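(* Let $\mathcal{F}$ denote the foliation on a neighborhood of $0\in\mathbb{C}^3$ associated to the vector field $$X = x(1 + x^2yz^3) \frac{\partial }{\partial x} + y(1 - x^2yz^3) \frac{\partial }{\partial y} - z \frac{\partial }{\partial z}.$$ The foliation $\mathcal{F}$ does not possess two independent holomorphic first integrals (though it possesses one non-constant holomorphic first integral). Besides, the holonomy map associated to the axis $\{x=y=0\}$ has finite orbits whereas it does not generate a finite subgroup of $\mathrm{Diff}(\mathbb{C}^2,0)$.
   Context: $\mathrm{Diff}(\mathbb{C}^2,0)$ is the group of germs of holomorphic diffeomorphisms of $\mathbb{C}^2$ fixing $0$. A holomorphic first integral of $\mathcal{F}$ is a holomorphic function $f$ defined near $0\in\mathbb{C}^3$ with $df(X)=0$; two first integrals $f_1,f_2$ are independent if $df_1\wedge df_2$ is not identically zero. The axis $\{x=y=0\}$ is invariant by $\mathcal{F}$ (a separatrix). The holonomy map $h\in\mathrm{Diff}(\mathbb{C}^2,0)$ associated to it is obtained by lifting the loop $z=e^{2\pi i t}$, $t\in[0,1]$, to the leaves of $\mathcal{F}$: $h$ sends $(x_0,y_0)$ to $(x(1),y(1))$, where $(x(t),y(t))$ solves $$x'=-2\pi i\,x(1+e^{6\pi i t}x^2y),\qquad y'=-2\pi i\,y(1-e^{6\pi i t}x^2y),\qquad (x(0),y(0))=(x_0,y_0).$$ For a small open neighborhood $V$ of $0\in\mathbb{C}^2$ on which $h^{\pm1}$ are defined and injective, the pseudogroup generated by $h$ on $V$ consists of the compositions $F_s\circ\cdots\circ F_1$, $F_i\in\{h,h^{-1}\}$,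 with domain the set of $p\in V$ with $F_l\circ\cdots\circ F_1(p)\in V$ for all $1\le l<s$. The orbit of $p\in V$ is the set of images in $V$ of $p$ under the elements whose domain contains $p$. The map $h$ has finite orbits if for some such sufficiently small $V$ the orbit of every $p\in V$ is finite. *)

(* Defs.v *)
From Stdlib Require Import Reals List.
From Coquelicot Require Export Coquelicot.

Open Scope C_scope.

(** The normed structures over [C] are fixed explicitly, because [C] also
    carries a structure of real normed module.  With them, [filterdiff] is
    complex Frechet differentiability. *)
Definition C2 : NormedModule C_AbsRing :=
  prod_NormedModule C_AbsRing C_NormedModule C_NormedModule.
Definition C3 : NormedModule C_AbsRing :=
  prod_NormedModule C_AbsRing C2 C_NormedModule.

Definition origin2 : C2 := (RtoC 0, RtoC 0).
Definition origin3 : C3 := (RtoC 0, RtoC 0, RtoC 0).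

(** [l] is the complex differential of [f] at [p]. *)
Definition is_differential {U V : NormedModule C_AbsRing}
    (f : U -> V) (p : U) (l : U -> V) : Prop :=
  filterdiff f (locally p) l.

Definition holomorphic_at {U V : NormedModule C_AbsRing}
    (f : U -> V) (p : U) : Prop :=
  exists l : U -> V, is_differential f p l.

(** Germs at [p] are represented by total functions, whose values away from
    [p] are irrelevant. *)
Definition holomorphic_near {U V : NormedModule C_AbsRing}
    (p : U) (f : U -> V) : Prop :=
  locally p (fun q => holomorphic_at f q).

Definition germ_eq {U V : NormedModule C_AbsRing}
    (p : U) (f g : U -> V) : Prop :=
  locally p (fun q => f q = g q).

(** * First integrals of a vector field near the origin of [C3] *)

Definition first_integral (X : C3 -> C3) (f : C3 -> C_NormedModule) : Prop :=
  holomorphic_near origin3 f /\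
  locally origin3 (fun p => forall l, is_differential f p l -> l (X p) = RtoC 0).

Definition constant_germ (f : C3 -> C_NormedModule) : Prop :=
  exists c : C, germ_eq origin3 f (fun _ => c).

(** [df1 /\ df2] vanishes at [p], as an alternating bilinear form. *)
Definition wedge_vanishes_at (f1 f2 : C3 -> C_NormedModule) (p : C3) : Prop :=
  forall l1 l2, is_differential f1 p l1 -> is_differential f2 p l2 ->
  forall u v : C3, l1 u * l2 v - l1 v * l2 u = RtoC 0.

Definition independent (f1 f2 : C3 -> C_NormedModule) : Prop :=
  ~ locally origin3 (wedge_vanishes_at f1 f2).

(** * Germs of holomorphic diffeomorphisms of [C2] fixing the origin *)

Definition inverse_germs (h g : C2 -> C2) : Prop :=
  h origin2 = origin2 /\ g origin2 = origin2 /\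
  holomorphic_near origin2 h /\ holomorphic_near origin2 g /\
  germ_eq origin2 (fun p => g (h p)) (fun p => p) /\
  germ_eq origin2 (fun p => h (g p)) (fun p => p).

Definition is_Diff (h : C2 -> C2) : Prop := exists g, inverse_germs h g.

(** A word [F_1; ...; F_s] in the letters [h] ([true]) and [g] ([false]) acts
    as [F_s o ... o F_1]: the head of the list is applied first. *)
Fixpoint word_map (h g : C2 -> C2) (w : list bool) (p : C2) : C2 :=
  match w with
  | nil => p
  | b :: w' => word_map h g w' (if b then h p else g p)
  end.

(** Up to equality of germs, the words in [h] and its inverse are the elements
    of the subgroup generated by [h]. *)
Definition generates_finite_subgroup (h : C2 -> C2) : Prop :=
  exists g, inverse_germs h g /\
  exists L : list (C2 -> C2),
    forall w, exists k, In k L /\ germ_eq origin2 (word_map h g w) k.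

(** * Pseudogroup and orbits *)

Definition injective_on (V : C2 -> Prop) (f : C2 -> C2) : Prop :=
  forall p q, V p -> V q -> f p = f q -> p = q.

(** [V] is an open neighborhood of the origin on which [h] and its inverse [g]
    are defined and injective. *)
Definition admissible (h g : C2 -> C2) (V : C2 -> Prop) : Prop :=
  open V /\ V origin2 /\
  (forall p, V p -> holomorphic_at h p /\ holomorphic_at g p) /\
  (forall p, V p -> g (h p) = p /\ h (g p) = p) /\
  injective_on V h /\ injective_on V g.

(** Domain of the element of the pseudogroup given by the word [w]. *)
Definition in_domain (h g : C2 -> C2) (V : C2 -> Prop) (w : list bool)
    (p : C2) : Prop :=
  V p /\
  forall l : nat, (1 <= l < length w)%nat -> V (word_map h g (firstn l w) p).

Definition orbit (h g : C2 -> C2) (V : C2 -> Prop) (p q : C2) : Prop :=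
  V q /\ exists w, in_domain h g V w p /\ word_map h g w p = q.

(** Orbits shrink when [V] does, so the existence of one admissible [V] with
    finite orbits gives arbitrarily small ones. *)
Definition has_finite_orbits (h : C2 -> C2) : Prop :=
  exists (g : C2 -> C2) (V : C2 -> Prop),
    admissible h g V /\
    forall p, V p -> exists L : list C2, forall q, orbit h g V p q -> In q L.

(** * The vector field and the holonomy of the axis [x = y = 0] *)

Definition X (p : C3) : C3 :=
  let '(x, y, z) := p in
  (x * (1 + x * x * y * (z * z * z)),
   y * (1 - x * x * y * (z * z * z)),
   - z).

(** [exp (i theta)] *)
Definition cis (theta : R) : C := (cos theta, sin theta).

(** The lift to the leaves of [X] of the loop [z = exp (2 pi i t)] that starts
    over [p] ends over [q].  The derivative is two-sided also at [t = 0] and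
    [t = 1]: this is no restriction, since only the values on [0, 1] matter and
    a one-sided solution extends affinely at both ends. *)
Definition holonomy_lift (p q : C2) : Prop :=
  exists x y : R -> C,
    (x 0%R, y 0%R) = p /\ (x 1%R, y 1%R) = q /\
    forall t : R, (0 <= t <= 1)%R ->
      is_derive (K := R_AbsRing) (V := C_R_NormedModule) x t
        (- (2 * PI * Ci) * x t * (1 + cis (6 * PI * t) * (x t * x t) * y t)) /\
      is_derive (K := R_AbsRing) (V := C_R_NormedModule) y t
        (- (2 * PI * Ci) * y t * (1 - cis (6 * PI * t) * (x t * x t) * y t)).

(** [h] represents the germ of the holonomy map. *)
Definition is_holonomy (h : C2 -> C2) : Prop :=
  locally origin2 (fun p => holonomy_lift p (h p)).

(* Main.v *)
Require Import Defs.
From Stdlib Require Import Reals List Lra Lia Psatz ClassicalEpsilon FinFun.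
From Coquelicot Require Import Coquelicot.
Local Open Scope C_scope.

(** The function [x y z^2] is a first integral of [X], and [w = x^2 y z^3]
    satisfies [w' = w^2] along its trajectories, so the flow is explicit.

    The holonomy.  On the loop [z = exp (2 pi i t)] this gives the holonomy map
    in closed form: [h (x, y) = (x / (1 + c w), y (1 + c w))] with [c = 2 pi i] and
    [w = x^2 y] ([shear_is_lift], and [lift_is_shear] for uniqueness).  Its [k]-th
    iterate is given by the same formula with [k c] in place of [c].  Hence [h] has
    infinite order.  Yet its orbits in a bounded neighborhood are finite: a point
    with [w = 0] is fixed, and otherwise [y (1 + k c w)] is unbounded in [k].

    The first integrals.  Every first integral [f] is near 0 a function of
    [x y z^2] alone ([first_integral_factor]), so that two of them have proportional
    differentials.  Consider a bounded first integral [g] on a polydisc deprived of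
    the coordinate planes.  By Riemann's theorem on removable singularities it has
    limits at these planes, with a linear rate ([removable_estimate]).  Turning [n]
    times around [z = 0] maps [(x, y, z)] to [(x / l, l y, z)] with [l = 1 - c n w],
    for the value of [w] at the starting point.  Let [x] tend to 0 and [n] to
    infinity in such a way that [n w] is fixed: the limit at [x = 0] does not change
    when [y] is multiplied by [l] ([x_limit_invariant]).  This is where the nonlinear
    term of [X] enters, since its linear part has the two integrals [x z] and [y z].  Thus [g] tends to one constant [c0] at [x = 0] and at [y = 0]
    ([common_limit]), and [g - c0 = O(x y)]; transported by the backward real flow,
    which multiplies [x y] by [s^2] and divides [z] by [s], this becomes
    [g - c0 = O(x y z^2)] ([xyz2_estimate]).  Applied to [g = f - phi(x y z^2)],
    where [phi] is such that [g] vanishes on a line, and then to the successive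
    quotients by [x y z^2], the estimate holds with the same constants at each step
    and yields [|g| <= M (K |x y z^2|)^n] for all [n] ([flat_power]): [g] is zero near
    the origin.

    Complex differentiability is pointwise, so the one-variable theory starts from
    Goursat's bisection argument, carried out in polar coordinates
    ([boundary_vanish]); it gives [Cauchy_formula] and then [removable_estimate]. *)

(** * Inequalities for the modulus *)

Lemma Cmod_sub_sym (a b : C) : Cmod (a - b) = Cmod (b - a).
Proof. rewrite <- Cmod_opp. f_equal. ring. Qed.

Lemma Cmod_triangle_sub (a b : C) : (Cmod (a - b) <= Cmod a + Cmod b)%R.
Proof. unfold Cminus. rewrite <- (Cmod_opp b). apply Cmod_triangle. Qed.

Lemma Cmod_triangle_rev (a b : C) : (Cmod a - Cmod b <= Cmod (a - b))%R.
Proof.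
  pose proof (Cmod_triangle (a - b) b) as H.
  replace (a - b + b) with a in H by ring. lra.
Qed.

Lemma C_minus_eq_0 (a b : C) : a - b = 0 -> a = b.
Proof. intros H. replace a with (a - b + b) by ring. rewrite H. ring. Qed.

(** * Functions of a real variable with complex values *)

(** Fixing the types once keeps numerals and operations on [C] readable, which
    the structure projections of [C_R_NormedModule] would hide. *)
Definition is_deriv_RC (f : R -> C) (t : R) (l : C) : Prop :=
  is_derive (K := R_AbsRing) (V := C_R_NormedModule) f t l.

Lemma continuous_RC (f : R -> C) (t : R) :
  continuous f t <->
  forall eps : R, (0 < eps)%R -> exists del : R, (0 < del)%R /\
    forall t', (Rabs (t' - t) < del)%R -> (Cmod (f t' - f t) < eps)%R.
Proof.
  split.
  - intros H eps He.
    assert (He' : (0 < eps / sqrt 2)%R).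
    { apply Rdiv_lt_0_compat; auto. apply Rlt_sqrt2_0. }
    destruct (proj1 (filterlim_locally _ _) H (mkposreal _ He')) as [d Hd].
    exists d; split; [apply cond_pos|]. intros t' Ht'.
    specialize (Hd t' Ht').
    apply (C_NormedModule_mixin_compat2 (f t) (f t') (mkposreal _ He')) in Hd.
    simpl in Hd. replace (sqrt 2 * (eps / sqrt 2))%R with eps in Hd.
    exact Hd. field. apply Rgt_not_eq, Rlt_sqrt2_0.
  - intros H. apply filterlim_locally. intros eps.
    destruct (H eps (cond_pos eps)) as [d [Hd Hd']].
    exists (mkposreal d Hd). intros t' Ht'.
    apply C_NormedModule_mixin_compat1. apply Hd'. exact Ht'.
Qed.

Lemma is_deriv_RC_eps (f : R -> C) (t : R) (l : C) :
  is_deriv_RC f t l <->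
  forall eps : R, (0 < eps)%R -> exists del : R, (0 < del)%R /\
    forall t', (Rabs (t' - t) < del)%R ->
      (Cmod (f t' - f t - (t' - t)%R * l) <= eps * Rabs (t' - t))%R.
Proof.
  split.
  - intros [_ H] eps He.
    destruct (H t (fun P h => h) (mkposreal eps He)) as [d Hd].
    exists d; split; [apply cond_pos|]. intros t' Ht'.
    specialize (Hd t' Ht'). simpl in Hd.
    rewrite <- Cmod_norm, scal_R_Cmult in Hd. exact Hd.
  - intros H. split; [apply is_linear_scal_l|].
    intros x Hx eps. apply (is_filter_lim_locally_unique (V := AbsRing_NormedModule R_AbsRing)) in Hx. subst x.
    destruct (H eps (cond_pos eps)) as [d [Hd Hd']].
    exists (mkposreal d Hd). intros t' Ht'.
    rewrite <- Cmod_norm, scal_R_Cmult. apply (Hd' t' Ht').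
Qed.

Lemma is_deriv_RC_pair (u v : R -> R) (t du dv : R) :
  is_derive u t du -> is_derive v t dv ->
  is_deriv_RC (fun s => (u s, v s) : C) t (du, dv).
Proof.
  intros Hu Hv. apply is_deriv_RC_eps. intros eps He.
  assert (He2 : (0 < eps / 2)%R) by lra.
  destruct Hu as [_ Hu], Hv as [_ Hv].
  destruct (Hu t (fun P h => h) (mkposreal _ He2)) as [d1 H1].
  destruct (Hv t (fun P h => h) (mkposreal _ He2)) as [d2 H2].
  exists (Rmin d1 d2). split; [apply Rmin_case; apply cond_pos|].
  intros s Hs.
  specialize (H1 s (Rlt_le_trans _ _ _ Hs (Rmin_l _ _))).
  specialize (H2 s (Rlt_le_trans _ _ _ Hs (Rmin_r _ _))).
  unfold minus, plus, opp, scal, norm in H1, H2. simpl in H1, H2.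
  unfold abs, mult in H1, H2; simpl in H1, H2.
  replace ((u s, v s) - (u t, v t) - (s - t)%R * (du, dv)) with
    (RtoC (u s + - u t + - ((s + - t) * du))%R +
     Ci * RtoC (v s + - v t + - ((s + - t) * dv))%R).
  2:{ apply injective_projections; simpl; ring. }
  eapply Rle_trans; [apply Cmod_triangle|].
  rewrite Cmod_mult, Cmod_Ci, !Cmod_R. unfold Rminus in *. lra.
Qed.

Lemma is_deriv_RC_fst (f : R -> C) (t : R) (l : C) :
  is_deriv_RC f t l -> is_derive (fun s => fst (f s)) t (fst l).
Proof.
  intros H. split; [apply is_linear_scal_l|].
  intros x Hx eps. apply (is_filter_lim_locally_unique (V := AbsRing_NormedModule R_AbsRing)) in Hx. subst x.
  destruct (proj1 (is_deriv_RC_eps _ _ _) H eps (cond_pos eps)) as [d [Hd Hd']].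
  exists (mkposreal d Hd). intros s Hs. specialize (Hd' s Hs).
  eapply Rle_trans; [|exact Hd']. eapply Rle_trans; [|apply re_le_Cmod].
  apply Req_le. unfold norm; simpl. unfold abs; simpl. f_equal.
  unfold minus, plus, opp, scal; simpl. unfold mult; simpl. ring.
Qed.

Lemma is_deriv_RC_snd (f : R -> C) (t : R) (l : C) :
  is_deriv_RC f t l -> is_derive (fun s => snd (f s)) t (snd l).
Proof.
  intros H. split; [apply is_linear_scal_l|].
  intros x Hx eps. apply (is_filter_lim_locally_unique (V := AbsRing_NormedModule R_AbsRing)) in Hx. subst x.
  destruct (proj1 (is_deriv_RC_eps _ _ _) H eps (cond_pos eps)) as [d [Hd Hd']].
  exists (mkposreal d Hd). intros s Hs. specialize (Hd' s Hs).
  eapply Rle_trans; [|exact Hd'].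
  eapply Rle_trans; [|eapply Rle_trans; [|apply Rmax_Cmod]].
  2: apply Rmax_r.
  apply Req_le. unfold norm; simpl. unfold abs; simpl. f_equal.
  unfold minus, plus, opp, scal; simpl. unfold mult; simpl. ring.
Qed.

Lemma is_deriv_RC_eq (f : R -> C) (t : R) (l l' : C) :
  is_deriv_RC f t l -> l = l' -> is_deriv_RC f t l'.
Proof. intros H <-. exact H. Qed.

Lemma is_deriv_RC_const (c : C) (t : R) : is_deriv_RC (fun _ => c) t 0.
Proof. apply (is_derive_const (V := C_R_NormedModule) c t). Qed.

Lemma is_deriv_RC_R (t : R) : is_deriv_RC (fun s => RtoC s) t 1.
Proof.
  apply (is_deriv_RC_pair (fun s => s) (fun _ => 0%R)).
  apply (is_derive_id t). apply (is_derive_const 0%R t).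
Qed.

Lemma is_deriv_RC_plus (f g : R -> C) (t : R) (l m : C) :
  is_deriv_RC f t l -> is_deriv_RC g t m ->
  is_deriv_RC (fun s => f s + g s) t (l + m).
Proof.
  intros Hf Hg. exact (is_derive_plus (V := C_R_NormedModule) f g t l m Hf Hg).
Qed.

Lemma is_deriv_RC_mult (f g : R -> C) (t : R) (l m : C) :
  is_deriv_RC f t l -> is_deriv_RC g t m ->
  is_deriv_RC (fun s => f s * g s) t (l * g t + f t * m).
Proof.
  intros Hf Hg.
  pose proof (is_deriv_RC_fst _ _ _ Hf) as F1.
  pose proof (is_deriv_RC_snd _ _ _ Hf) as F2.
  pose proof (is_deriv_RC_fst _ _ _ Hg) as G1.
  pose proof (is_deriv_RC_snd _ _ _ Hg) as G2.
  eapply is_deriv_RC_eq.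
  - apply (is_deriv_RC_pair
      (fun s => fst (f s) * fst (g s) - snd (f s) * snd (g s))%R
      (fun s => fst (f s) * snd (g s) + snd (f s) * fst (g s))%R).
    + apply (is_derive_minus (V := R_NormedModule)); apply Derive.is_derive_mult; eassumption.
    + apply (is_derive_plus (V := R_NormedModule)); apply Derive.is_derive_mult; eassumption.
  - unfold minus, plus, opp; simpl.
    apply injective_projections; simpl; ring.
Qed.

Lemma is_deriv_RC_inv (f : R -> C) (t : R) (l : C) :
  is_deriv_RC f t l -> f t <> 0 ->
  is_deriv_RC (fun s => / f s) t (- l / (f t * f t)).
Proof.
  intros Hf Hn.
  pose proof (is_deriv_RC_fst _ _ _ Hf) as F1.
  pose proof (is_deriv_RC_snd _ _ _ Hf) as F2.
  assert (Hm : (fst (f t) ^ 2 + snd (f t) ^ 2 <> 0)%R).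
  { intros E. apply Hn. apply injective_projections; simpl; nra. }
  eapply is_deriv_RC_eq.
  - apply (is_deriv_RC_pair
      (fun s => fst (f s) / (fst (f s) ^ 2 + snd (f s) ^ 2))%R
      (fun s => - snd (f s) / (fst (f s) ^ 2 + snd (f s) ^ 2))%R).
    + apply is_derive_div; [exact F1| |exact Hm].
      apply (is_derive_plus (V := R_NormedModule)); apply is_derive_pow; eassumption.
    + apply is_derive_div; [apply (is_derive_opp (V := R_NormedModule)); exact F2| |exact Hm].
      apply (is_derive_plus (V := R_NormedModule)); apply is_derive_pow; eassumption.
  - unfold plus, opp; simpl.
    destruct (f t) as [a b]; destruct l as [p q]; simpl in *.
    assert (Hm' : (a * a + b * b <> 0)%R) by nra.
    assert (Hm2 : ((a * a - b * b) * (a * a - b * b) + (a * b + b * a) * (a * b + b * a) <> 0)%R).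
    { replace ((a * a - b * b) * (a * a - b * b) + (a * b + b * a) * (a * b + b * a))%R
        with ((a * a + b * b) * (a * a + b * b))%R by ring.
      apply Rmult_integral_contrapositive; auto. }
    apply injective_projections; simpl; field; repeat split; try nra;
    rewrite ?Rmult_1_r; auto.
Qed.

Lemma is_deriv_RC_cis (a t : R) :
  is_deriv_RC (fun s => cis (a * s)) t (RtoC a * Ci * cis (a * t)).
Proof.
  eapply is_deriv_RC_eq.
  - apply (is_deriv_RC_pair (fun s => cos (a * s)) (fun s => sin (a * s)))%R.
    + apply (is_derive_comp cos (fun s => a * s)%R).
      apply is_derive_cos. apply is_derive_scal. apply is_derive_id.
    + apply (is_derive_comp sin (fun s => a * s)%R).
      apply is_derive_sin. apply is_derive_scal. apply is_derive_id.
  - unfold scal, one; simpl. unfold mult; simpl.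
    apply injective_projections; simpl; ring.
Qed.

Lemma is_deriv_RC_zero_const (f : R -> C) (a b : R) :
  (a <= b)%R -> (forall t, (a <= t <= b)%R -> is_deriv_RC f t 0) -> f a = f b.
Proof.
  intros Hab H. destruct (Req_dec a b) as [->|Hn]; auto.
  apply (eq_is_derive (V := C_R_NormedModule) f a b); [exact H|lra].
Qed.

Lemma is_deriv_RC_continuous (f : R -> C) (t : R) (l : C) :
  is_deriv_RC f t l -> continuous f t.
Proof.
  intros H. apply (ex_derive_continuous (V := C_R_NormedModule)). exists l. exact H.
Qed.

Lemma continuous_RC_pair (u v : R -> R) (t : R) :
  continuous u t -> continuous v t -> continuous (fun s => (u s, v s) : C) t.
Proof.
  intros Hu Hv. apply filterlim_locally. intros eps.
  generalize (filter_and _ _ (proj1 (filterlim_locally _ _) Hu eps)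
                             (proj1 (filterlim_locally _ _) Hv eps)).
  apply filter_imp. intros s [H1 H2]. split; assumption.
Qed.

Lemma continuous_RC_mult (f g : R -> C) (t : R) :
  continuous f t -> continuous g t -> continuous (fun s => f s * g s) t.
Proof.
  intros Hf Hg.
  assert (F1 : continuous (fun s => fst (f s)) t) by (apply (continuous_comp f fst); [exact Hf|apply continuous_fst]).
  assert (F2 : continuous (fun s => snd (f s)) t) by (apply (continuous_comp f snd); [exact Hf|apply continuous_snd]).
  assert (G1 : continuous (fun s => fst (g s)) t) by (apply (continuous_comp g fst); [exact Hg|apply continuous_fst]).
  assert (G2 : continuous (fun s => snd (g s)) t) by (apply (continuous_comp g snd); [exact Hg|apply continuous_snd]).
  apply (continuous_RC_pair
   (fun s => fst (f s) * fst (g s) - snd (f s) * snd (g s))%R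
   (fun s => fst (f s) * snd (g s) + snd (f s) * fst (g s))%R).
  - apply (continuous_minus (V := R_NormedModule)); apply (continuous_mult (K := R_AbsRing)); auto.
  - apply (continuous_plus (V := R_NormedModule)); apply (continuous_mult (K := R_AbsRing)); auto.
Qed.

Lemma continuous_RC_plus (f g : R -> C) (t : R) :
  continuous f t -> continuous g t -> continuous (fun s => f s + g s) t.
Proof. intros Hf Hg. apply (continuous_plus (V := C_R_NormedModule)); assumption. Qed.

(** * Integrals of complex-valued functions *)

Definition is_CInt (f : R -> C) (a b : R) (l : C) : Prop :=
  is_RInt (V := C_R_NormedModule) f a b l.

Definition CInt (f : R -> C) (a b : R) : C :=
  RInt (V := C_R_CompleteNormedModule) f a b.

Lemma CInt_unique f a b l : is_CInt f a b l -> CInt f a b = l.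
Proof. apply (is_RInt_unique (V := C_R_CompleteNormedModule)). Qed.

Lemma CInt_correct (f : R -> C) (a b : R) :
  (a <= b)%R -> (forall t, (a <= t <= b)%R -> continuous f t) ->
  is_CInt f a b (CInt f a b).
Proof.
  intros Hab H. apply (RInt_correct (V := C_R_CompleteNormedModule)).
  apply (ex_RInt_continuous (V := C_R_CompleteNormedModule)).
  rewrite Rmin_left, Rmax_right; auto.
Qed.

Lemma is_CInt_plus f g a b l m :
  is_CInt f a b l -> is_CInt g a b m -> is_CInt (fun t => f t + g t) a b (l + m).
Proof. intros; apply (is_RInt_plus (V := C_R_NormedModule)); assumption. Qed.

Lemma is_CInt_minus f g a b l m :
  is_CInt f a b l -> is_CInt g a b m -> is_CInt (fun t => f t - g t) a b (l - m).
Proof. intros; apply (is_RInt_minus (V := C_R_NormedModule)); assumption. Qed.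

Lemma is_CInt_scal c f a b l :
  is_CInt f a b l -> is_CInt (fun t => c * f t) a b (c * l).
Proof.
  intros H.
  pose proof (is_RInt_fct_extend_fst _ _ _ _ H) as H1.
  pose proof (is_RInt_fct_extend_snd _ _ _ _ H) as H2.
  apply is_RInt_fct_extend_pair; simpl.
  - apply (is_RInt_minus (V := R_NormedModule));
    apply (is_RInt_scal (V := R_NormedModule)); assumption.
  - apply (is_RInt_plus (V := R_NormedModule));
    apply (is_RInt_scal (V := R_NormedModule)); assumption.
Qed.

Lemma is_CInt_ext f g a b l :
  (a <= b)%R -> (forall t, (a <= t <= b)%R -> f t = g t) ->
  is_CInt f a b l -> is_CInt g a b l.
Proof.
  intros Hab H. apply is_RInt_ext. rewrite Rmin_left, Rmax_right; auto.
  intros; apply H; lra.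
Qed.

Lemma is_CInt_Chasles f a b c l m :
  is_CInt f a b l -> is_CInt f b c m -> is_CInt f a c (l + m).
Proof. apply (is_RInt_Chasles (V := C_R_NormedModule)). Qed.

Lemma is_CInt_bound f a b l M :
  (a <= b)%R -> (forall t, (a <= t <= b)%R -> (Cmod (f t) <= M)%R) ->
  is_CInt f a b l -> (Cmod l <= (b - a) * M)%R.
Proof.
  intros Hab H Hi. rewrite Cmod_norm.
  apply (norm_RInt_le_const (V := C_R_NormedModule) f a b l M Hab); auto.
  intros t Ht. rewrite <- Cmod_norm. auto.
Qed.

Lemma is_CInt_deriv (f df : R -> C) (a b : R) :
  (a <= b)%R ->
  (forall t, (a <= t <= b)%R -> is_deriv_RC f t (df t)) ->
  (forall t, (a <= t <= b)%R -> continuous df t) ->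
  is_CInt df a b (f b - f a).
Proof.
  intros Hab H1 H2.
  apply (is_RInt_derive (V := C_R_CompleteNormedModule) f df a b);
  rewrite Rmin_left, Rmax_right; auto.
Qed.

(** * Goursat's bisection argument *)

Lemma nested_intervals (a b : nat -> R) :
  (forall n, a n <= a (S n))%R -> (forall n, b (S n) <= b n)%R ->
  (forall n, a n <= b n)%R ->
  exists s, forall n, (a n <= s <= b n)%R.
Proof.
  intros Ha Hb Hab.
  assert (Ha' : forall n m, (n <= m)%nat -> (a n <= a m)%R).
  { intros n m H; induction H; [lra|]. specialize (Ha m). lra. }
  assert (Hb' : forall n m, (n <= m)%nat -> (b m <= b n)%R).
  { intros n m H; induction H; [lra|]. specialize (Hb m). lra. }
  assert (H : forall n m, (a n <= b m)%R).
  { intros n m. destruct (Nat.le_ge_cases n m) as [L|L].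
    - specialize (Ha' _ _ L). specialize (Hab m). lra.
    - specialize (Hb' _ _ L). specialize (Hab n). lra. }
  destruct (completeness (fun x => exists n, x = a n)) as [s [Hs1 Hs2]].
  - exists (b O). intros x [n ->]. apply H.
  - exists (a O); exists O; reflexivity.
  - exists s. intros n. split.
    + apply Hs1. exists n; reflexivity.
    + apply Hs2. intros x [m ->]. apply H.
Qed.

(** Among the four quarters of a rectangle one carries at least a quarter of
    the modulus of [I], while the square of the size is also divided by four.
    The nested rectangles so obtained shrink to a point at which the local bound
    fails, unless [I] vanishes. *)
Lemma bisection_vanish (I : R -> R -> R -> R -> C) (a0 b0 c0 d0 : R) :
  (a0 <= b0)%R -> (c0 <= d0)%R ->
  (forall a m b c d, (a0 <= a <= m)%R -> (m <= b <= b0)%R ->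
     (c0 <= c <= d)%R -> (d <= d0)%R -> I a b c d = I a m c d + I m b c d) ->
  (forall a b c m d, (a0 <= a <= b)%R -> (b <= b0)%R ->
     (c0 <= c <= m)%R -> (m <= d <= d0)%R -> I a b c d = I a b c m + I a b m d) ->
  (forall s t eps, (a0 <= s <= b0)%R -> (c0 <= t <= d0)%R -> (0 < eps)%R ->
     exists del, (0 < del)%R /\ forall a b c d,
       (a0 <= a <= s)%R -> (s <= b <= b0)%R -> (c0 <= c <= t)%R -> (t <= d <= d0)%R ->
       (b - a < del)%R -> (d - c < del)%R ->
       (Cmod (I a b c d) <= eps * ((b - a) + (d - c)) ^ 2)%R) ->
  I a0 b0 c0 d0 = 0.
Proof.
  intros Hab Hcd Add1 Add2 Loc.
  apply Cmod_eq_0. apply NNPP. intros Hne.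
  pose proof (Cmod_ge_0 (I a0 b0 c0 d0)) as Hge.
  set (N := Cmod (I a0 b0 c0 d0)) in *.
  assert (HN : (0 < N)%R) by lra. clear Hge Hne.
  set (sz := ((b0 - a0) + (d0 - c0))%R).
  (* the [+ 1] keeps the quotient meaningful for a rectangle reduced to a point *)
  set (eps := (N / (2 * (sz ^ 2 + 1)))%R).
  assert (Hsz : (0 < 2 * (sz ^ 2 + 1))%R) by nra.
  assert (Heps : (0 < eps)%R) by (apply Rdiv_lt_0_compat; auto).
  set (Bad := fun Q : (R * R) * (R * R) => let '((a, b), (c, d)) := Q in
    (a0 <= a <= b)%R /\ (b <= b0)%R /\ (c0 <= c <= d)%R /\ (d <= d0)%R /\
    (eps * ((b - a) + (d - c)) ^ 2 < Cmod (I a b c d))%R).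
  set (Half := fun Q Q' : (R * R) * (R * R) => let '((a, b), (c, d)) := Q in
    let '((a', b'), (c', d')) := Q' in
    (a <= a')%R /\ (b' <= b)%R /\ (c <= c')%R /\ (d' <= d)%R /\
    (b' - a' = (b - a) / 2)%R /\ (d' - c' = (d - c) / 2)%R).
  assert (Step : forall Q, exists Q', Bad Q -> Bad Q' /\ Half Q Q').
  { intros [[a b] [c d]].
    destruct (classic (Bad ((a, b), (c, d)))) as [HB|HB]; [|exists ((a, b), (c, d)); tauto].
    destruct HB as (B1 & B2 & B3 & B4 & B5).
    set (m := ((a + b) / 2)%R). set (k := ((c + d) / 2)%R).
    assert (Hm : (a <= m <= b)%R) by (unfold m; lra).
    assert (Hk : (c <= k <= d)%R) by (unfold k; lra).
    assert (Hsum : I a b c d = (I a m c k + I a m k d) + (I m b c k + I m b k d)).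
    { rewrite (Add1 a m b c d), (Add2 a m c k d), (Add2 m b c k d); auto; lra. }
    assert (HC : (Cmod (I a b c d) <=
      (Cmod (I a m c k) + Cmod (I a m k d)) + (Cmod (I m b c k) + Cmod (I m b k d)))%R).
    { rewrite Hsum. eapply Rle_trans; [apply Cmod_triangle|].
      apply Rplus_le_compat; apply Cmod_triangle. }
    assert (E1 : (m - a = (b - a) / 2)%R) by (unfold m; lra).
    assert (E2 : (b - m = (b - a) / 2)%R) by (unfold m; lra).
    assert (E3 : (k - c = (d - c) / 2)%R) by (unfold k; lra).
    assert (E4 : (d - k = (d - c) / 2)%R) by (unfold k; lra).
    set (q := (eps * ((b - a) / 2 + (d - c) / 2) ^ 2)%R).
    assert (Hq : (eps * ((b - a) + (d - c)) ^ 2 = 4 * q)%R) by (unfold q; field).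
    rewrite Hq in B5.
    destruct (Rlt_dec q (Cmod (I a m c k))).
    { exists ((a, m), (c, k)). intros _. unfold Bad, Half. rewrite E1, E3.
      fold q. repeat split; lra. }
    destruct (Rlt_dec q (Cmod (I a m k d))).
    { exists ((a, m), (k, d)). intros _. unfold Bad, Half. rewrite E1, E4.
      fold q. repeat split; lra. }
    destruct (Rlt_dec q (Cmod (I m b c k))).
    { exists ((m, b), (c, k)). intros _. unfold Bad, Half. rewrite E2, E3.
      fold q. repeat split; lra. }
    destruct (Rlt_dec q (Cmod (I m b k d))).
    { exists ((m, b), (k, d)). intros _. unfold Bad, Half. rewrite E2, E4.
      fold q. repeat split; lra. }
    exfalso; lra. }
  set (next := fun Q => proj1_sig (constructive_indefinite_description _ (Step Q))).
  assert (Hnext : forall Q, Bad Q -> Bad (next Q) /\ Half Q (next Q)).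
  { intros Q. exact (proj2_sig (constructive_indefinite_description _ (Step Q))). }
  set (Q := fix Q n := match n with O => ((a0, b0), (c0, d0)) | S n => next (Q n) end).
  assert (HBad : forall n, Bad (Q n)).
  { induction n; [|apply Hnext; auto]. simpl. repeat split; try lra.
    fold N sz. unfold eps. apply Rlt_le_trans with (N * 1)%R; [|lra].
    unfold Rdiv. rewrite Rmult_assoc. apply Rmult_lt_compat_l; auto.
    apply Rmult_lt_reg_l with (2 * (sz ^ 2 + 1))%R; auto.
    rewrite <- Rmult_assoc, Rinv_r, Rmult_1_l; [|lra]. nra. }
  assert (HHalf : forall n, Half (Q n) (Q (S n))) by (intros n; apply Hnext; auto).
  clearbody Q.
  destruct (nested_intervals (fun n => fst (fst (Q n))) (fun n => snd (fst (Q n)))) as [s Hs].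
  { intros n. specialize (HHalf n). destruct (Q n) as [[a b] [c d]], (Q (S n)) as [[a' b'] [c' d']].
    simpl in *. lra. }
  { intros n. specialize (HHalf n). destruct (Q n) as [[a b] [c d]], (Q (S n)) as [[a' b'] [c' d']].
    simpl in *. lra. }
  { intros n. specialize (HBad n). destruct (Q n) as [[a b] [c d]]. simpl in *. lra. }
  destruct (nested_intervals (fun n => fst (snd (Q n))) (fun n => snd (snd (Q n)))) as [t Ht].
  { intros n. specialize (HHalf n). destruct (Q n) as [[a b] [c d]], (Q (S n)) as [[a' b'] [c' d']].
    simpl in *. lra. }
  { intros n. specialize (HHalf n). destruct (Q n) as [[a b] [c d]], (Q (S n)) as [[a' b'] [c' d']].
    simpl in *. lra. }
  { intros n. specialize (HBad n). destruct (Q n) as [[a b] [c d]]. simpl in *. lra. }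
  assert (HW : forall n, (snd (fst (Q n)) - fst (fst (Q n)) =
      (snd (fst (Q O)) - fst (fst (Q O))) * (/ 2) ^ n)%R /\
      (snd (snd (Q n)) - fst (snd (Q n)) =
      (snd (snd (Q O)) - fst (snd (Q O))) * (/ 2) ^ n)%R).
  { induction n; [simpl; lra|]. specialize (HHalf n).
    destruct (Q n) as [[a b] [c d]], (Q (S n)) as [[a' b'] [c' d']].
    simpl in *. destruct IHn. lra. }
  destruct (Loc s t eps) as [del [Hdel HL]]; auto.
  { specialize (Hs O). specialize (HBad O). destruct (Q O) as [[a b] [c d]]. simpl in *. lra. }
  { specialize (Ht O). specialize (HBad O). destruct (Q O) as [[a b] [c d]]. simpl in *. lra. }
  set (W := ((snd (fst (Q O)) - fst (fst (Q O))) + (snd (snd (Q O)) - fst (snd (Q O))))%R) in *.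
  assert (HW0 : (0 <= snd (fst (Q O)) - fst (fst (Q O)))%R /\ (0 <= snd (snd (Q O)) - fst (snd (Q O)))%R).
  { specialize (HBad O). destruct (Q O) as [[a b] [c d]]. simpl in *. lra. }
  destruct (pow_lt_1_zero (/ 2) (Rabs_def1 (/ 2) 1 ltac:(lra) ltac:(lra)) (del / (W + 1))) as [n Hn].
  { apply Rdiv_lt_0_compat; auto. unfold W; lra. }
  specialize (Hn n (le_n _)). rewrite Rabs_pos_eq in Hn by (apply pow_le; lra).
  destruct (HW n) as [W1 W2]. specialize (Hs n). specialize (Ht n). specialize (HBad n).
  assert (Hp : (0 <= (/ 2) ^ n)%R) by (apply pow_le; lra).
  set (p := ((/ 2) ^ n)%R) in *.
  assert (Hp2 : ((W + 1) * p < del)%R).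
  { apply Rmult_lt_reg_r with (/ (W + 1))%R. apply Rinv_0_lt_compat; unfold W; lra.
    replace ((W + 1) * p * / (W + 1))%R with p by (field; unfold W; lra). exact Hn. }
  destruct (Q n) as [[a b] [c d]]. simpl in *. destruct HBad as (B1 & B2 & B3 & B4 & B5).
  apply (Rlt_irrefl (Cmod (I a b c d))). eapply Rle_lt_trans; [|exact B5].
  unfold W in Hp2. apply HL; lra.
Qed.

(** * Complex differentiability in one variable *)

(** Only a pointwise derivative is required: its continuity is a consequence of
    Cauchy's theory, hence not available at this stage. *)
Definition cdiff (f : C -> C) (z l : C) : Prop :=
  forall eps, (0 < eps)%R -> exists del, (0 < del)%R /\
    forall z', (Cmod (z' - z) < del)%R ->
      (Cmod (f z' - f z - l * (z' - z)) <= eps * Cmod (z' - z))%R.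

Lemma cdiff_continuous f z l : cdiff f z l ->
  forall eps, (0 < eps)%R -> exists del, (0 < del)%R /\
    forall z', (Cmod (z' - z) < del)%R -> (Cmod (f z' - f z) < eps)%R.
Proof.
  intros H eps He. destruct (H 1%R Rlt_0_1) as [d [Hd Hd']].
  pose proof (Cmod_ge_0 l) as Hl.
  exists (Rmin d (eps / (Cmod l + 2))). split.
  { apply Rmin_case; auto. apply Rdiv_lt_0_compat; lra. }
  intros z' Hz. specialize (Hd' z' (Rlt_le_trans _ _ _ Hz (Rmin_l _ _))).
  pose proof (Rlt_le_trans _ _ _ Hz (Rmin_r _ _)) as Hz2.
  replace (f z' - f z) with ((f z' - f z - l * (z' - z)) + l * (z' - z)) by ring.
  eapply Rle_lt_trans; [apply Cmod_triangle|]. rewrite Cmod_mult.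
  apply Rle_lt_trans with ((Cmod l + 1) * Cmod (z' - z))%R; [lra|].
  apply Rle_lt_trans with ((Cmod l + 1) * (eps / (Cmod l + 2)))%R.
  { apply Rmult_le_compat_l; lra. }
  replace ((Cmod l + 1) * (eps / (Cmod l + 2)))%R
    with (eps * ((Cmod l + 1) / (Cmod l + 2)))%R by (field; lra).
  rewrite <- (Rmult_1_r eps) at 2. apply Rmult_lt_compat_l; auto.
  apply Rmult_lt_reg_r with (Cmod l + 2)%R; [lra|].
  replace ((Cmod l + 1) / (Cmod l + 2) * (Cmod l + 2))%R with (Cmod l + 1)%R by (field; lra).
  lra.
Qed.

Lemma cdiff_comp_continuous f g t l :
  cdiff f (g t) l -> continuous g t -> continuous (fun s : R => f (g s)) t.
Proof.
  intros Hf Hg. apply continuous_RC. intros eps He.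
  destruct (cdiff_continuous _ _ _ Hf eps He) as [d [Hd Hd']].
  destruct (proj1 (continuous_RC _ _) Hg d Hd) as [d' [Hd1 Hd2]].
  exists d'. split; auto.
Qed.

Lemma Cmod_cis t : Cmod (cis t) = 1%R.
Proof.
  unfold Cmod, cis; simpl fst; simpl snd.
  replace (cos t ^ 2 + sin t ^ 2)%R with 1%R; [apply sqrt_1|].
  pose proof (sin2_cos2 t) as H. unfold Rsqr in H. lra.
Qed.

Lemma cis_neq_0 t : cis t <> 0.
Proof. apply Cmod_gt_0. rewrite Cmod_cis. lra. Qed.

(** * Cauchy's formula on a disc *)

Definition circ (rho t : R) : C := rho * cis t.

(** [kern rho w t dt] is [dz / (z - w)] on the circle [z = circ rho t]. *)
Definition kern (rho : R) (w : C) (t : R) : C := Ci * circ rho t / (circ rho t - w).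

(** The segments from [w] to the circle, which fill the disc.  With
    [z = seg rho w s t], [dz / (z - w) = ds / s + kern rho w t dt]. *)
Definition seg (rho : R) (w : C) (s t : R) : C := w + s * (circ rho t - w).

Lemma Cmod_circ rho t : (0 <= rho)%R -> Cmod (circ rho t) = rho.
Proof.
  intros H. unfold circ. rewrite Cmod_mult, Cmod_cis, Cmod_R, Rabs_pos_eq; auto. ring.
Qed.

Lemma is_deriv_circ rho t : is_deriv_RC (circ rho) t (Ci * circ rho t).
Proof.
  apply is_derive_ext with (fun s => RtoC rho * cis (1 * s)).
  { intros s. unfold circ. rewrite Rmult_1_l. reflexivity. }
  eapply is_deriv_RC_eq.
  - apply is_deriv_RC_mult; [apply is_deriv_RC_const|apply is_deriv_RC_cis].
  - unfold circ. rewrite Rmult_1_l. ring.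
Qed.

Lemma circ_continuous rho t : continuous (circ rho) t.
Proof. exact (is_deriv_RC_continuous _ _ _ (is_deriv_circ rho t)). Qed.

Lemma circ_lipschitz rho s t :
  (0 <= rho)%R -> (Cmod (circ rho t - circ rho s) <= rho * Rabs (t - s))%R.
Proof.
  intros Hr.
  assert (H : forall a b, (a <= b)%R -> (Cmod (circ rho b - circ rho a) <= rho * Rabs (b - a))%R).
  { intros a b Hab. rewrite Rabs_pos_eq, Rmult_comm by lra.
    apply (is_CInt_bound (fun t => Ci * circ rho t) a b); auto.
    - intros u _. rewrite Cmod_mult, Cmod_Ci, Cmod_circ; lra.
    - apply is_CInt_deriv; auto.
      + intros u _. apply is_deriv_circ.
      + intros u _. apply continuous_RC_mult; [apply continuous_const|apply circ_continuous]. }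
  destruct (Rle_dec s t) as [L|L]; [apply H; auto|].
  rewrite Cmod_sub_sym, Rabs_minus_sym. apply H; lra.
Qed.

Lemma circ_sub_lb rho w t :
  (Cmod w < rho)%R -> (rho - Cmod w <= Cmod (circ rho t - w))%R.
Proof.
  intros H. pose proof (Cmod_ge_0 w). pose proof (Cmod_triangle_rev (circ rho t) w) as H1.
  rewrite Cmod_circ in H1; lra.
Qed.

Lemma circ_sub_neq_0 rho w t : (Cmod w < rho)%R -> circ rho t - w <> 0.
Proof. intros H. apply Cmod_gt_0. pose proof (circ_sub_lb rho w t H). lra. Qed.

Lemma kern_bound rho w t :
  (Cmod w < rho)%R -> (Cmod (kern rho w t) <= rho / (rho - Cmod w))%R.
Proof.
  intros H. pose proof (Cmod_ge_0 w). unfold kern.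
  rewrite Cmod_div by (apply circ_sub_neq_0; auto).
  rewrite Cmod_mult, Cmod_Ci, Cmod_circ, Rmult_1_l by lra.
  apply Rmult_le_compat_l; [lra|]. apply Rinv_le_contravar; [lra|].
  apply circ_sub_lb; auto.
Qed.

Lemma kern_continuous rho w t : (Cmod w < rho)%R -> continuous (kern rho w) t.
Proof.
  intros H. unfold kern, Cdiv.
  apply (continuous_RC_mult (fun t => Ci * circ rho t) (fun t => / (circ rho t - w))).
  - apply continuous_RC_mult; [apply continuous_const|apply circ_continuous].
  - eapply is_deriv_RC_continuous. apply is_deriv_RC_inv.
    + apply (is_deriv_RC_plus (circ rho) (fun _ => - w)).
      apply is_deriv_circ. apply is_deriv_RC_const.
    + apply circ_sub_neq_0; auto.
Qed.

Lemma Cmod_seg rho w s t :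
  (Cmod w < rho)%R -> (0 <= s <= 1)%R -> (Cmod (seg rho w s t) <= rho)%R.
Proof.
  intros H Hs. pose proof (Cmod_ge_0 w).
  replace (seg rho w s t) with (RtoC (1 - s)%R * w + RtoC s * circ rho t).
  2:{ unfold seg. rewrite RtoC_minus. ring. }
  eapply Rle_trans; [apply Cmod_triangle|].
  rewrite !Cmod_mult, !Cmod_R, Cmod_circ, !Rabs_pos_eq by lra. nra.
Qed.

Lemma seg_lipschitz rho w s t s' t' :
  (Cmod w < rho)%R -> (0 <= s <= 1)%R -> (0 <= s' <= 1)%R ->
  (Cmod (seg rho w s' t' - seg rho w s t) <= 2 * rho * (Rabs (s' - s) + Rabs (t' - t)))%R.
Proof.
  intros H Hs Hs'. pose proof (Cmod_ge_0 w).
  replace (seg rho w s' t' - seg rho w s t) with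
    (RtoC (s' - s)%R * (circ rho t' - w) + RtoC s * (circ rho t' - circ rho t)).
  2:{ unfold seg. rewrite RtoC_minus. ring. }
  eapply Rle_trans; [apply Cmod_triangle|].
  rewrite !Cmod_mult, !Cmod_R, (Rabs_pos_eq s) by lra.
  pose proof (circ_lipschitz rho t t' ltac:(lra)) as H1.
  pose proof (Cmod_triangle_sub (circ rho t') w) as H2.
  rewrite Cmod_circ in H2 by lra.
  pose proof (Rabs_pos (s' - s)). pose proof (Rabs_pos (t' - t)).
  pose proof (Cmod_ge_0 (circ rho t' - circ rho t)).
  assert (Rabs (s' - s) * Cmod (circ rho t' - w) <= Rabs (s' - s) * (2 * rho))%R.
  { apply Rmult_le_compat_l; lra. }
  assert (s * Cmod (circ rho t' - circ rho t) <= 1 * (rho * Rabs (t' - t)))%R.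
  { apply Rmult_le_compat; lra. }
  assert (0 <= rho * Rabs (t' - t))%R by (apply Rmult_le_pos; lra). lra.
Qed.

Lemma seg_continuous_angle rho w s t : continuous (fun t => seg rho w s t) t.
Proof.
  unfold seg. apply continuous_RC_plus; [apply continuous_const|].
  apply continuous_RC_mult; [apply continuous_const|].
  apply (continuous_RC_plus (circ rho) (fun _ => - w)); [apply circ_continuous|apply continuous_const].
Qed.

Lemma seg_continuous_radius rho w s t : continuous (fun s => seg rho w s t) s.
Proof.
  unfold seg. apply continuous_RC_plus; [apply continuous_const|].
  apply continuous_RC_mult; [|apply continuous_const].
  eapply is_deriv_RC_continuous. apply is_deriv_RC_R.
Qed.

(** Integral of [f(z) dz / (z - w)] along the boundary of a rectangle in polar
    coordinates [z = seg rho w s t]. *)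
Definition boundary (f : C -> C) (rho : R) (w : C) (a b c d : R) : C :=
  CInt (fun t => f (seg rho w b t) * kern rho w t) c d
  - CInt (fun t => f (seg rho w a t) * kern rho w t) c d
  - CInt (fun s => (f (seg rho w s d) - f (seg rho w s c)) / s) a b.

Lemma Cinv_R_continuous (s : R) : (s <> 0)%R -> continuous (fun s : R => / RtoC s) s.
Proof.
  intros H. eapply is_deriv_RC_continuous. apply is_deriv_RC_inv; [apply is_deriv_RC_R|].
  intros E. apply H. now apply RtoC_inj.
Qed.

Lemma is_CInt_angle f rho w s c d :
  (forall z, (Cmod z <= rho)%R -> exists l, cdiff f z l) ->
  (Cmod w < rho)%R -> (0 <= s <= 1)%R -> (c <= d)%R ->
  is_CInt (fun t => f (seg rho w s t) * kern rho w t) c d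
    (CInt (fun t => f (seg rho w s t) * kern rho w t) c d).
Proof.
  intros Hf Hw Hs Hcd. apply CInt_correct; auto. intros t _.
  apply continuous_RC_mult; [|apply kern_continuous; auto].
  destruct (Hf (seg rho w s t)) as [l Hl]; [apply Cmod_seg; auto|].
  apply (cdiff_comp_continuous f (fun t => seg rho w s t) t l Hl).
  apply seg_continuous_angle.
Qed.

Lemma is_CInt_radius f rho w a b c d :
  (forall z, (Cmod z <= rho)%R -> exists l, cdiff f z l) ->
  (Cmod w < rho)%R -> (0 < a <= b)%R -> (b <= 1)%R ->
  is_CInt (fun s => (f (seg rho w s d) - f (seg rho w s c)) / s) a b
    (CInt (fun s => (f (seg rho w s d) - f (seg rho w s c)) / s) a b).
Proof.
  intros Hf Hw Hs Hcd. apply CInt_correct; [lra|]. intros s Hs'.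
  apply continuous_RC_mult; [|apply Cinv_R_continuous; lra].
  apply (continuous_minus (V := C_R_NormedModule)).
  - destruct (Hf (seg rho w s d)) as [l Hl]; [apply Cmod_seg; auto; lra|].
    apply (cdiff_comp_continuous f (fun s => seg rho w s d) s l Hl).
    apply seg_continuous_radius.
  - destruct (Hf (seg rho w s c)) as [l Hl]; [apply Cmod_seg; auto; lra|].
    apply (cdiff_comp_continuous f (fun s => seg rho w s c) s l Hl).
    apply seg_continuous_radius.
Qed.

(** For an affine [f] the form [f(z) dz / (z - w)] is exact in the coordinates
    [(s, t)], and its integrals are explicit; the boundary terms then cancel. *)
Lemma is_CInt_angle_affine A B rho w s c d :
  (Cmod w < rho)%R -> (c <= d)%R ->
  is_CInt (fun t => (A + B * seg rho w s t) * kern rho w t) c d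
    ((A + B * w) * CInt (kern rho w) c d + B * s * (circ rho d - circ rho c)).
Proof.
  intros Hw Hcd.
  apply is_CInt_ext with
    (fun t => (A + B * w) * kern rho w t + (B * s) * (Ci * circ rho t)); auto.
  - intros t _. unfold seg, kern. field. apply circ_sub_neq_0; auto.
  - apply is_CInt_plus; apply is_CInt_scal.
    + apply CInt_correct; auto. intros; apply kern_continuous; auto.
    + apply is_CInt_deriv; auto.
      * intros; apply is_deriv_circ.
      * intros. apply continuous_RC_mult; [apply continuous_const|apply circ_continuous].
Qed.

Lemma is_CInt_const (v : C) a b : is_CInt (fun _ => v) a b ((b - a)%R * v).
Proof.
  unfold is_CInt. rewrite <- scal_R_Cmult.
  apply (is_RInt_const (V := C_R_NormedModule)).
Qed.

Lemma is_CInt_radius_affine A B rho w a b c d :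
  (0 < a <= b)%R ->
  is_CInt (fun s => ((A + B * seg rho w s d) - (A + B * seg rho w s c)) / s) a b
    ((b - a)%R * (B * (circ rho d - circ rho c))).
Proof.
  intros Hab.
  apply is_CInt_ext with (fun _ : R => B * (circ rho d - circ rho c)); [lra| |apply is_CInt_const].
  intros s Hs. unfold seg. field. intros E; apply RtoC_inj in E; lra.
Qed.

(** The affine part contributes nothing, so that only the distance of [f] to an
    affine function matters. *)
Lemma boundary_bound f rho w a b c d A B M :
  (forall z, (Cmod z <= rho)%R -> exists l, cdiff f z l) ->
  (Cmod w < rho)%R -> (0 < a <= b)%R -> (b <= 1)%R -> (c <= d)%R ->
  (forall s t, (a <= s <= b)%R -> (c <= t <= d)%R ->
     (Cmod (f (seg rho w s t) - (A + B * seg rho w s t)) <= M)%R) ->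
  (Cmod (boundary f rho w a b c d) <=
    2 * M * ((d - c) * (rho / (rho - Cmod w)) + (b - a) * / a))%R.
Proof.
  intros Hf Hw Hab Hb1 Hcd HM.
  pose proof (Cmod_ge_0 w) as Hw0.
  assert (HM0 : (0 <= M)%R).
  { eapply Rle_trans; [apply Cmod_ge_0|]. apply (HM a c); lra. }
  set (K := (rho / (rho - Cmod w))%R).
  assert (HK : (0 <= K)%R).
  { apply Rmult_le_pos; [lra|]. apply Rlt_le, Rinv_0_lt_compat; lra. }
  assert (H1 : forall s, (a <= s <= b)%R ->
    (Cmod (CInt (fun t => f (seg rho w s t) * kern rho w t)%C c d -
      ((A + B * w) * CInt (kern rho w) c d + B * s * (circ rho d - circ rho c))) <=
     (d - c) * (M * K))%R).
  { intros s Hs. eapply is_CInt_bound; [exact Hcd| |].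
    2:{ apply is_CInt_minus. apply is_CInt_angle; auto; lra. apply is_CInt_angle_affine; auto. }
    intros t Ht. simpl.
    replace (f (seg rho w s t) * kern rho w t - (A + B * seg rho w s t) * kern rho w t)
      with ((f (seg rho w s t) - (A + B * seg rho w s t)) * kern rho w t) by ring.
    rewrite Cmod_mult. apply Rmult_le_compat; try apply Cmod_ge_0; auto.
    apply kern_bound; auto. }
  assert (H2 : (Cmod (CInt (fun s : R => (f (seg rho w s d) - f (seg rho w s c)) / s)%C a b -
      (b - a)%R * (B * (circ rho d - circ rho c))) <= (b - a) * (2 * M * / a))%R).
  { eapply is_CInt_bound; [apply Hab| |].
    2:{ apply is_CInt_minus. apply is_CInt_radius; auto. apply (is_CInt_radius_affine A); auto. }
    intros s Hs. simpl.
    assert (Hs0 : RtoC s <> 0) by (intros E; apply RtoC_inj in E; lra).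
    replace ((f (seg rho w s d) - f (seg rho w s c)) / s -
       (A + B * seg rho w s d - (A + B * seg rho w s c)) / s)
      with (((f (seg rho w s d) - (A + B * seg rho w s d)) -
             (f (seg rho w s c) - (A + B * seg rho w s c))) / s) by (field; auto).
    rewrite Cmod_div, Cmod_R, Rabs_pos_eq by (auto; lra).
    apply Rmult_le_compat; try apply Cmod_ge_0.
    - apply Rlt_le, Rinv_0_lt_compat; lra.
    - eapply Rle_trans; [apply Cmod_triangle_sub|].
      pose proof (HM s d). pose proof (HM s c). lra.
    - apply Rinv_le_contravar; lra. }
  pose proof (H1 a ltac:(lra)) as Ha. pose proof (H1 b ltac:(lra)) as Hb.
  unfold boundary.
  set (Ia := CInt (fun t : R => f (seg rho w a t) * kern rho w t)%C c d) in *.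
  set (Ib := CInt (fun t : R => f (seg rho w b t) * kern rho w t)%C c d) in *.
  set (Ir := CInt (fun s : R => (f (seg rho w s d) - f (seg rho w s c)) / s)%C a b) in *.
  set (k := (A + B * w) * CInt (kern rho w) c d) in *.
  set (D := circ rho d - circ rho c) in *.
  replace (Ib - Ia - Ir) with
    ((Ib - (k + B * b * D)) - (Ia - (k + B * a * D)) - (Ir - (b - a)%R * (B * D))).
  2:{ rewrite RtoC_minus. ring. }
  eapply Rle_trans; [apply Cmod_triangle_sub|].
  eapply Rle_trans; [apply Rplus_le_compat_r, Cmod_triangle_sub|]. nra.
Qed.

(** Goursat: near each point [f] is affine up to an error which is small
    compared with the size of the rectangle, and the boundary has a length of the
    order of that size. *)
Lemma boundary_vanish f rho w a0 b0 c0 d0 :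
  (forall z, (Cmod z <= rho)%R -> exists l, cdiff f z l) ->
  (Cmod w < rho)%R -> (0 < a0 <= b0)%R -> (b0 <= 1)%R -> (c0 <= d0)%R ->
  boundary f rho w a0 b0 c0 d0 = 0.
Proof.
  intros Hf Hw Ha0 Hb0 Hcd0. pose proof (Cmod_ge_0 w) as Hw0.
  apply bisection_vanish; [lra|lra| | |].
  - intros a m b c d H1 H2 H3 H4. unfold boundary.
    rewrite (CInt_unique _ a b _ (is_CInt_Chasles _ _ _ _ _ _
      (is_CInt_radius f rho w a m c d Hf Hw ltac:(lra) ltac:(lra))
      (is_CInt_radius f rho w m b c d Hf Hw ltac:(lra) ltac:(lra)))).
    ring.
  - intros a b c m d H1 H2 H3 H4. unfold boundary.
    rewrite (CInt_unique _ c d _ (is_CInt_Chasles _ _ _ _ _ _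
      (is_CInt_angle f rho w a c m Hf Hw ltac:(lra) ltac:(lra))
      (is_CInt_angle f rho w a m d Hf Hw ltac:(lra) ltac:(lra)))).
    rewrite (CInt_unique _ c d _ (is_CInt_Chasles _ _ _ _ _ _
      (is_CInt_angle f rho w b c m Hf Hw ltac:(lra) ltac:(lra))
      (is_CInt_angle f rho w b m d Hf Hw ltac:(lra) ltac:(lra)))).
    rewrite (CInt_unique (fun s => (f (seg rho w s d) - f (seg rho w s c)) / s) a b
      (CInt (fun s => (f (seg rho w s m) - f (seg rho w s c)) / s) a b +
       CInt (fun s => (f (seg rho w s d) - f (seg rho w s m)) / s) a b)).
    + ring.
    + eapply is_CInt_ext; [lra| |apply is_CInt_plus; apply is_CInt_radius; auto; lra].
      intros s Hs. simpl. field. intros E; apply RtoC_inj in E; lra.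
  - intros s t eps Hs Ht He.
    destruct (Hf (seg rho w s t)) as [B HB]; [apply Cmod_seg; auto; lra|].
    set (K := (rho / (rho - Cmod w))%R).
    assert (HK : (0 <= K)%R).
    { apply Rmult_le_pos; [lra|]. apply Rlt_le, Rinv_0_lt_compat; lra. }
    assert (Hia : (0 < / a0)%R) by (apply Rinv_0_lt_compat; lra).
    set (L := (4 * rho * (K + / a0))%R).
    assert (HL : (0 < L)%R) by (apply Rmult_lt_0_compat; lra).
    destruct (HB (eps / L)%R) as [del [Hdel HB']]; [apply Rdiv_lt_0_compat; auto|].
    exists (del / (4 * rho))%R. split; [apply Rdiv_lt_0_compat; lra|].
    intros a b c d H1 H2 H3 H4 H5 H6.
    set (h := ((b - a) + (d - c))%R).
    assert (Hh : (2 * rho * h < del)%R).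
    { replace del with (2 * rho * (del / (4 * rho) + del / (4 * rho)))%R by (field; lra).
      apply Rmult_lt_compat_l; unfold h; lra. }
    eapply Rle_trans.
    { apply (boundary_bound f rho w a b c d
        (f (seg rho w s t) - B * seg rho w s t) B (eps / L * (2 * rho * h))); auto; try lra.
      intros s' t' Hs' Ht'.
      replace (f (seg rho w s' t') - (f (seg rho w s t) - B * seg rho w s t + B * seg rho w s' t'))
        with (f (seg rho w s' t') - f (seg rho w s t) - B * (seg rho w s' t' - seg rho w s t)) by ring.
      assert (Hd : (Cmod (seg rho w s' t' - seg rho w s t) <= 2 * rho * h)%R).
      { eapply Rle_trans; [apply seg_lipschitz; auto; lra|].
        apply Rmult_le_compat_l; [lra|]. unfold h.
        apply Rplus_le_compat; apply Rabs_le; lra. }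
      eapply Rle_trans; [apply HB'; lra|].
      apply Rmult_le_compat_l; [|lra]. apply Rlt_le, Rdiv_lt_0_compat; auto. }
    fold K.
    assert (Hia' : (/ a <= / a0)%R) by (apply Rinv_le_contravar; lra).
    assert (Hia2 : (0 < / a)%R) by (apply Rinv_0_lt_compat; lra).
    assert (HX : ((d - c) * K + (b - a) * / a <= h * (K + / a0))%R).
    { unfold h. assert (0 <= (b - a) * (/ a0 - / a))%R by (apply Rmult_le_pos; lra).
      assert (0 <= (b - a) * K)%R by (apply Rmult_le_pos; lra).
      assert (0 <= (d - c) * / a0)%R by (apply Rmult_le_pos; lra). lra. }
    assert (Hh0 : (0 <= h)%R) by (unfold h; lra).
    eapply Rle_trans.
    { apply Rmult_le_compat_l; [|exact HX].
      apply Rmult_le_pos; [lra|]. apply Rmult_le_pos; [apply Rlt_le, Rdiv_lt_0_compat; auto|].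
      apply Rmult_le_pos; lra. }
    apply Req_le. unfold L, h. field. split; [lra|]. split; [|lra].
    assert (0 < a0 * K + 1)%R by nra. lra.
Qed.

Lemma le_all_eps (x K : R) : (forall eps, (0 < eps)%R -> (x <= K * eps)%R) -> (x <= 0)%R.
Proof.
  intros H. apply Rnot_lt_le. intros Hx.
  pose proof (Rabs_pos K). pose proof (Rle_abs K).
  assert (He : (0 < x / (2 * (Rabs K + 1)))%R) by (apply Rdiv_lt_0_compat; lra).
  specialize (H _ He).
  assert (E : ((Rabs K + 1) * (x / (2 * (Rabs K + 1))) = x / 2)%R) by (field; lra).
  nra.
Qed.

Lemma circ_2PI rho : circ rho (2 * PI) = circ rho 0.
Proof. unfold circ, cis. rewrite cos_2PI, sin_2PI, cos_0, sin_0. reflexivity. Qed.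

Lemma PI_pos : (0 < PI)%R. Proof. apply PI_RGT_0. Qed.

(** With [q = w / z], the kernel is the sum of [Ci * q ^ n], whose terms with
    [n > 0] integrate to zero; the remainders [q ^ n * kern] all have the same
    integral, which is arbitrarily small. *)
Lemma kern_winding rho w :
  (Cmod w < rho)%R -> CInt (kern rho w) 0 (2 * PI) = RtoC (2 * PI) * Ci.
Proof.
  intros Hw. pose proof (Cmod_ge_0 w) as Hw0. pose proof PI_pos as Hpi.
  assert (Hn : forall t, circ rho t <> 0).
  { intros t. apply Cmod_gt_0. rewrite Cmod_circ; lra. }
  set (q := fun t : R => (w * / circ rho t)%C).
  assert (Hq : forall t, is_deriv_RC q t (- Ci * q t)).
  { intros t. eapply is_deriv_RC_eq.
    - apply is_deriv_RC_mult; [apply is_deriv_RC_const|].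
      apply is_deriv_RC_inv; [apply is_deriv_circ|auto].
    - unfold q. field. auto. }
  assert (Hqn : forall n t, is_deriv_RC (fun t => q t ^ n) t (- Ci * INR n * q t ^ n)).
  { induction n; intros t.
    - eapply is_deriv_RC_eq; [apply (is_deriv_RC_const 1)|]. simpl. ring.
    - eapply is_deriv_RC_eq.
      + apply (is_deriv_RC_mult q (fun t => q t ^ n)%C); [apply Hq|apply IHn].
      + rewrite S_INR, RtoC_plus. simpl. ring. }
  assert (Hqc : forall n t, continuous (fun t => q t ^ n)%C t).
  { intros n t. eapply is_deriv_RC_continuous. apply Hqn. }
  assert (HqI : forall n, is_CInt (fun t => Ci * q t ^ (S n)) 0 (2 * PI) 0).
  { intros n.
    assert (Hn0 : RtoC (INR (S n)) <> 0).
    { intros E. apply RtoC_inj in E. apply (not_0_INR (S n)); auto. }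
    assert (H : is_CInt (fun t => Ci * q t ^ (S n)) 0 (2 * PI)
      ((- / INR (S n) * q (2 * PI)%R ^ S n) - (- / INR (S n) * q 0%R ^ S n))).
    { apply (is_CInt_deriv (fun t => - / INR (S n) * q t ^ S n)%C); [lra| |].
      - intros t _. eapply is_deriv_RC_eq.
        + apply is_deriv_RC_mult; [apply is_deriv_RC_const|apply Hqn].
        + cbv beta. field. exact Hn0.
      - intros t _. apply continuous_RC_mult; [apply continuous_const|apply Hqc]. }
    replace (RtoC 0) with ((- / INR (S n) * q (2 * PI)%R ^ S n) - (- / INR (S n) * q 0%R ^ S n)).
    exact H. unfold q. rewrite circ_2PI. ring. }
  set (E := fun n => CInt (fun t => q t ^ n * kern rho w t)%C 0 (2 * PI)).
  assert (HE : forall n, is_CInt (fun t => q t ^ n * kern rho w t) 0 (2 * PI) (E n)).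
  { intros n. apply CInt_correct; [lra|]. intros t _.
    apply continuous_RC_mult; [apply Hqc|apply kern_continuous; auto]. }
  assert (Hk : forall n t, q t ^ n * kern rho w t = Ci * q t ^ n + q t ^ S n * kern rho w t).
  { intros n t. unfold q, kern. simpl. field. repeat split; auto; apply circ_sub_neq_0; auto. }
  assert (HS : forall n, E (S n) = E (S (S n))).
  { intros n. apply CInt_unique. replace (E (S (S n))) with (RtoC 0 + E (S (S n))) by ring.
    eapply is_CInt_ext; [lra| |apply is_CInt_plus; [apply HqI|apply HE]].
    intros t _. symmetry. apply Hk. }
  assert (HE1 : forall n, E 1%nat = E (S n)).
  { induction n; auto. rewrite IHn. apply HS. }
  assert (HE0 : E 1%nat = 0).
  { apply Cmod_eq_0. apply Rle_antisym; [|apply Cmod_ge_0].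
    apply (le_all_eps _ (2 * PI * (rho / (rho - Cmod w)))). intros eps He.
    assert (Hx : (0 <= Cmod w / rho < 1)%R).
    { split; [apply Rmult_le_pos; [lra|apply Rlt_le, Rinv_0_lt_compat; lra]|].
      apply Rmult_lt_reg_r with rho; [lra|]. unfold Rdiv. rewrite Rmult_assoc, Rinv_l; lra. }
    destruct (pow_lt_1_zero (Cmod w / rho) (Rabs_def1 (Cmod w / rho) 1 ltac:(lra) ltac:(lra)) eps He)
      as [n Hn']. specialize (Hn' (S n) ltac:(lia)).
    rewrite Rabs_pos_eq in Hn' by (apply pow_le; lra).
    rewrite (HE1 n).
    replace (2 * PI * (rho / (rho - Cmod w)) * eps)%R
      with ((2 * PI - 0) * (eps * (rho / (rho - Cmod w))))%R by ring.
    eapply is_CInt_bound; [lra| |apply HE].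
    intros t _. simpl. rewrite Cmod_mult.
    apply Rmult_le_compat; try apply Cmod_ge_0; [|apply kern_bound; auto].
    change (q t * q t ^ n) with (q t ^ S n). rewrite Cmod_pow.
    unfold q. rewrite Cmod_mult, Cmod_inv, Cmod_circ by (auto; lra). unfold Rdiv in Hn'. lra. }
  apply CInt_unique.
  replace (RtoC (2 * PI) * Ci) with ((2 * PI - 0)%R * Ci + E 1%nat).
  2:{ rewrite HE0, Rminus_0_r. ring. }
  eapply is_CInt_ext; [lra| |apply is_CInt_plus; [apply is_CInt_const|apply HE]].
  intros t _. specialize (Hk O t). simpl in *.
  replace (kern rho w t) with (1 * kern rho w t) at 2 by ring. rewrite Hk. ring.
Qed.

(** The integral over the circle is the case [s = 1] of the integrals over the
    curves [seg rho w s].  They do not depend on [s] by Goursat, the two radii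
    [t = 0] and [t = 2 PI] being the same segment, and they tend to [f w] times
    the winding integral as [s] tends to 0. *)
Lemma Cauchy_formula f rho w :
  (forall z, (Cmod z <= rho)%R -> exists l, cdiff f z l) -> (Cmod w < rho)%R ->
  is_CInt (fun t => f (circ rho t) * kern rho w t) 0 (2 * PI) (f w * (RtoC (2 * PI) * Ci)).
Proof.
  intros Hf Hw. pose proof (Cmod_ge_0 w) as Hw0. pose proof PI_pos as Hpi.
  set (J := fun s => CInt (fun t => f (seg rho w s t) * kern rho w t)%C 0 (2 * PI)).
  assert (HJ : forall a, (0 < a <= 1)%R -> J 1%R = J a).
  { intros a Ha. apply C_minus_eq_0.
    rewrite <- (boundary_vanish f rho w a 1 0 (2 * PI)); auto; try lra.
    unfold boundary, J.
    replace (CInt (fun s : R => (f (seg rho w s (2 * PI)) - f (seg rho w s 0)) / s)%C a 1)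
      with (RtoC 0); [ring|].
    symmetry. apply CInt_unique.
    replace (RtoC 0) with ((1 - a)%R * RtoC 0) by ring.
    eapply is_CInt_ext; [lra| |apply is_CInt_const].
    intros s Hs. simpl. unfold seg. rewrite circ_2PI. field.
    intros E; apply RtoC_inj in E; lra. }
  assert (H1 : J 1%R = f w * (RtoC (2 * PI) * Ci)).
  { apply C_minus_eq_0. apply Cmod_eq_0. apply Rle_antisym; [|apply Cmod_ge_0].
    apply (le_all_eps _ (2 * PI * (rho / (rho - Cmod w)))). intros eps He.
    destruct (Hf w) as [l Hl]; [lra|].
    destruct (cdiff_continuous _ _ _ Hl eps He) as [d [Hd Hd']].
    set (a := Rmin 1 (d / (4 * rho))).
    assert (Ha0 : (0 < d / (4 * rho))%R) by (apply Rdiv_lt_0_compat; lra).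
    assert (Ha : (0 < a <= 1)%R).
    { split; [apply Rmin_case; lra|apply Rmin_l]. }
    assert (Ha2 : (a * (2 * rho) < d)%R).
    { apply Rle_lt_trans with (d / (4 * rho) * (2 * rho))%R.
      - apply Rmult_le_compat_r; [lra|apply Rmin_r].
      - replace (d / (4 * rho) * (2 * rho))%R with (d / 2)%R by (field; lra). lra. }
    rewrite (HJ a Ha). rewrite <- (kern_winding rho w Hw).
    replace (2 * PI * (rho / (rho - Cmod w)) * eps)%R
      with ((2 * PI - 0) * (eps * (rho / (rho - Cmod w))))%R by ring.
    eapply is_CInt_bound; [lra| |].
    2:{ apply is_CInt_minus; [apply is_CInt_angle; auto; lra|].
        apply is_CInt_scal. apply CInt_correct; [lra|]. intros; apply kern_continuous; auto. }
    intros t _. simpl.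
    replace (f (seg rho w a t) * kern rho w t - f w * kern rho w t)
      with ((f (seg rho w a t) - f w) * kern rho w t) by ring.
    rewrite Cmod_mult.
    apply Rmult_le_compat; try apply Cmod_ge_0; [|apply kern_bound; auto].
    apply Rlt_le, Hd'. unfold seg.
    replace (w + a * (circ rho t - w) - w) with (a * (circ rho t - w)) by ring.
    rewrite Cmod_mult, Cmod_R, Rabs_pos_eq by lra.
    eapply Rle_lt_trans; [|exact Ha2]. apply Rmult_le_compat_l; [lra|].
    eapply Rle_trans; [apply Cmod_triangle_sub|]. rewrite Cmod_circ; lra. }
  rewrite <- H1.
  eapply is_CInt_ext; [lra| |apply (is_CInt_angle f rho w 1); auto; lra].
  intros t _. simpl. f_equal. f_equal. unfold seg. ring.
Qed.

Lemma cdiff_is_derive f z l :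
  cdiff f z l <->
  is_derive (K := C_AbsRing) (V := AbsRing_NormedModule C_AbsRing) f z l.
Proof.
  split.
  - intros H. split; [apply is_linear_scal_l|].
    intros x Hx eps. apply (is_filter_lim_locally_unique (V := AbsRing_NormedModule C_AbsRing)) in Hx. subst x.
    destruct (H eps (cond_pos eps)) as [d [Hd Hd']].
    exists (mkposreal d Hd). intros z' Hz'. specialize (Hd' z' Hz').
    rewrite Cmult_comm in Hd'. exact Hd'.
  - intros [_ H] eps He.
    destruct (H z (fun P h => h) (mkposreal eps He)) as [d Hd].
    exists d; split; [apply cond_pos|]. intros z' Hz'.
    specialize (Hd z' Hz'). rewrite (Cmult_comm l). exact Hd.
Qed.

Lemma cdiff_mult f g z l m :
  cdiff f z l -> cdiff g z m -> cdiff (fun z => f z * g z) z (l * g z + f z * m).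
Proof.
  rewrite !cdiff_is_derive. intros Hf Hg.
  apply (is_derive_mult (K := C_AbsRing)); auto. exact Cmult_comm.
Qed.

Lemma cdiff_id z : cdiff (fun z => z) z 1.
Proof.
  intros eps He. exists 1%R. split; [lra|]. intros z' _.
  replace (z' - z - 1 * (z' - z)) with (RtoC 0) by ring. rewrite Cmod_0.
  apply Rmult_le_pos; [lra|apply Cmod_ge_0].
Qed.

(** Riemann's removable singularity theorem, in a quantitative form: the
    constant depends only on the bound and on the radius.  Cauchy's formula
    applies to [z * z * F z], which is differentiable at 0 too; dividing it by
    [z * z] leaves two polar terms, which vanish because [F] is bounded. *)
Lemma removable_estimate F r M :
  (0 < r)%R ->
  (forall z : C, z <> 0 -> (Cmod z < r)%R -> exists l, cdiff F z l) ->
  (forall z : C, z <> 0 -> (Cmod z < r)%R -> (Cmod (F z) <= M)%R) ->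
  exists c : C, forall z : C, z <> 0 -> (Cmod z < r)%R ->
    (Cmod (F z - c) <= 4 / r * M * Cmod z)%R.
Proof.
  intros Hr HF HM. pose proof PI_pos as Hpi.
  set (rho := (3 / 4 * r)%R).
  assert (Hrho : (0 < rho < r)%R) by (unfold rho; lra).
  assert (HM0 : (0 <= M)%R).
  { eapply Rle_trans; [apply Cmod_ge_0|]. apply (HM (RtoC rho)).
    - intros E; apply RtoC_inj in E; lra.
    - rewrite Cmod_R, Rabs_pos_eq; lra. }
  set (f := fun z => z * z * F z).
  assert (Hf : forall z, (Cmod z <= rho)%R -> exists l, cdiff f z l).
  { intros z Hz. destruct (classic (z = 0)) as [->|Hz0].
    - exists 0. intros eps He. exists (Rmin r (eps / (M + 1))).
      split. { apply Rmin_case; auto. apply Rdiv_lt_0_compat; lra. }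
      intros z' Hz'. unfold f.
      replace (z' * z' * F z' - 0 * 0 * F 0 - 0 * (z' - 0)) with (z' * z' * F z') by ring.
      replace (z' - 0) with z' in * by ring.
      pose proof (Rlt_le_trans _ _ _ Hz' (Rmin_l _ _)).
      pose proof (Rlt_le_trans _ _ _ Hz' (Rmin_r _ _)) as Hz2.
      destruct (classic (z' = 0)) as [->|Hn].
      + replace (0 * 0 * F 0) with (RtoC 0) by ring. rewrite Cmod_0; lra.
      + rewrite !Cmod_mult. specialize (HM z' Hn ltac:(lra)).
        pose proof (Cmod_ge_0 z'). pose proof (Cmod_ge_0 (F z')).
        assert (Cmod z' * (M + 1) <= eps)%R.
        { apply Rle_trans with (eps / (M + 1) * (M + 1))%R; [apply Rmult_le_compat_r; lra|].
          apply Req_le. field. lra. }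
        assert (Cmod z' * Cmod (F z') <= Cmod z' * (M + 1))%R by (apply Rmult_le_compat_l; lra).
        rewrite (Rmult_comm eps), Rmult_assoc. apply Rmult_le_compat_l; lra.
    - destruct (HF z Hz0) as [l Hl]; [lra|]. eexists.
      apply (cdiff_mult (fun z => z * z) F); [|exact Hl].
      apply (cdiff_mult (fun z => z) (fun z => z)); apply cdiff_id. }
  set (T := RtoC (2 * PI) * Ci).
  assert (HT : T <> 0).
  { unfold T. intros E. apply (f_equal Cmod) in E.
    rewrite Cmod_mult, Cmod_Ci, Cmod_0, Cmod_R, Rabs_pos_eq in E; lra. }
  assert (HmT : Cmod T = (2 * PI)%R).
  { unfold T. rewrite Cmod_mult, Cmod_Ci, Cmod_R, Rabs_pos_eq; lra. }
  assert (Hc0 : forall t, circ rho t <> 0).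
  { intros t. apply Cmod_gt_0. rewrite Cmod_circ; lra. }
  assert (HFc : forall t, continuous (fun t => F (circ rho t)) t).
  { intros t. destruct (HF (circ rho t)) as [l Hl]; auto; [rewrite Cmod_circ; lra|].
    apply (cdiff_comp_continuous F _ t l Hl). apply circ_continuous. }
  assert (Hcb : forall t, (Cmod (F (circ rho t)) <= M)%R).
  { intros t. apply HM; auto. rewrite Cmod_circ; lra. }
  set (B := fun w => CInt (fun t => F (circ rho t) * kern rho w t)%C 0 (2 * PI)).
  assert (HB : forall w, (Cmod w < rho)%R ->
    is_CInt (fun t => F (circ rho t) * kern rho w t) 0 (2 * PI) (B w)).
  { intros w Hw. apply CInt_correct; [lra|]. intros t _.
    apply (continuous_RC_mult (fun t => F (circ rho t)) (kern rho w)); auto.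
    apply kern_continuous; auto. }
  set (b0 := CInt (fun t => Ci * (circ rho t * circ rho t * F (circ rho t)))%C 0 (2 * PI)).
  set (b1 := CInt (fun t => Ci * (circ rho t * F (circ rho t)))%C 0 (2 * PI)).
  assert (Hb0 : is_CInt (fun t => Ci * (circ rho t * circ rho t * F (circ rho t))) 0 (2 * PI) b0).
  { apply CInt_correct; [lra|]. intros t _.
    apply continuous_RC_mult; [apply continuous_const|].
    apply (continuous_RC_mult (fun t => circ rho t * circ rho t)%C (fun t => F (circ rho t))); auto.
    apply continuous_RC_mult; apply circ_continuous. }
  assert (Hb1 : is_CInt (fun t => Ci * (circ rho t * F (circ rho t))) 0 (2 * PI) b1).
  { apply CInt_correct; [lra|]. intros t _.
    apply continuous_RC_mult; [apply continuous_const|].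
    apply (continuous_RC_mult (circ rho) (fun t => F (circ rho t))); auto.
    apply circ_continuous. }
  (* z^2 / (z - w) = z + w + w^2 / (z - w) *)
  assert (Hexp : forall w, (Cmod w < rho)%R ->
    w * w * F w * T = b0 + w * b1 + w * w * B w).
  { intros w Hw. change (w * w * F w * T) with (f w * (RtoC (2 * PI) * Ci)).
    rewrite <- (CInt_unique _ _ _ _ (Cauchy_formula f rho w Hf Hw)).
    apply CInt_unique.
    eapply is_CInt_ext; [lra| |apply is_CInt_plus; [apply is_CInt_plus; [exact Hb0|apply (is_CInt_scal w); exact Hb1]|
       apply (is_CInt_scal (w * w)), HB; auto]].
    intros t _. simpl. unfold f, kern. field. apply circ_sub_neq_0; auto. }
  set (K := (M * (rho / (rho - r / 2)))%R).
  assert (HBb : forall w, (Cmod w <= r / 2)%R -> (Cmod (B w) <= (2 * PI - 0) * K)%R).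
  { intros w Hw. apply (is_CInt_bound (fun t => F (circ rho t) * kern rho w t)); [lra| |apply HB; unfold rho; lra].
    intros t _. rewrite Cmod_mult. apply Rmult_le_compat; try apply Cmod_ge_0; auto.
    eapply Rle_trans; [apply kern_bound; unfold rho; lra|].
    apply Rmult_le_compat_l; [lra|]. apply Rinv_le_contravar; unfold rho; lra. }
  assert (HK : (0 <= K)%R).
  { apply Rmult_le_pos; auto. apply Rmult_le_pos; [lra|].
    apply Rlt_le, Rinv_0_lt_compat; unfold rho; lra. }
  assert (Hsmall : forall eps, (0 < eps)%R -> exists w : C, w <> 0 /\ (Cmod w <= r / 2)%R /\ (Cmod w <= eps)%R).
  { intros eps He. exists (RtoC (Rmin (r / 2) eps)).
    assert (0 < Rmin (r / 2) eps)%R by (apply Rmin_case; lra).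
    rewrite Cmod_R, Rabs_pos_eq by lra. split; [|split; [apply Rmin_l|apply Rmin_r]].
    intros E; apply RtoC_inj in E; lra. }
  assert (E0 : b0 = 0).
  { apply Cmod_eq_0. apply Rle_antisym; [|apply Cmod_ge_0].
    apply (le_all_eps _ (r / 2 * M * (2 * PI) + Cmod b1 + r / 2 * ((2 * PI - 0) * K))%R).
    intros eps He. destruct (Hsmall eps He) as [w [Hw0 [Hw Hwe]]].
    replace b0 with (w * (w * F w * T - b1 - w * B w)).
    2:{ specialize (Hexp w ltac:(unfold rho; lra)).
        replace (w * (w * F w * T - b1 - w * B w)) with (w * w * F w * T - w * b1 - w * w * B w) by ring.
        rewrite Hexp. ring. }
    rewrite Cmod_mult, Rmult_comm. pose proof (Cmod_ge_0 w).
    apply Rmult_le_compat; try apply Cmod_ge_0; auto.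
    eapply Rle_trans; [apply Cmod_triangle_sub|]. apply Rplus_le_compat.
    - eapply Rle_trans; [apply Cmod_triangle_sub|]. apply Rplus_le_compat_r.
      rewrite !Cmod_mult, HmT. apply Rmult_le_compat_r; [lra|].
      apply Rmult_le_compat; try apply Cmod_ge_0; auto. apply HM; auto; lra.
    - rewrite Cmod_mult. apply Rmult_le_compat; try apply Cmod_ge_0; auto. }
  assert (E1 : b1 = 0).
  { apply Cmod_eq_0. apply Rle_antisym; [|apply Cmod_ge_0].
    apply (le_all_eps _ (M * (2 * PI) + ((2 * PI - 0) * K))%R).
    intros eps He. destruct (Hsmall eps He) as [w [Hw0 [Hw Hwe]]].
    replace b1 with (w * (F w * T - B w)).
    2:{ specialize (Hexp w ltac:(unfold rho; lra)). rewrite E0 in Hexp.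
        replace (F w * T) with ((w * w * F w * T) / (w * w)) by (field; auto).
        rewrite Hexp. field. auto. }
    rewrite Cmod_mult, Rmult_comm. pose proof (Cmod_ge_0 w).
    apply Rmult_le_compat; try apply Cmod_ge_0; auto.
    eapply Rle_trans; [apply Cmod_triangle_sub|]. apply Rplus_le_compat; auto.
    rewrite !Cmod_mult, HmT. apply Rmult_le_compat_r; [lra|]. apply HM; auto; lra. }
  assert (HFB : forall w : C, w <> 0 -> (Cmod w < rho)%R -> F w * T = B w).
  { intros w Hw0 Hw. specialize (Hexp w Hw). rewrite E0, E1 in Hexp.
    replace (F w * T) with ((w * w * F w * T) / (w * w)) by (field; auto).
    rewrite Hexp. field. auto. }
  assert (Hc : (Cmod (B 0) <= 2 * PI * M)%R).
  { replace (2 * PI * M)%R with ((2 * PI - 0) * (M * 1))%R by ring.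
    apply (is_CInt_bound (fun t => F (circ rho t) * kern rho 0 t)); [lra| |apply HB; rewrite Cmod_0; lra].
    intros t _. rewrite Cmod_mult. apply Rmult_le_compat; try apply Cmod_ge_0; auto.
    eapply Rle_trans; [apply kern_bound; rewrite Cmod_0; lra|].
    rewrite Cmod_0. apply Req_le. field. lra. }
  exists (B 0 / T). intros z Hz0 Hz. destruct (Rle_dec (Cmod z) (r / 2)) as [Hz2|Hz2].
  - assert (Hzr : (Cmod z < rho)%R) by (unfold rho; lra).
    assert (Hd : (Cmod (B z - B 0) <= (2 * PI - 0) * (M * (Cmod z * (4 / r))))%R).
    { eapply is_CInt_bound; [| |apply is_CInt_minus; [apply HB; exact Hzr|apply HB; rewrite Cmod_0; lra]]; [lra|].
      intros t _. simpl.
      replace (F (circ rho t) * kern rho z t - F (circ rho t) * kern rho 0 t)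
        with (F (circ rho t) * (z * (Ci / (circ rho t - z)))).
      2:{ unfold kern. field. split; [|apply circ_sub_neq_0; auto].
          replace (circ rho t - 0) with (circ rho t) by ring. auto. }
      rewrite !Cmod_mult. apply Rmult_le_compat; try apply Cmod_ge_0; auto.
      { apply Rmult_le_pos; apply Cmod_ge_0. }
      apply Rmult_le_compat_l; [apply Cmod_ge_0|].
      rewrite Cmod_div by (apply circ_sub_neq_0; auto). rewrite Cmod_Ci.
      pose proof (circ_sub_lb rho z t Hzr).
      replace (4 / r)%R with (1 / (rho - r / 2))%R by (unfold rho; field; lra).
      apply Rmult_le_compat_l; [lra|]. apply Rinv_le_contravar; unfold rho in *; lra. }
    replace (F z - B 0 / T) with ((B z - B 0) / T).
    2:{ rewrite <- (HFB z); auto. field. exact HT. }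
    rewrite Cmod_div, HmT by exact HT.
    apply Rmult_le_reg_r with (2 * PI)%R; [lra|].
    unfold Rdiv at 1. rewrite Rmult_assoc, Rinv_l by lra. lra.
  - assert (Hc' : (Cmod (B 0 / T) <= M)%R).
    { rewrite Cmod_div, HmT by exact HT. apply Rmult_le_reg_r with (2 * PI)%R; [lra|].
      unfold Rdiv at 1. rewrite Rmult_assoc, Rinv_l by lra. lra. }
    eapply Rle_trans; [apply Cmod_triangle_sub|].
    specialize (HM z Hz0 Hz).
    apply Rle_trans with (2 * M)%R; [lra|].
    replace (2 * M)%R with (4 / r * M * (r / 2))%R by (field; lra).
    apply Rmult_le_compat_l; [|lra]. apply Rmult_le_pos; auto.
    apply Rlt_le, Rdiv_lt_0_compat; lra.
Qed.

(** * Differentials of functions of several complex variables *)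

(** [ring] needs the type of the equation to be displayed as [C]. *)
Ltac C_ring := match goal with |- @eq _ ?s ?t => change (@eq C s t); ring end.

Lemma locally_norm_iff (U : NormedModule C_AbsRing) (p : U) (P : U -> Prop) :
  locally p P <->
  exists d : R, (0 < d)%R /\ forall q, (norm (minus q p) < d)%R -> P q.
Proof.
  split.
  - intros H. destruct (locally_norm_le_locally p P H) as [d Hd].
    exists d. split; [apply cond_pos|exact Hd].
  - intros [d [Hd H]]. apply (locally_le_locally_norm p P). exists (mkposreal d Hd). exact H.
Qed.

Lemma is_differential_norm (U V : NormedModule C_AbsRing) (f : U -> V) p l :
  is_differential f p l <->
  is_linear l /\ forall eps : R, (0 < eps)%R -> exists d : R, (0 < d)%R /\
    forall q, (norm (minus q p) < d)%R ->
      (norm (minus (minus (f q) (f p)) (l (minus q p))) <= eps * norm (minus q p))%R.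
Proof.
  split.
  - intros [Hl H]. split; auto. intros eps He.
    apply locally_norm_iff. exact (H p (fun P h => h) (mkposreal eps He)).
  - intros [Hl H]. split; auto. intros x Hx eps.
    apply is_filter_lim_locally_unique in Hx. subst x.
    apply locally_norm_iff. exact (H eps (cond_pos eps)).
Qed.

(** The two normed structures of [C] over itself have the same norm, hence the
    same differentials. *)
Lemma filterdiff_AbsRing (U : NormedModule C_AbsRing) (f : U -> C) F l :
  filterdiff (V := AbsRing_NormedModule C_AbsRing) f F l <->
  filterdiff (V := C_NormedModule) f F l.
Proof.
  split; intros [[A B D] H]; (split; [split; assumption|exact H]).
Qed.

(** The sum of the moduli is equivalent to the norm of [C3] and easier to
    compute with than its nested square roots. *)
Definition norm3 (u : C3) : R := (Cmod (fst (fst u)) + Cmod (snd (fst u)) + Cmod (snd u))%R.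

Definition sub3 (q p : C3) : C3 :=
  (fst (fst q) - fst (fst p), snd (fst q) - snd (fst p), snd q - snd p).

Lemma norm3_le (u : C3) : (norm u <= 2 * norm3 u)%R.
Proof.
  destruct u as [[x y] z].
  destruct (norm_prod (K := C_AbsRing) (U := C2) (V := C_NormedModule) (x, y) z) as [_ H1].
  destruct (norm_prod (K := C_AbsRing) (U := C_NormedModule) (V := C_NormedModule) x y) as [_ H2].
  unfold norm3. simpl fst. simpl snd.
  change (norm (K := C_AbsRing) (V := C_NormedModule) x) with (Cmod x) in *.
  change (norm (K := C_AbsRing) (V := C_NormedModule) y) with (Cmod y) in *.
  change (norm (K := C_AbsRing) (V := C_NormedModule) z) with (Cmod z) in *.
  pose proof (Cmod_ge_0 x). pose proof (Cmod_ge_0 y). pose proof (Cmod_ge_0 z).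
  assert (Hs : (0 < sqrt 2)%R) by apply Rlt_sqrt2_0.
  assert (Hs2 : (sqrt 2 * sqrt 2 = 2)%R) by (apply sqrt_sqrt; lra).
  assert (Hs1 : (1 <= sqrt 2)%R) by (rewrite <- sqrt_1; apply sqrt_le_1_alt; lra).
  eapply Rle_trans; [exact H1|].
  apply Rle_trans with (sqrt 2 * (sqrt 2 * (Cmod x + Cmod y + Cmod z)))%R; [|nra].
  apply Rmult_le_compat_l; [lra|]. apply Rmax_lub; [|nra].
  eapply Rle_trans; [exact H2|]. apply Rmult_le_compat_l; [lra|].
  apply Rmax_lub; lra.
Qed.

Lemma norm3_ge (u : C3) : (norm3 u <= 3 * norm u)%R.
Proof.
  destruct u as [[x y] z].
  destruct (norm_prod (K := C_AbsRing) (U := C2) (V := C_NormedModule) (x, y) z) as [H1 _].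
  destruct (norm_prod (K := C_AbsRing) (U := C_NormedModule) (V := C_NormedModule) x y) as [H2 _].
  unfold norm3. simpl fst. simpl snd.
  change (norm (K := C_AbsRing) (V := C_NormedModule) x) with (Cmod x) in *.
  change (norm (K := C_AbsRing) (V := C_NormedModule) y) with (Cmod y) in *.
  change (norm (K := C_AbsRing) (V := C_NormedModule) z) with (Cmod z) in *.
  pose proof (Rle_trans _ _ _ (Rle_trans _ _ _ (Rmax_l _ _) H2) (Rle_trans _ _ _ (Rmax_l _ _) H1)) as Hx.
  pose proof (Rle_trans _ _ _ (Rle_trans _ _ _ (Rmax_r _ _) H2) (Rle_trans _ _ _ (Rmax_l _ _) H1)) as Hy.
  pose proof (Rle_trans _ _ _ (Rmax_r _ _) H1) as Hz.
  set (N := norm (K := C_AbsRing) (V := C3) (x, y, z)).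
  change (Cmod x <= N)%R in Hx. change (Cmod y <= N)%R in Hy. change (Cmod z <= N)%R in Hz.
  change (Cmod x + Cmod y + Cmod z <= 3 * N)%R. lra.
Qed.

Lemma norm3_pos u : (0 <= norm3 u)%R.
Proof. unfold norm3. pose proof (Cmod_ge_0 (fst (fst u))). pose proof (Cmod_ge_0 (snd (fst u))).
  pose proof (Cmod_ge_0 (snd u)). lra. Qed.

Lemma sub3_minus (q p : C3) : minus q p = sub3 q p.
Proof. destruct q as [[x y] z], p as [[x' y'] z']. reflexivity. Qed.

Lemma locally3_iff (p : C3) (P : C3 -> Prop) :
  locally p P <->
  exists d : R, (0 < d)%R /\ forall q : C3, (norm3 (sub3 q p) < d)%R -> P q.
Proof.
  rewrite locally_norm_iff. split; intros [d [Hd H]].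
  - exists (d / 2)%R. split; [lra|]. intros q Hq. apply H.
    rewrite sub3_minus. eapply Rle_lt_trans; [apply norm3_le|]. lra.
  - exists (d / 3)%R. split; [lra|]. intros q Hq. apply H.
    rewrite <- sub3_minus. eapply Rle_lt_trans; [apply norm3_ge|]. lra.
Qed.

Definition lin3 (a b c : C) (u : C3) : C := a * fst (fst u) + b * snd (fst u) + c * snd u.

Lemma lin3_is_linear a b c : is_linear (K := C_AbsRing) (U := C3) (V := C_NormedModule) (lin3 a b c).
Proof.
  split.
  - intros [[x y] z] [[x' y'] z']. unfold lin3, plus; simpl. unfold Cplus; simpl.
    apply injective_projections; simpl; ring.
  - intros k [[x y] z]. unfold lin3, scal; simpl. unfold scal; simpl. unfold mult; simpl.
    unfold scal; simpl. unfold mult; simpl. ring.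
  - set (M := (Cmod a + Cmod b + Cmod c + 1)%R).
    pose proof (Cmod_ge_0 a). pose proof (Cmod_ge_0 b). pose proof (Cmod_ge_0 c).
    exists (M * 3)%R. split; [unfold M; lra|]. intros u. rewrite Rmult_assoc.
    apply Rle_trans with (M * norm3 u)%R; [|apply Rmult_le_compat_l; [unfold M; lra|apply norm3_ge]].
    change (Cmod (lin3 a b c u) <= M * norm3 u)%R. unfold lin3.
    eapply Rle_trans; [apply Cmod_triangle|].
    eapply Rle_trans; [apply Rplus_le_compat_r, Cmod_triangle|].
    rewrite !Cmod_mult. unfold norm3, M.
    pose proof (Cmod_ge_0 (fst (fst u))). pose proof (Cmod_ge_0 (snd (fst u))).
    pose proof (Cmod_ge_0 (snd u)). nra.
Qed.

Definition diff3 (f : C3 -> C) (p : C3) (a b c : C) : Prop :=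
  is_differential (U := C3) (V := C_NormedModule) f p (lin3 a b c).

Lemma diff3_eps f p a b c :
  diff3 f p a b c <->
  forall eps : R, (0 < eps)%R -> exists d : R, (0 < d)%R /\
    forall q : C3, (norm3 (sub3 q p) < d)%R ->
      (Cmod (f q - f p - lin3 a b c (sub3 q p)) <= eps * norm3 (sub3 q p))%R.
Proof.
  unfold diff3. rewrite is_differential_norm. split.
  - intros [_ H] eps He. destruct (H (eps / 2)%R ltac:(lra)) as [d [Hd Hd']].
    exists (d / 2)%R. split; [lra|]. intros q Hq. specialize (Hd' q).
    rewrite sub3_minus in Hd'. pose proof (norm3_le (sub3 q p)).
    eapply Rle_trans; [apply Hd'; lra|]. 
    replace (eps * norm3 (sub3 q p))%R with (eps / 2 * (2 * norm3 (sub3 q p)))%R by field.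
    apply Rmult_le_compat_l; lra.
  - intros H. split; [apply lin3_is_linear|].
    intros eps He. destruct (H (eps / 3)%R ltac:(lra)) as [d [Hd Hd']].
    exists (d / 3)%R. split; [lra|]. intros q Hq. specialize (Hd' q).
    rewrite sub3_minus in *. pose proof (norm3_ge (sub3 q p)).
    eapply Rle_trans; [apply Hd'; lra|]. 
    replace (eps * norm (sub3 q p))%R with (eps / 3 * (3 * norm (sub3 q p)))%R by field.
    apply Rmult_le_compat_l; lra.
Qed.

Lemma linear_lin3 (l : C3 -> C) :
  is_linear (K := C_AbsRing) (U := C3) (V := C_NormedModule) l ->
  forall u, l u = lin3 (l (RtoC 1, RtoC 0, RtoC 0)) (l (RtoC 0, RtoC 1, RtoC 0))
                       (l (RtoC 0, RtoC 0, RtoC 1)) u.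
Proof.
  intros Hl [[x y] z].
  transitivity (l (plus (plus (scal x ((RtoC 1, RtoC 0, RtoC 0) : C3)) (scal y ((RtoC 0, RtoC 1, RtoC 0) : C3)))
    (scal z ((RtoC 0, RtoC 0, RtoC 1) : C3)))).
  - f_equal. unfold plus, scal; simpl. unfold plus, scal; simpl. unfold mult; simpl.
    unfold scal; simpl. unfold mult; simpl.
    repeat apply injective_projections; simpl; ring.
  - rewrite (linear_plus _ Hl), (linear_plus _ Hl), !(linear_scal _ Hl).
    unfold lin3; simpl. unfold plus, scal; simpl. unfold mult; simpl.
    assert (G : forall a b c : C, x * a + y * b + z * c = a * x + b * y + c * z) by (intros; ring).
    apply G.
Qed.

Lemma is_differential_diff3 f p l :
  is_differential (U := C3) (V := C_NormedModule) f p l ->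
  exists a b c, (forall u, l u = lin3 a b c u) /\ diff3 f p a b c.
Proof.
  intros H. exists (l (RtoC 1, RtoC 0, RtoC 0)), (l (RtoC 0, RtoC 1, RtoC 0)), (l (RtoC 0, RtoC 0, RtoC 1)).
  pose proof (linear_lin3 l (proj1 H)) as E. split; [exact E|].
  apply (filterdiff_ext_lin f l); [exact H|exact E].
Qed.

(** Behind the uniqueness of differentials: a linear map that is negligible
    before the identity vanishes. *)
Lemma small_slope (a : C) :
  (forall eps : R, (0 < eps)%R -> exists d : R, (0 < d)%R /\
     forall h : C, (Cmod h < d)%R -> (Cmod (a * h) <= eps * Cmod h)%R) -> a = 0.
Proof.
  intros H. apply Cmod_eq_0. apply Rle_antisym; [|apply Cmod_ge_0].
  apply (le_all_eps _ 1). intros eps He. destruct (H eps He) as [d [Hd Hd']].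
  specialize (Hd' (RtoC (d / 2))). rewrite Cmod_mult, Cmod_R, Rabs_pos_eq in Hd' by lra.
  specialize (Hd' ltac:(lra)). rewrite Rmult_1_l.
  apply Rmult_le_reg_r with (d / 2)%R; lra.
Qed.

Lemma diff3_unique f p a b c a' b' c' :
  diff3 f p a b c -> diff3 f p a' b' c' -> a = a' /\ b = b' /\ c = c'.
Proof.
  rewrite !diff3_eps. intros H H'.
  assert (G : forall eps : R, (0 < eps)%R -> exists d : R, (0 < d)%R /\
    forall u : C3, (norm3 u < d)%R ->
    (Cmod (lin3 (a - a') (b - b') (c - c') u) <= eps * norm3 u)%R).
  { intros eps He. destruct (H (eps / 2)%R ltac:(lra)) as [d [Hd Hd']].
    destruct (H' (eps / 2)%R ltac:(lra)) as [e [Hee He']].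
    exists (Rmin d e). split; [apply Rmin_case; auto|]. intros u Hu.
    pose proof (Rlt_le_trans _ _ _ Hu (Rmin_l _ _)) as Hu1.
    pose proof (Rlt_le_trans _ _ _ Hu (Rmin_r _ _)) as Hu2.
    set (q := ((fst (fst p) + fst (fst u), snd (fst p) + snd (fst u)), snd p + snd u) : C3).
    assert (Eu : sub3 q p = u).
    { destruct u as [[u1 u2] u3]. unfold sub3, q; simpl.
      assert (G : forall a b : C, a + b - a = b) by (intros; ring).
      rewrite !G. reflexivity. }
    specialize (Hd' q). specialize (He' q). rewrite Eu in *.
    specialize (Hd' Hu1). specialize (He' Hu2).
    replace (lin3 (a - a') (b - b') (c - c') u) with
      ((f q - f p - lin3 a' b' c' u) - (f q - f p - lin3 a b c u)) by (unfold lin3; ring).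
    eapply Rle_trans; [apply Cmod_triangle_sub|]. lra. }
  repeat split; apply C_minus_eq_0, small_slope; intros eps He; destruct (G eps He) as [d [Hd Hd']];
    exists d; split; auto; intros h Hh.
  - specialize (Hd' (h, RtoC 0, RtoC 0)). unfold norm3, lin3 in Hd'. simpl in Hd'.
    rewrite Cmod_0, !Rplus_0_r in Hd'. specialize (Hd' Hh).
    replace ((a - a') * h) with ((a - a') * h + (b - b') * 0 + (c - c') * 0) by ring. exact Hd'.
  - specialize (Hd' (RtoC 0, h, RtoC 0)). unfold norm3, lin3 in Hd'. simpl in Hd'.
    rewrite Cmod_0, Rplus_0_r, Rplus_0_l in Hd'. specialize (Hd' Hh).
    replace ((b - b') * h) with ((a - a') * 0 + (b - b') * h + (c - c') * 0) by ring. exact Hd'.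
  - specialize (Hd' (RtoC 0, RtoC 0, h)). unfold norm3, lin3 in Hd'. simpl in Hd'.
    rewrite Cmod_0, !Rplus_0_l in Hd'. specialize (Hd' Hh).
    replace ((c - c') * h) with ((a - a') * 0 + (b - b') * 0 + (c - c') * h) by ring. exact Hd'.
Qed.

Lemma diff3_curve f (x y z : R -> C) t dx dy dz a b c :
  diff3 f (x t, y t, z t) a b c ->
  is_deriv_RC x t dx -> is_deriv_RC y t dy -> is_deriv_RC z t dz ->
  is_deriv_RC (fun s => f (x s, y s, z s)) t (a * dx + b * dy + c * dz).
Proof.
  intros Hf Hx Hy Hz. rewrite diff3_eps in Hf.
  apply is_deriv_RC_eps. intros eps He.
  pose proof (Cmod_ge_0 dx). pose proof (Cmod_ge_0 dy). pose proof (Cmod_ge_0 dz).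
  pose proof (Cmod_ge_0 a). pose proof (Cmod_ge_0 b). pose proof (Cmod_ge_0 c).
  set (D := (Cmod dx + Cmod dy + Cmod dz + 3)%R).
  set (N := (Cmod a + Cmod b + Cmod c + 1)%R).
  destruct (Hf (eps / 2 / D)%R) as [d [Hd Hd']]; [apply Rdiv_lt_0_compat; unfold D; lra|].
  set (e1 := Rmin 1 (eps / 2 / N)).
  assert (He1 : (0 < e1)%R).
  { apply Rmin_case; [lra|]. apply Rdiv_lt_0_compat; unfold N; lra. }
  destruct (proj1 (is_deriv_RC_eps _ _ _) Hx e1 He1) as [d1 [Hd1 Hd1']].
  destruct (proj1 (is_deriv_RC_eps _ _ _) Hy e1 He1) as [d2 [Hd2 Hd2']].
  destruct (proj1 (is_deriv_RC_eps _ _ _) Hz e1 He1) as [d3 [Hd3 Hd3']].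
  exists (Rmin (Rmin d1 d2) (Rmin d3 (d / D))). split.
  { repeat apply Rmin_case; auto. apply Rdiv_lt_0_compat; unfold D; lra. }
  intros s Hs.
  pose proof (Rlt_le_trans _ _ _ Hs (Rmin_l _ _)) as Hs1.
  pose proof (Rlt_le_trans _ _ _ Hs (Rmin_r _ _)) as Hs2.
  pose proof (Rlt_le_trans _ _ _ Hs2 (Rmin_r _ _)) as Hs3.
  specialize (Hd1' s (Rlt_le_trans _ _ _ Hs1 (Rmin_l _ _))).
  specialize (Hd2' s (Rlt_le_trans _ _ _ Hs1 (Rmin_r _ _))).
  specialize (Hd3' s (Rlt_le_trans _ _ _ Hs2 (Rmin_l _ _))).
  set (q := ((x s, y s), z s) : C3). set (p := ((x t, y t), z t) : C3) in *.
  set (T := Rabs (s - t)) in *. assert (HT : (0 <= T)%R) by apply Rabs_pos.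
  set (ex := x s - x t - (s - t)%R * dx) in *.
  set (ey := y s - y t - (s - t)%R * dy) in *.
  set (ez := z s - z t - (s - t)%R * dz) in *.
  assert (HqD : (norm3 (sub3 q p) <= D * T)%R).
  { assert (Q : forall g dg e, (Cmod e <= e1 * T)%R ->
        g = e + (s - t)%R * dg -> (Cmod g <= (Cmod dg + 1) * T)%R).
    { intros g dg e Hge ->. eapply Rle_trans; [apply Cmod_triangle|].
      rewrite Cmod_mult, Cmod_R. fold T. pose proof (Rmin_l 1 (eps / 2 / N)). fold e1 in H5.
      assert (e1 * T <= 1 * T)%R by (apply Rmult_le_compat_r; auto). lra. }
    pose proof (Q (x s - x t) dx ex Hd1' ltac:(unfold ex; ring)).
    pose proof (Q (y s - y t) dy ey Hd2' ltac:(unfold ey; ring)).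
    pose proof (Q (z s - z t) dz ez Hd3' ltac:(unfold ez; ring)).
    unfold norm3, sub3, q, p; simpl. unfold D. lra. }
  assert (HDp : (0 < D)%R) by (unfold D; lra).
  specialize (Hd' q). specialize (Hd' ltac:(
    eapply Rle_lt_trans; [exact HqD|]; apply Rmult_lt_reg_l with (/ D)%R; [apply Rinv_0_lt_compat; exact HDp|];
    rewrite <- Rmult_assoc, Rinv_l, Rmult_1_l by lra; unfold Rdiv in Hs3; lra)).
  replace (f q - f p - (s - t)%R * (a * dx + b * dy + c * dz)) with
    ((f q - f p - lin3 a b c (sub3 q p)) + (a * ex + b * ey + c * ez)).
  2:{ unfold lin3, sub3, q, p, ex, ey, ez; simpl. ring. }
  eapply Rle_trans; [apply Cmod_triangle|].
  assert (Q1 : (Cmod (f q - f p - lin3 a b c (sub3 q p)) <= eps / 2 * T)%R).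
  { eapply Rle_trans; [exact Hd'|].
    replace (eps / 2 * T)%R with (eps / 2 / D * (D * T))%R by (field; lra).
    apply Rmult_le_compat_l; auto. apply Rlt_le, Rdiv_lt_0_compat; lra. }
  assert (Q2 : (Cmod (a * ex + b * ey + c * ez) <= N * (e1 * T))%R).
  { eapply Rle_trans; [apply Cmod_triangle|].
    eapply Rle_trans; [apply Rplus_le_compat_r, Cmod_triangle|].
    rewrite !Cmod_mult.
    assert (0 <= e1 * T)%R by (apply Rmult_le_pos; lra).
    apply (Rmult_le_compat_l (Cmod a)) in Hd1'; auto.
    apply (Rmult_le_compat_l (Cmod b)) in Hd2'; auto.
    apply (Rmult_le_compat_l (Cmod c)) in Hd3'; auto. unfold N. lra. }
  assert (Q3 : (N * (e1 * T) <= eps / 2 * T)%R).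
  { rewrite <- Rmult_assoc. apply Rmult_le_compat_r; auto.
    apply Rle_trans with (N * (eps / 2 / N))%R.
    - apply Rmult_le_compat_l; [unfold N; lra|apply Rmin_r].
    - apply Req_le. field. unfold N; lra. }
  lra.
Qed.

Lemma diff3_slice f (p v : C3) s a b c :
  diff3 f (fst (fst p) + s * fst (fst v), snd (fst p) + s * snd (fst v), snd p + s * snd v) a b c ->
  cdiff (fun s => f (fst (fst p) + s * fst (fst v), snd (fst p) + s * snd (fst v), snd p + s * snd v)) s
    (lin3 a b c v).
Proof.
  rewrite diff3_eps. intros H eps He.
  set (N := (norm3 v + 1)%R). assert (HN : (0 < N)%R) by (pose proof (norm3_pos v); unfold N; lra).
  destruct (H (eps / N)%R) as [d [Hd Hd']]; [apply Rdiv_lt_0_compat; auto|].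
  exists (d / N)%R. split; [apply Rdiv_lt_0_compat; auto|]. intros s' Hs'.
  specialize (Hd' (fst (fst p) + s' * fst (fst v), snd (fst p) + s' * snd (fst v), snd p + s' * snd v)).
  set (q' := ((fst (fst p) + s' * fst (fst v), snd (fst p) + s' * snd (fst v)), snd p + s' * snd v) : C3) in *.
  set (q := ((fst (fst p) + s * fst (fst v), snd (fst p) + s * snd (fst v)), snd p + s * snd v) : C3) in *.
  assert (E : norm3 (sub3 q' q) = (Cmod (s' - s) * norm3 v)%R).
  { assert (G : forall a b : C, a + s' * b - (a + s * b) = (s' - s) * b) by (intros; ring).
    unfold norm3, sub3, q, q'; simpl. rewrite !G, !Cmod_mult. ring. }
  assert (E2 : lin3 a b c (sub3 q' q) = lin3 a b c v * (s' - s)).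
  { unfold lin3, sub3, q, q'; simpl. ring. }
  rewrite E, E2 in Hd'. pose proof (Cmod_ge_0 (s' - s)).
  assert (HH : (Cmod (s' - s) * norm3 v <= Cmod (s' - s) * N)%R).
  { apply Rmult_le_compat_l; unfold N; lra. }
  eapply Rle_trans; [apply Hd'|].
  - eapply Rle_lt_trans; [exact HH|]. apply Rmult_lt_reg_r with (/ N)%R; [apply Rinv_0_lt_compat; auto|].
    rewrite Rmult_assoc, Rinv_r, Rmult_1_r by lra. exact Hs'.
  - replace (eps * Cmod (s' - s))%R with (eps / N * (Cmod (s' - s) * N))%R by (field; lra).
    apply Rmult_le_compat_l; auto. apply Rlt_le, Rdiv_lt_0_compat; auto.
Qed.

Lemma diff3_continuous f p a b c : diff3 f p a b c ->
  forall eps : R, (0 < eps)%R -> exists d : R, (0 < d)%R /\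
    forall q : C3, (norm3 (sub3 q p) < d)%R -> (Cmod (f q - f p) < eps)%R.
Proof.
  rewrite diff3_eps. intros H eps He. destruct (H 1%R ltac:(lra)) as [d [Hd Hd']].
  pose proof (Cmod_ge_0 a). pose proof (Cmod_ge_0 b). pose proof (Cmod_ge_0 c).
  set (N := (Cmod a + Cmod b + Cmod c + 1)%R).
  assert (HN : (0 < N)%R) by (unfold N; lra).
  exists (Rmin d (eps / N)). split.
  { apply Rmin_case; auto. apply Rdiv_lt_0_compat; auto. }
  intros q Hq. specialize (Hd' q (Rlt_le_trans _ _ _ Hq (Rmin_l _ _))).
  pose proof (Rlt_le_trans _ _ _ Hq (Rmin_r _ _)) as Hq2.
  set (u := sub3 q p) in *.
  assert (HL : (Cmod (lin3 a b c u) <= (Cmod a + Cmod b + Cmod c) * norm3 u)%R).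
  { unfold lin3. eapply Rle_trans; [apply Cmod_triangle|].
    eapply Rle_trans; [apply Rplus_le_compat_r, Cmod_triangle|].
    rewrite !Cmod_mult. unfold norm3.
    pose proof (Cmod_ge_0 (fst (fst u))). pose proof (Cmod_ge_0 (snd (fst u))).
    pose proof (Cmod_ge_0 (snd u)). nra. }
  replace (f q - f p) with ((f q - f p - lin3 a b c u) + lin3 a b c u) by ring.
  eapply Rle_lt_trans; [apply Cmod_triangle|].
  apply Rle_lt_trans with (N * norm3 u)%R; [unfold N; lra|].
  apply Rlt_le_trans with (N * (eps / N))%R; [apply Rmult_lt_compat_l; auto|].
  apply Req_le. field. lra.
Qed.

Lemma diff3_comp (g : C -> C) f p l a b c :
  cdiff g (f p) l -> diff3 f p a b c ->
  diff3 (fun q => g (f q)) p (l * a) (l * b) (l * c).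
Proof.
  intros Hg Hf. unfold diff3.
  apply (filterdiff_ext_lin (fun q => g (f q)) (fun u => lin3 a b c u * l)).
  2:{ intros u. unfold lin3. C_ring. }
  apply (filterdiff_comp' (U := C3) (V := C_NormedModule) (W := C_NormedModule) f g p (lin3 a b c) (fun z => z * l)); [exact Hf|].
  apply is_differential_norm. split.
  - destruct (is_linear_scal_l (K := C_AbsRing) (V := AbsRing_NormedModule C_AbsRing) l) as [A B D].
    split; assumption.
  - intros eps He. destruct (Hg eps He) as [d [Hd Hd']]. exists d. split; auto.
    intros q Hq. specialize (Hd' q Hq). rewrite (Cmult_comm l) in Hd'. exact Hd'.
Qed.

Lemma diff3_mult f g p a b c a' b' c' :
  diff3 f p a b c -> diff3 g p a' b' c' ->
  diff3 (fun q => f q * g q) p (a * g p + f p * a') (b * g p + f p * b') (c * g p + f p * c').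
Proof.
  intros Hf Hg. unfold diff3.
  apply (filterdiff_ext_lin (fun q => f q * g q)
    (fun u => lin3 a b c u * g p + f p * lin3 a' b' c' u)).
  2:{ intros u. unfold lin3. C_ring. }
  apply filterdiff_AbsRing in Hf. apply filterdiff_AbsRing in Hg.
  apply filterdiff_AbsRing.
  exact (filterdiff_mult_fct (K := C_AbsRing) (U := C3) f g p _ _ Cmult_comm Hf Hg).
Qed.

Lemma diff3_minus f g p a b c a' b' c' :
  diff3 f p a b c -> diff3 g p a' b' c' ->
  diff3 (fun q => f q - g q) p (a - a') (b - b') (c - c').
Proof.
  intros Hf Hg. unfold diff3.
  apply (filterdiff_ext_lin (fun q => f q - g q)
    (fun u => lin3 a b c u - lin3 a' b' c' u)).
  2:{ intros u. unfold lin3. C_ring. }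
  exact (filterdiff_minus_fct (K := C_AbsRing) (U := C3) (V := C_NormedModule) f g _ _ Hf Hg).
Qed.

Lemma diff3_const k p : diff3 (fun _ => k) p 0 0 0.
Proof.
  apply diff3_eps. intros eps He. exists 1%R. split; [lra|]. intros q _.
  replace (k - k - lin3 0 0 0 (sub3 q p)) with (RtoC 0) by (unfold lin3; ring).
  rewrite Cmod_0. apply Rmult_le_pos; [lra|apply norm3_pos].
Qed.

Lemma diff3_lin3 a b c p : diff3 (lin3 a b c) p a b c.
Proof.
  apply diff3_eps. intros eps He. exists 1%R. split; [lra|]. intros q _.
  replace (lin3 a b c q - lin3 a b c p - lin3 a b c (sub3 q p)) with (RtoC 0) by (unfold lin3, sub3; simpl; ring).
  rewrite Cmod_0. apply Rmult_le_pos; [lra|apply norm3_pos].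
Qed.

Lemma diff3_eq f p a b c a' b' c' :
  diff3 f p a b c -> a = a' -> b = b' -> c = c' -> diff3 f p a' b' c'.
Proof. intros H <- <- <-. exact H. Qed.

Lemma diff3_ext_loc f g p a b c :
  locally p (fun q => f q = g q) -> diff3 f p a b c -> diff3 g p a b c.
Proof.
  intros H. apply (filterdiff_ext_locally (K := C_AbsRing) (U := C3) (V := C_NormedModule) f g). exact H.
Qed.

Lemma cdiff_inv (z : C) : z <> 0 -> cdiff (fun z => / z) z (- / (z * z)).
Proof.
  intros Hz eps He. pose proof (proj1 (Cmod_gt_0 z) Hz) as Hm.
  exists (Rmin (Cmod z / 2) (eps * (Cmod z * (Cmod z * Cmod z)) / 2)). split.
  { apply Rmin_case; [lra|]. assert (0 < Cmod z * (Cmod z * Cmod z))%R by (repeat apply Rmult_lt_0_compat; lra).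
    assert (0 < eps * (Cmod z * (Cmod z * Cmod z)))%R by (apply Rmult_lt_0_compat; lra). lra. }
  intros z' Hz'.
  pose proof (Rlt_le_trans _ _ _ Hz' (Rmin_l _ _)) as H1.
  pose proof (Rlt_le_trans _ _ _ Hz' (Rmin_r _ _)) as H2.
  assert (H3 : (Cmod z / 2 <= Cmod z')%R).
  { rewrite Cmod_sub_sym in H1. pose proof (Cmod_triangle_rev z z'). lra. }
  assert (Hz0 : z' <> 0) by (apply Cmod_gt_0; lra).
  replace (/ z' - / z - - / (z * z) * (z' - z)) with ((z' - z) * ((z' - z) / (z * z * z'))) by (field; auto).
  rewrite Cmod_mult, Rmult_comm. apply Rmult_le_compat_r; [apply Cmod_ge_0|].
  rewrite Cmod_div, !Cmod_mult by (repeat apply Cmult_neq_0; auto).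
  apply Rmult_le_reg_r with (Cmod z * Cmod z * Cmod z')%R.
  { repeat apply Rmult_lt_0_compat; lra. }
  unfold Rdiv. rewrite Rmult_assoc, Rinv_l, Rmult_1_r.
  2:{ apply Rgt_not_eq. repeat apply Rmult_lt_0_compat; lra. }
  apply Rlt_le. eapply Rlt_le_trans; [exact H2|].
  replace (eps * (Cmod z * (Cmod z * Cmod z)) / 2)%R with (eps * (Cmod z * Cmod z * (Cmod z / 2)))%R by field.
  apply Rmult_le_compat_l; [lra|]. apply Rmult_le_compat_l; [|exact H3].
  apply Rmult_le_pos; lra.
Qed.

(** * First integrals off the coordinate planes *)

(** The quotients by [x], [y] and [xyz2] below are defined off the coordinate
    planes only, so the whole argument is carried out there. *)

Definition off_axes (r : R) (p : C3) : Prop :=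
  let '(x, y, z) := p in
  x <> RtoC 0 /\ y <> RtoC 0 /\ z <> RtoC 0 /\
  (Cmod x < r)%R /\ (Cmod y < r)%R /\ (Cmod z < r)%R.

Definition integral_on (r : R) (g : C3 -> C) : Prop :=
  forall p, off_axes r p -> exists a b c, diff3 g p a b c /\ lin3 a b c (X p) = 0.

Definition bounded_on (r M : R) (g : C3 -> C) : Prop :=
  forall p, off_axes r p -> (Cmod (g p) <= M)%R.

(** The flow of [X] is explicit: [w = x^2 y z^3] satisfies [w' = w^2].  The
    curve below is the trajectory in the complex time [tau * t], with
    [E t = exp (tau * t)]; a first integral is constant along it. *)
Lemma flow_constant g r (x y z tau : C) (E : R -> C) :
  integral_on r g -> E 0%R = 1 ->
  (forall t : R, is_deriv_RC E t (tau * E t)) ->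
  let w := x * x * y * (z * z * z) in
  let k := fun t : R => 1 - w * tau * t in
  (forall t : R, (0 <= t <= 1)%R -> E t <> 0 /\ k t <> 0 /\
     off_axes r (x * E t * / k t, y * E t * k t, z * / E t)) ->
  g (x, y, z) = g (x * E 1%R * / k 1%R, y * E 1%R * k 1%R, z * / E 1%R).
Proof.
  intros Hg HE0 HE w k Hk.
  replace (g (x, y, z)) with (g (x * E 0%R * / k 0%R, y * E 0%R * k 0%R, z * / E 0%R)).
  2:{ replace (k 0%R) with (RtoC 1) by (unfold k; ring). rewrite HE0.
      assert (H1 : RtoC 1 <> 0) by (intros H; apply RtoC_inj in H; lra).
      f_equal. apply injective_projections; [apply injective_projections|]; simpl; field; auto. }
  apply (is_deriv_RC_zero_const (fun t => g (x * E t * / k t, y * E t * k t, z * / E t))); [lra|].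
  intros t Ht. destruct (Hk t Ht) as (HEt & Hkt & Hoff).
  destruct (Hg _ Hoff) as (a & b & c & Hd & HX).
  assert (Dk : is_deriv_RC k t (- (w * tau))).
  { apply is_derive_ext with (fun t : R => 1 + (- (w * tau)) * t).
    { intros s. unfold k. C_ring. }
    eapply is_deriv_RC_eq.
    - apply (is_deriv_RC_plus (fun _ => RtoC 1) (fun t : R => (- (w * tau)) * t)%C).
      apply is_deriv_RC_const.
      apply (is_deriv_RC_mult (fun _ => - (w * tau)) (fun t => RtoC t)).
      apply is_deriv_RC_const. apply is_deriv_RC_R.
    - ring. }
  assert (Dx : is_deriv_RC (fun t => x * E t * / k t) t (tau * (x * E t * / k t) * (1 + w * / k t))).
  { eapply is_deriv_RC_eq.
    - apply is_deriv_RC_mult; [apply is_deriv_RC_mult; [apply (is_deriv_RC_const x)|apply HE]|].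
      apply is_deriv_RC_inv; [exact Dk|exact Hkt].
    - cbv beta. field. exact Hkt. }
  assert (Dy : is_deriv_RC (fun t => y * E t * k t) t (tau * (y * E t) * (k t - w))).
  { eapply is_deriv_RC_eq.
    - apply is_deriv_RC_mult; [apply is_deriv_RC_mult; [apply (is_deriv_RC_const y)|apply HE]|].
      exact Dk.
    - cbv beta. ring. }
  assert (Dz : is_deriv_RC (fun t => z * / E t) t (- tau * (z * / E t))).
  { eapply is_deriv_RC_eq.
    - apply is_deriv_RC_mult; [apply (is_deriv_RC_const z)|].
      apply is_deriv_RC_inv; [apply HE|exact HEt].
    - cbv beta. field. exact HEt. }
  eapply is_deriv_RC_eq; [exact (diff3_curve g _ _ _ t _ _ _ a b c Hd Dx Dy Dz)|].
  replace (RtoC 0) with (tau * lin3 a b c (X (x * E t * / k t, y * E t * k t, z * / E t))).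
  2:{ rewrite HX. ring. }
  unfold lin3, X; simpl fst; simpl snd. cbv beta. unfold w. clearbody k.
  field. auto.
Qed.

Lemma Csqrt_exists (a : C) : exists b : C, b * b = a.
Proof.
  destruct a as [p q]. set (m := Cmod (p, q)).
  assert (Hm2 : (m * m = p * p + q * q)%R).
  { unfold m, Cmod; simpl. rewrite sqrt_sqrt; [ring|nra]. }
  assert (Hm0 : (0 <= m)%R) by apply Cmod_ge_0.
  assert (Hp : (0 <= (m + p) / 2)%R) by (assert (- m <= p)%R by nra; lra).
  assert (Hq : (0 <= (m - p) / 2)%R) by (assert (p <= m)%R by nra; lra).
  set (s := sqrt ((m + p) / 2)). set (t := sqrt ((m - p) / 2)).
  assert (Hs : (s * s = (m + p) / 2)%R) by (apply sqrt_sqrt; auto).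
  assert (Ht : (t * t = (m - p) / 2)%R) by (apply sqrt_sqrt; auto).
  assert (Hst : (s * t = Rabs q / 2)%R).
  { unfold s, t. rewrite <- sqrt_mult by auto.
    replace ((m + p) / 2 * ((m - p) / 2))%R with ((Rabs q / 2) * (Rabs q / 2))%R.
    - apply sqrt_square. pose proof (Rabs_pos q). lra.
    - assert (Rabs q * Rabs q = q * q)%R by (rewrite <- Rabs_mult; apply Rabs_pos_eq; nra). nra. }
  destruct (Rle_dec 0 q) as [L|L].
  - rewrite Rabs_pos_eq in Hst by auto. exists (s, t).
    apply injective_projections; simpl; lra.
  - rewrite Rabs_left in Hst by lra. exists (s, (- t)%R).
    apply injective_projections; simpl; lra.
Qed.

Lemma cis_nat n : cis (2 * PI * INR n) = 1.
Proof.
  unfold cis. replace (2 * PI * INR n)%R with (0 + 2 * INR n * PI)%R by ring.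
  rewrite cos_period, sin_period, cos_0, sin_0. reflexivity.
Qed.

Lemma RtoC_neq_0 (x : R) : (x <> 0)%R -> RtoC x <> 0.
Proof. intros H E. apply H. now apply RtoC_inj. Qed.

Lemma INR_large (a : R) : exists n, (0 < n)%nat /\ (a < INR n)%R.
Proof.
  destruct (INR_unbounded (Rmax a 0)) as [n Hn].
  pose proof (Rmax_l a 0). pose proof (Rmax_r a 0).
  exists n. split; [|lra]. apply INR_lt. simpl. lra.
Qed.

Lemma eq_of_close (a b : C) K :
  (forall eps : R, (0 < eps <= 1)%R -> (Cmod (a - b) <= K * eps)%R) -> a = b.
Proof.
  intros H. apply C_minus_eq_0, Cmod_eq_0, Rle_antisym; [|apply Cmod_ge_0].
  apply (le_all_eps _ (Rabs K)). intros eps He.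
  destruct (Rle_dec eps 1) as [L|L].
  - eapply Rle_trans; [apply (H eps); lra|]. apply Rmult_le_compat_r; [lra|apply Rle_abs].
  - eapply Rle_trans; [apply (H 1%R); lra|]. pose proof (Rle_abs K). pose proof (Rabs_pos K). nra.
Qed.

(** Time [2 pi i n] turns [n] times around [z = 0] and maps [(x, y)] to
    [(x / l, l y)], with [l = 1 - 2 pi i n w].  The case of a real [l] suffices
    and keeps the trajectory away from [l = 0]. *)
Lemma turn_constant g r (x y z : C) (n : nat) (l : R) :
  integral_on r g -> (0 < l)%R ->
  x * x * y * (z * z * z) * (RtoC (2 * PI * INR n) * Ci) = RtoC (1 - l) ->
  x <> 0 -> y <> 0 -> z <> 0 -> (Cmod z < r)%R ->
  (Cmod x < r)%R -> (Cmod x < r * l)%R -> (Cmod y < r)%R -> (Cmod y * l < r)%R ->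
  g (x, y, z) = g (x / l, y * l, z).
Proof.
  intros Hg Hl Hw Hx0 Hy0 Hz0 Hz Hx1 Hx2 Hy1 Hy2.
  pose proof (Cmod_ge_0 x). pose proof (Cmod_ge_0 y).
  rewrite (flow_constant g r x y z (RtoC (2 * PI * INR n) * Ci) (fun t => cis (2 * PI * INR n * t)) Hg).
  - rewrite Hw, Rmult_1_r, cis_nat.
    replace (1 - RtoC (1 - l) * 1) with (RtoC l) by (rewrite RtoC_minus; ring).
    f_equal. apply injective_projections; [apply injective_projections|]; simpl;
    field; try apply RtoC_neq_0; try lra; intros E; apply RtoC_inj in E; lra.
  - rewrite Rmult_0_r. unfold cis. rewrite cos_0, sin_0. reflexivity.
  - intros t. apply is_deriv_RC_cis.
  - intros t Ht. rewrite Hw.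
    assert (Ek : 1 - RtoC (1 - l) * t = RtoC (1 - (1 - l) * t)).
    { rewrite !RtoC_minus, RtoC_mult, RtoC_minus. ring. }
    rewrite Ek. set (k := (1 - (1 - l) * t)%R).
    assert (Hk : (Rmin 1 l <= k)%R).
    { unfold k. destruct (Rle_dec 1 l); [rewrite Rmin_left|rewrite Rmin_right]; nra. }
    assert (Hk' : (k <= Rmax 1 l)%R).
    { unfold k. destruct (Rle_dec 1 l); [rewrite Rmax_right|rewrite Rmax_left]; nra. }
    assert (Hk0 : (0 < k)%R) by (pose proof (Rmin_pos 1 l ltac:(lra) Hl); lra).
    assert (HkC : RtoC k <> 0) by (apply RtoC_neq_0; lra).
    pose proof (cis_neq_0 (2 * PI * INR n * t)) as Hc.
    split; [exact Hc|]. split; [exact HkC|].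
    assert (Hr : (0 < r)%R) by (pose proof (Cmod_ge_0 z); lra).
    repeat split; try (repeat apply Cmult_neq_0; auto; intros E;
       apply (f_equal Cmod) in E; rewrite Cmod_0, Cmod_inv in E by auto;
       apply Rinv_neq_0_compat in E; auto; apply Rgt_not_eq, Cmod_gt_0; auto).
    + rewrite !Cmod_mult, Cmod_inv, Cmod_cis, Cmod_R, Rabs_pos_eq by (auto; lra).
      apply Rmult_lt_reg_r with k; auto. rewrite Rmult_1_r, Rmult_assoc, Rinv_l by lra.
      destruct (Rle_dec 1 l); [rewrite Rmin_left in Hk by auto|rewrite Rmin_right in Hk by lra]; nra.
    + rewrite !Cmod_mult, Cmod_cis, Cmod_R, Rabs_pos_eq by lra. rewrite Rmult_1_r.
      destruct (Rle_dec 1 l); [rewrite Rmax_right in Hk' by auto|rewrite Rmax_left in Hk' by lra]; nra.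
    + rewrite !Cmod_mult, Cmod_inv, Cmod_cis by auto. lra.
Qed.

(** As [x] tends to 0, [w] does too, and a number of turns of the order of
    [1 / w] keeps [l = 1 - 2 pi i n w] equal to [s]: the limit of a first
    integral at [x = 0] is the same at [y] and at [s y]. *)
Lemma x_limit_invariant g r K (y z : C) (s : R) (c1 c2 : C) :
  integral_on r g -> (0 < r)%R -> (0 < s <= 1)%R ->
  y <> 0 -> z <> 0 -> (Cmod y < r)%R -> (Cmod z < r)%R ->
  (forall x : C, x <> 0 -> (Cmod x < r)%R -> (Cmod (g (x, y, z) - c1) <= K * Cmod x)%R) ->
  (forall x : C, x <> 0 -> (Cmod x < r)%R -> (Cmod (g (x, y * s, z)%C - c2) <= K * Cmod x)%R) ->
  c1 = c2.
Proof.
  intros Hg Hr Hs Hy0 Hz0 Hy Hz H1 H2. pose proof PI_pos as Hpi.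
  (* [x = xi / m] and [n = m ^ 2] turns give [2 pi i n w = 1 - s] exactly *)
  destruct (Csqrt_exists (RtoC (1 - s) / (y * (z * z * z) * (RtoC (2 * PI) * Ci)))) as [xi Hxi].
  assert (HCi : Ci <> 0) by (intros E; apply (f_equal Cmod) in E; rewrite Cmod_Ci, Cmod_0 in E; lra).
  assert (H2pi : RtoC (2 * PI) <> 0) by (apply RtoC_neq_0; lra).
  assert (HxiE : xi * xi * y * (z * z * z) * (RtoC (2 * PI) * Ci) = RtoC (1 - s)).
  { rewrite Hxi. field. auto. }
  assert (HK : (0 <= K)%R).
  { specialize (H1 (RtoC (r / 2)) ltac:(apply RtoC_neq_0; lra)).
    rewrite Cmod_R, Rabs_pos_eq in H1 by lra. specialize (H1 ltac:(lra)).
    pose proof (Cmod_ge_0 (g (RtoC (r / 2), y, z) - c1)). nra. }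
  destruct (classic (s = 1%R)) as [->|Hs1].
  { apply (eq_of_close _ _ (2 * K * r)). intros eps He.
    set (e := (eps / 2 * r)%R). assert (He' : (0 < e < r)%R) by (unfold e; nra).
    specialize (H1 (RtoC e) ltac:(apply RtoC_neq_0; lra)).
    specialize (H2 (RtoC e) ltac:(apply RtoC_neq_0; lra)).
    rewrite Cmod_R, Rabs_pos_eq in H1, H2 by lra.
    specialize (H1 ltac:(lra)). specialize (H2 ltac:(lra)).
    replace (y * 1) with y in H2 by ring.
    replace (c1 - c2) with ((g (RtoC e, y, z) - c2) - (g (RtoC e, y, z) - c1)) by ring.
    eapply Rle_trans; [apply Cmod_triangle_sub|]. unfold e in *. nra. }
  assert (Hxi0 : xi <> 0).
  { intros ->. assert (RtoC (1 - s) = 0) by (rewrite <- HxiE; ring).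
    apply RtoC_inj in H. lra. }
  pose proof (proj1 (Cmod_gt_0 xi) Hxi0) as Hxim.
  apply (eq_of_close _ _ (K * (s + 1) * r)). intros eps He.
  destruct (INR_large (Cmod xi / (r * s * eps))) as [m [Hm0 Hm]].
  assert (HmR : (0 < INR m)%R) by (apply lt_0_INR; auto).
  assert (Hd : (0 < r * s * eps)%R) by (repeat apply Rmult_lt_0_compat; lra).
  assert (HmC : RtoC (INR m) <> 0) by (apply RtoC_neq_0; lra).
  assert (HsC : RtoC s <> 0) by (apply RtoC_neq_0; lra).
  set (x := xi / INR m).
  assert (Hx : Cmod x = (Cmod xi / INR m)%R).
  { unfold x. rewrite Cmod_div, Cmod_R, Rabs_pos_eq; auto; lra. }
  assert (Hxs : (Cmod x < r * s * eps)%R).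
  { rewrite Hx. apply Rlt_div_l; auto. apply Rlt_div_l in Hm; auto. lra. }
  assert (Hx0 : x <> 0).
  { apply Cmod_gt_0. rewrite Hx. apply Rdiv_lt_0_compat; auto. }
  assert (Hrs : (r * s * eps <= r * s)%R).
  { rewrite <- (Rmult_1_r (r * s)) at 2. apply Rmult_le_compat_l; [nra|lra]. }
  assert (Hrs2 : (r * s <= r)%R) by nra.
  assert (E : g (x, y, z) = g (x / s, y * s, z)).
  { apply (turn_constant g r x y z (m * m) s); auto; try lra.
    - rewrite <- HxiE. unfold x. rewrite mult_INR, !RtoC_mult. field. auto.
    - pose proof (Cmod_ge_0 y). nra. }
  assert (Hxs' : Cmod (x / s) = (Cmod x / s)%R).
  { rewrite Cmod_div, Cmod_R, Rabs_pos_eq; auto; lra. }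
  assert (Hxs2 : (Cmod x / s < r * eps)%R).
  { apply Rmult_lt_reg_r with s; [lra|]. unfold Rdiv. rewrite Rmult_assoc, Rinv_l by lra. lra. }
  specialize (H1 x Hx0 ltac:(lra)).
  specialize (H2 (x / s)). rewrite Hxs' in H2.
  assert (Hx0' : x / s <> 0).
  { apply Cmod_gt_0. rewrite Hxs'. apply Rdiv_lt_0_compat; [apply Cmod_gt_0; auto|lra]. }
  specialize (H2 Hx0' ltac:(nra)). rewrite <- E in H2.
  replace (c1 - c2) with ((g (x, y, z) - c2) - (g (x, y, z) - c1)) by ring.
  eapply Rle_trans; [apply Cmod_triangle_sub|].
  assert (K * (Cmod x / s) <= K * (r * eps))%R by (apply Rmult_le_compat_l; lra).
  assert (K * Cmod x <= K * (r * s * eps))%R by (apply Rmult_le_compat_l; lra).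
  lra.
Qed.

(** The same with the roles of [x] and [y] exchanged, now with [l = 1 / s].
    Since [w] is linear in [y], no square root is needed: [y = eta / m] and [m]
    turns. *)
Lemma y_limit_invariant g r K (x z : C) (s : R) (c1 c2 : C) :
  integral_on r g -> (0 < r)%R -> (0 < s <= 1)%R ->
  x <> 0 -> z <> 0 -> (Cmod x < r)%R -> (Cmod z < r)%R ->
  (forall y : C, y <> 0 -> (Cmod y < r)%R -> (Cmod (g (x, y, z) - c1) <= K * Cmod y)%R) ->
  (forall y : C, y <> 0 -> (Cmod y < r)%R -> (Cmod (g (x * s, y, z)%C - c2) <= K * Cmod y)%R) ->
  c1 = c2.
Proof.
  intros Hg Hr Hs Hx0 Hz0 Hx Hz H1 H2. pose proof PI_pos as Hpi.
  assert (HCi : Ci <> 0) by (intros E; apply (f_equal Cmod) in E; rewrite Cmod_Ci, Cmod_0 in E; lra).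
  assert (H2pi : RtoC (2 * PI) <> 0) by (apply RtoC_neq_0; lra).
  assert (HsC : RtoC s <> 0) by (apply RtoC_neq_0; lra).
  set (eta := RtoC (1 - / s) / (x * x * (z * z * z) * (RtoC (2 * PI) * Ci))).
  assert (HetaE : x * x * eta * (z * z * z) * (RtoC (2 * PI) * Ci) = RtoC (1 - / s)).
  { unfold eta. field. auto. }
  assert (HK : (0 <= K)%R).
  { specialize (H1 (RtoC (r / 2)) ltac:(apply RtoC_neq_0; lra)).
    rewrite Cmod_R, Rabs_pos_eq in H1 by lra. specialize (H1 ltac:(lra)).
    pose proof (Cmod_ge_0 (g (x, RtoC (r / 2), z) - c1)). nra. }
  destruct (classic (s = 1%R)) as [->|Hs1].
  { apply (eq_of_close _ _ (2 * K * r)). intros eps He.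
    set (e := (eps / 2 * r)%R). assert (He' : (0 < e < r)%R) by (unfold e; nra).
    specialize (H1 (RtoC e) ltac:(apply RtoC_neq_0; lra)).
    specialize (H2 (RtoC e) ltac:(apply RtoC_neq_0; lra)).
    rewrite Cmod_R, Rabs_pos_eq in H1, H2 by lra.
    specialize (H1 ltac:(lra)). specialize (H2 ltac:(lra)).
    replace (x * 1) with x in H2 by ring.
    replace (c1 - c2) with ((g (x, RtoC e, z) - c2) - (g (x, RtoC e, z) - c1)) by ring.
    eapply Rle_trans; [apply Cmod_triangle_sub|]. unfold e in *. nra. }
  assert (Hsi : (1 < / s)%R).
  { rewrite <- Rinv_1. apply Rinv_lt_contravar; lra. }
  assert (Heta0 : eta <> 0).
  { intros E. assert (E2 : RtoC (1 - / s) = 0) by (rewrite <- HetaE, E; ring).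
    apply RtoC_inj in E2. lra. }
  pose proof (proj1 (Cmod_gt_0 eta) Heta0) as Hxim.
  apply (eq_of_close _ _ (K * (s + 1) * r)). intros eps He.
  destruct (INR_large (Cmod eta / (r * s * eps))) as [m [Hm0 Hm]].
  assert (HmR : (0 < INR m)%R) by (apply lt_0_INR; auto).
  assert (Hd : (0 < r * s * eps)%R) by (repeat apply Rmult_lt_0_compat; lra).
  assert (HmC : RtoC (INR m) <> 0) by (apply RtoC_neq_0; lra).
  set (y := eta / INR m).
  assert (Hy : Cmod y = (Cmod eta / INR m)%R).
  { unfold y. rewrite Cmod_div, Cmod_R, Rabs_pos_eq; auto; lra. }
  assert (Hys : (Cmod y < r * s * eps)%R).
  { rewrite Hy. apply Rlt_div_l; auto. apply Rlt_div_l in Hm; auto. lra. }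
  assert (Hy0 : y <> 0).
  { apply Cmod_gt_0. rewrite Hy. apply Rdiv_lt_0_compat; auto. }
  assert (Hrs : (r * s * eps <= r * s)%R).
  { rewrite <- (Rmult_1_r (r * s)) at 2. apply Rmult_le_compat_l; [nra|lra]. }
  assert (Hrs2 : (r * s <= r)%R) by nra.
  assert (Hys2 : (Cmod y * / s < r * eps)%R).
  { apply Rmult_lt_reg_r with s; [lra|]. rewrite Rmult_assoc, Rinv_l by lra. lra. }
  assert (E : g (x, y, z) = g (x * s, y * RtoC (/ s), z)).
  { replace (x * s) with (x / RtoC (/ s)) by (rewrite RtoC_inv by lra; field; auto).
    apply (turn_constant g r x y z m (/ s)); auto; try lra.
    - rewrite <- HetaE. unfold y. rewrite !RtoC_mult. field. auto.
    - pose proof (Cmod_ge_0 x). nra.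
    - nra. }
  assert (Hys' : Cmod (y * RtoC (/ s)) = (Cmod y * / s)%R).
  { rewrite Cmod_mult, Cmod_R, Rabs_pos_eq; auto; lra. }
  specialize (H1 y Hy0 ltac:(lra)).
  specialize (H2 (y * RtoC (/ s))). rewrite Hys' in H2.
  assert (Hy0' : y * RtoC (/ s) <> 0).
  { apply Cmult_neq_0; auto. apply RtoC_neq_0; lra. }
  specialize (H2 Hy0' ltac:(nra)). rewrite <- E in H2.
  replace (c1 - c2) with ((g (x, y, z) - c2) - (g (x, y, z) - c1)) by ring.
  eapply Rle_trans; [apply Cmod_triangle_sub|].
  assert (K * (Cmod y * / s) <= K * (r * eps))%R by (apply Rmult_le_compat_l; lra).
  assert (K * Cmod y <= K * (r * s * eps))%R by (apply Rmult_le_compat_l; lra).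
  lra.
Qed.

Lemma exp_le_mono (a b : R) : (a <= b)%R -> (exp a <= exp b)%R.
Proof. intros [H| ->]; [apply Rlt_le, exp_increasing, H|apply Rle_refl]. Qed.

Lemma is_deriv_RC_exp (L t : R) :
  is_deriv_RC (fun t => RtoC (exp (L * t))) t (RtoC L * RtoC (exp (L * t))).
Proof.
  eapply is_deriv_RC_eq.
  - apply (is_deriv_RC_pair (fun t => exp (L * t)) (fun _ => 0%R)).
    + apply (is_derive_comp exp (fun s => L * s)%R).
      apply is_derive_exp. apply is_derive_scal. apply is_derive_id.
    + apply (is_derive_const 0%R t).
  - unfold scal, one; simpl. unfold mult; simpl. unfold zero; simpl.
    apply injective_projections; simpl; ring.
Qed.

Lemma Cmod_w_le (x y z : C) :
  (Cmod x <= 1)%R -> (Cmod y <= 1)%R -> (Cmod z <= 1)%R ->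
  (Cmod (x * x * y * (z * z * z)) <= Cmod x)%R /\ (Cmod (x * x * y * (z * z * z)) <= Cmod z)%R.
Proof.
  rewrite !Cmod_mult. intros Hx Hy Hz.
  pose proof (Cmod_ge_0 x). pose proof (Cmod_ge_0 y). pose proof (Cmod_ge_0 z).
  set (a := Cmod x) in *. set (b := Cmod y) in *. set (c := Cmod z) in *.
  assert (0 <= a * b <= 1)%R by nra. assert (0 <= c * c <= 1)%R by nra.
  assert (0 <= c * c * c <= c)%R by nra.
  assert (0 <= a * a * b <= a)%R by nra. split; nra.
Qed.

(** The real flow for a fixed time multiplies [z] by [s], and points near the
    axis [x = y = 0] remain near it. *)
Lemma z_limit_invariant g r K (z : C) (s : R) (c1 c2 : C) :
  integral_on r g -> (0 < r <= 1)%R -> (0 < s <= 1)%R -> (0 <= K)%R ->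
  z <> 0 -> (Cmod z < r)%R ->
  (forall x y : C, x <> 0 -> y <> 0 -> (Cmod x < r)%R -> (Cmod y < r)%R ->
     (Cmod (g (x, y, z) - c1) <= K * Cmod x)%R) ->
  (forall x y : C, x <> 0 -> y <> 0 -> (Cmod x < r)%R -> (Cmod y < r)%R ->
     (Cmod (g (x, y, z * s)%C - c2) <= K * Cmod x)%R) ->
  c1 = c2.
Proof.
  intros Hg Hr Hs HK Hz0 Hz H1 H2.
  set (L := (- ln s)%R).
  assert (HL : (0 <= L)%R).
  { unfold L. assert (ln s <= 0)%R; [|lra]. rewrite <- ln_1. apply ln_le; lra. }
  assert (HE1 : exp (L * 1) = (/ s)%R).
  { unfold L. rewrite Rmult_1_r, exp_Ropp, exp_ln; lra. }
  apply (eq_of_close _ _ K). intros eps He.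
  (* small enough for [|w| L <= 1 / 4] and for the end point to be near the axis *)
  set (sg := (r * s * eps / (4 * (1 + L)))%R).
  assert (HsgE : (sg * (4 * (1 + L)) = r * s * eps)%R) by (unfold sg; field; lra).
  assert (Hrse : (0 < r * s * eps <= s)%R).
  { split; [repeat apply Rmult_lt_0_compat; lra|].
    assert (r * eps <= 1)%R by nra. nra. }
  assert (Hsg : (0 < sg)%R) by (apply Rdiv_lt_0_compat; lra).
  assert (HsgL : (sg * L <= 1 / 4)%R) by nra.
  assert (Hsg4 : (4 * sg <= r * s * eps)%R) by nra.
  assert (Hrs : (r * s * eps <= r * s)%R) by (assert (0 < r * s)%R by nra; nra).
  assert (Hsi : (1 <= / s)%R) by (rewrite <- Rinv_1 at 1; apply Rinv_le_contravar; lra).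
  assert (Hsgs : (4 * (sg * / s) <= r * eps)%R).
  { apply Rmult_le_reg_r with s; [lra|].
    replace (4 * (sg * / s) * s)%R with (4 * sg)%R by (field; lra). lra. }
  assert (Hx0 : RtoC sg <> 0) by (apply RtoC_neq_0; lra).
  assert (Hxm : Cmod sg = sg) by (rewrite Cmod_R, Rabs_pos_eq; lra).
  set (w := (RtoC sg * RtoC sg * RtoC sg * (z * z * z))).
  assert (Hw : (Cmod w <= sg)%R).
  { apply Rle_trans with (Cmod sg); [|lra]. apply (Cmod_w_le (RtoC sg) (RtoC sg) z); rewrite ?Hxm; nra. }
  assert (Hk : forall t, (0 <= t <= 1)%R -> (1 / 2 <= Cmod (1 - w * RtoC L * t) <= 3 / 2)%R).
  { intros t Ht.
    assert (B : (Cmod (w * RtoC L * t) <= 1 / 4)%R).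
    { rewrite !Cmod_mult, !Cmod_R, !Rabs_pos_eq by lra. pose proof (Cmod_ge_0 w).
      assert (Cmod w * L <= sg * L)%R by (apply Rmult_le_compat_r; lra).
      assert (0 <= Cmod w * L)%R by (apply Rmult_le_pos; lra). nra. }
    pose proof (Cmod_triangle_rev 1 (w * RtoC L * t)) as T1.
    pose proof (Cmod_triangle_sub 1 (w * RtoC L * t)) as T2.
    rewrite Cmod_1 in *. lra. }
  assert (HE : forall t, (0 <= t <= 1)%R -> (1 <= exp (L * t) <= / s)%R).
  { intros t Ht. split; [rewrite <- exp_0|rewrite <- HE1]; apply exp_le_mono; nra. }
  set (kk := fun t : R => 1 - w * RtoC L * t).
  assert (Hoff : forall t : R, (0 <= t <= 1)%R ->
    off_axes r (sg * exp (L * t) * / kk t, sg * exp (L * t) * kk t, z * / exp (L * t)) /\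
    (Cmod (sg * exp (L * t) * / kk t)%C <= 2 * (sg * / s))%R /\ kk t <> 0).
  { intros t Ht. specialize (Hk t Ht). specialize (HE t Ht). fold (kk t) in Hk.
    assert (Hk0 : kk t <> 0) by (apply Cmod_gt_0; lra).
    assert (He0 : RtoC (exp (L * t)) <> 0) by (apply RtoC_neq_0; lra).
    assert (Hmx : (Cmod (sg * exp (L * t) * / kk t)%C <= 2 * (sg * / s))%R).
    { rewrite !Cmod_mult, Cmod_inv, !Cmod_R, !Rabs_pos_eq by (auto; lra).
      replace (2 * (sg * / s))%R with (sg * / s * 2)%R by ring.
      apply Rmult_le_compat; [nra| | |].
      - apply Rlt_le, Rinv_0_lt_compat; lra.
      - apply Rmult_le_compat_l; lra.
      - replace 2%R with (/ (1 / 2))%R by field. apply Rinv_le_contravar; lra. }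
    assert (Hie : RtoC (exp (L * t)) <> 0 -> / RtoC (exp (L * t)) <> 0).
    { intros _. rewrite <- RtoC_inv by lra. apply RtoC_neq_0. apply Rinv_neq_0_compat; lra. }
    assert (Hik : / kk t <> 0).
    { apply Cmod_gt_0. rewrite Cmod_inv by auto. apply Rinv_0_lt_compat; lra. }
    split; [|split; auto].
    split; [|split; [|split; [|split; [|split]]]].
    - repeat apply Cmult_neq_0; auto.
    - repeat apply Cmult_neq_0; auto.
    - repeat apply Cmult_neq_0; auto.
    - nra.
    - rewrite !Cmod_mult, !Cmod_R, !Rabs_pos_eq by lra.
      assert (sg * exp (L * t) <= sg * / s)%R by (apply Rmult_le_compat_l; lra).
      assert (0 <= sg * exp (L * t))%R by nra. nra.
    - rewrite Cmod_mult, Cmod_inv, Cmod_R, Rabs_pos_eq by (auto; lra).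
      apply Rmult_lt_reg_r with (exp (L * t)); [lra|].
      rewrite Rmult_assoc, Rinv_l by lra. nra. }
  pose proof (flow_constant g r (RtoC sg) (RtoC sg) z (RtoC L) (fun t => RtoC (exp (L * t))) Hg) as F.
  cbv zeta in F. fold w in F.
  assert (E : g (RtoC sg, RtoC sg, z) =
     g (sg * exp (L * 1) * / kk 1%R, sg * exp (L * 1) * kk 1%R, z * s)).
  { rewrite F.
    - fold (kk 1%R). rewrite HE1.
      replace (z * / RtoC (/ s)) with (z * s); [reflexivity|].
      rewrite RtoC_inv by lra. field. apply RtoC_neq_0; lra.
    - rewrite Rmult_0_r, exp_0. reflexivity.
    - intros t. apply is_deriv_RC_exp.
    - intros t Ht. destruct (Hoff t Ht) as (O1 & _ & O3). split; [|split; [exact O3|exact O1]].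
      apply RtoC_neq_0. specialize (HE t Ht). lra. }
  destruct (Hoff 1%R ltac:(lra)) as (O1 & O2 & _). destruct O1 as (X0 & Y0 & _ & X1 & Y1 & _).
  specialize (H1 sg sg Hx0 Hx0). rewrite Hxm in H1. specialize (H1 ltac:(nra) ltac:(nra)).
  specialize (H2 _ _ X0 Y0 X1 Y1). rewrite <- E in H2.
  replace (c1 - c2) with ((g (RtoC sg, RtoC sg, z) - c2) - (g (RtoC sg, RtoC sg, z) - c1)) by ring.
  eapply Rle_trans; [apply Cmod_triangle_sub|].
  assert (K * Cmod (sg * exp (L * 1) * / kk 1%R)%C <= K * (2 * (sg * / s)))%R by (apply Rmult_le_compat_l; auto).
  assert (2 * (sg * / s) + sg <= eps)%R by nra.
  assert (K * (2 * (sg * / s) + sg) <= K * eps)%R by (apply Rmult_le_compat_l; auto). lra.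
Qed.

(** The backward real flow divides [z] by [s] and multiplies [x y] by [s^2].  The
    trajectory stays in the polydisc because [|w| <= |z| <= s] there, which
    controls the factor [k = 1 - w log s] of [flow_constant]. *)
Lemma backward_flow g r (x y z : C) (s : R) :
  integral_on r g -> (0 < r <= 1)%R -> (0 < s <= 1)%R ->
  off_axes r (x, y, z) -> (Cmod z < r * s)%R ->
  exists x1 y1 z1, off_axes r (x1, y1, z1) /\ g (x, y, z) = g (x1, y1, z1) /\
    (Cmod x1 * Cmod y1 = Cmod x * Cmod y * (s * s))%R.
Proof.
  intros Hg Hr Hs (Hx0 & Hy0 & Hz0 & Hx & Hy & Hz) Hzs.
  set (L := ln s).
  assert (HL : (L <= 0)%R) by (unfold L; rewrite <- ln_1; apply ln_le; lra).
  assert (HE1 : exp (L * 1) = s) by (rewrite Rmult_1_r; apply exp_ln; lra).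
  set (w := x * x * y * (z * z * z)).
  pose proof (Cmod_ge_0 x). pose proof (Cmod_ge_0 y). pose proof (Cmod_ge_0 z). pose proof (Cmod_ge_0 w).
  assert (Hw : (Cmod w <= Cmod z)%R) by (apply Cmod_w_le; lra).
  set (kk := fun t : R => 1 - w * RtoC L * t).
  assert (HE : forall t, (0 <= t <= 1)%R -> (s <= exp (L * t) <= 1)%R).
  { intros t Ht. split; [rewrite <- HE1|rewrite <- exp_0]; apply exp_le_mono; nra. }
  assert (Hk : forall t, (0 <= t <= 1)%R ->
    (exp (L * t) <= Cmod (kk t))%R /\ (exp (L * t) * Cmod (kk t) <= 1)%R).
  { intros t Ht. specialize (HE t Ht). set (e := exp (L * t)) in *.
    set (a := (- (L * t))%R). assert (Ha : (0 <= a)%R) by (unfold a; nra).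
    assert (Ha1 : (e * (1 + a) <= 1)%R).
    { pose proof (exp_ineq1_le a) as Hi.
      assert (Hea : (e * exp a = 1)%R).
      { unfold e, a. rewrite <- exp_plus. replace (L * t + - (L * t))%R with 0%R by ring. apply exp_0. }
      rewrite <- Hea. apply Rmult_le_compat_l; lra. }
    assert (B : (Cmod (w * RtoC L * t) = Cmod w * a)%R).
    { rewrite Cmod_mult, Cmod_mult, !Cmod_R, (Rabs_left1 L), (Rabs_pos_eq t) by lra.
      unfold a. ring. }
    pose proof (Cmod_triangle_rev 1 (w * RtoC L * t)) as T1.
    pose proof (Cmod_triangle_sub 1 (w * RtoC L * t)) as T2.
    fold (kk t) in T1, T2. rewrite Cmod_1, B in *.
    assert (Cmod w <= e)%R by nra. assert (Cmod w <= 1)%R by lra.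
    assert (Cmod w * a <= e * a)%R by (apply Rmult_le_compat_r; auto).
    split; [nra|].
    assert (0 <= e * a)%R by nra.
    assert (Cmod w * (e * a) <= 1 * (e * a))%R by (apply Rmult_le_compat_r; auto).
    assert (e * Cmod (kk t) <= e * (1 + Cmod w * a))%R by (apply Rmult_le_compat_l; lra). nra. }
  assert (Hk0 : forall t, (0 <= t <= 1)%R -> kk t <> 0).
  { intros t Ht. apply Cmod_gt_0. specialize (HE t Ht). destruct (Hk t Ht). lra. }
  assert (Hoff : forall t : R, (0 <= t <= 1)%R ->
    off_axes r (x * exp (L * t) * / kk t, y * exp (L * t) * kk t, z * / exp (L * t))).
  { intros t Ht. specialize (Hk t Ht). specialize (HE t Ht). specialize (Hk0 t Ht).
    assert (He0 : RtoC (exp (L * t)) <> 0) by (apply RtoC_neq_0; lra).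
    assert (Hie : / RtoC (exp (L * t)) <> 0).
    { rewrite <- RtoC_inv by lra. apply RtoC_neq_0. apply Rinv_neq_0_compat; lra. }
    assert (Hik : / kk t <> 0).
    { apply Cmod_gt_0. rewrite Cmod_inv by auto. apply Rinv_0_lt_compat; lra. }
    split; [|split; [|split; [|split; [|split]]]].
    - repeat apply Cmult_neq_0; auto.
    - repeat apply Cmult_neq_0; auto.
    - repeat apply Cmult_neq_0; auto.
    - rewrite !Cmod_mult, Cmod_inv, Cmod_R, Rabs_pos_eq by (auto; lra).
      apply Rmult_lt_reg_r with (Cmod (kk t)); [lra|].
      rewrite Rmult_assoc, Rinv_l by lra. nra.
    - rewrite !Cmod_mult, Cmod_R, Rabs_pos_eq by lra. nra.
    - rewrite Cmod_mult, Cmod_inv, Cmod_R, Rabs_pos_eq by (auto; lra).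
      apply Rmult_lt_reg_r with (exp (L * t)); [lra|].
      rewrite Rmult_assoc, Rinv_l by lra. nra. }
  pose proof (flow_constant g r x y z (RtoC L) (fun t => RtoC (exp (L * t))) Hg) as F.
  cbv zeta in F. fold w in F.
  do 3 eexists. split; [apply (Hoff 1%R); lra|]. split.
  - rewrite F; [reflexivity| | |].
    + rewrite Rmult_0_r, exp_0. reflexivity.
    + intros t. apply is_deriv_RC_exp.
    + intros t Ht. split; [|split; [apply Hk0; auto|apply Hoff; auto]].
      apply RtoC_neq_0. specialize (HE t Ht). lra.
  - specialize (Hk0 1%R ltac:(lra)). rewrite HE1.
    assert (0 < Cmod (kk 1%R))%R by (apply Cmod_gt_0; auto).
    rewrite !Cmod_mult, Cmod_inv, Cmod_R, Rabs_pos_eq by (auto; lra). field. lra.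
Qed.

(** * Behavior of a first integral at the coordinate planes *)

Lemma C3_intro (P : C3 -> Prop) : (forall x y z : C, P (x, y, z)) -> forall p, P p.
Proof. intros H [[x y] z]. exact (H x y z). Qed.

Lemma cdiff_ext f g z l : (forall s, f s = g s) -> cdiff f z l -> cdiff g z l.
Proof.
  intros E H eps He. destruct (H eps He) as [d [Hd Hd']]. exists d; split; auto.
  intros z' Hz'. rewrite <- !E. auto.
Qed.

Lemma cdiff_slice_x g (x y z a b c : C) :
  diff3 g (x, y, z) a b c -> cdiff (fun x => g (x, y, z)) x a.
Proof.
  intros H.
  assert (E : forall s : C, (0 + s * 1, y + s * 0, z + s * 0) = (s, y, z)).
  { intros s. apply injective_projections; [apply injective_projections|]; simpl; ring. }
  apply cdiff_ext with (fun s : C => g (0 + s * 1, y + s * 0, z + s * 0)).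
  { intros s. rewrite E. reflexivity. }
  replace a with (lin3 a b c (RtoC 1, RtoC 0, RtoC 0)) by (unfold lin3; simpl; ring).
  apply (diff3_slice g (RtoC 0, y, z) (RtoC 1, RtoC 0, RtoC 0)). simpl. rewrite E. exact H.
Qed.

Lemma cdiff_slice_y g (x y z a b c : C) :
  diff3 g (x, y, z) a b c -> cdiff (fun y => g (x, y, z)) y b.
Proof.
  intros H.
  assert (E : forall s : C, (x + s * 0, 0 + s * 1, z + s * 0) = (x, s, z)).
  { intros s. apply injective_projections; [apply injective_projections|]; simpl; ring. }
  apply cdiff_ext with (fun s : C => g (x + s * 0, 0 + s * 1, z + s * 0)).
  { intros s. rewrite E. reflexivity. }
  replace b with (lin3 a b c (RtoC 0, RtoC 1, RtoC 0)) by (unfold lin3; simpl; ring).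
  apply (diff3_slice g (x, RtoC 0, z) (RtoC 0, RtoC 1, RtoC 0)). simpl. rewrite E. exact H.
Qed.

Lemma cdiff_slice_z g (x y z a b c : C) :
  diff3 g (x, y, z) a b c -> cdiff (fun z => g (x, y, z)) z c.
Proof.
  intros H.
  assert (E : forall s : C, (x + s * 0, y + s * 0, 0 + s * 1) = (x, y, s)).
  { intros s. apply injective_projections; [apply injective_projections|]; simpl; ring. }
  apply cdiff_ext with (fun s : C => g (x + s * 0, y + s * 0, 0 + s * 1)).
  { intros s. rewrite E. reflexivity. }
  replace c with (lin3 a b c (RtoC 0, RtoC 0, RtoC 1)) by (unfold lin3; simpl; ring).
  apply (diff3_slice g (x, y, RtoC 0) (RtoC 0, RtoC 0, RtoC 1)). simpl. rewrite E. exact H.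
Qed.

Lemma bounded_on_pos g r M : (0 < r)%R -> bounded_on r M g -> (0 <= M)%R.
Proof.
  intros Hr H. assert (E : Cmod (RtoC (r / 2)) = (r / 2)%R) by (rewrite Cmod_R, Rabs_pos_eq; lra).
  assert (H0 : RtoC (r / 2) <> 0) by (apply RtoC_neq_0; lra).
  eapply Rle_trans; [apply Cmod_ge_0|]. apply (H (RtoC (r / 2), RtoC (r / 2), RtoC (r / 2))).
  repeat split; auto; lra.
Qed.

Lemma Cmod_real_half (r e : R) : (0 < r)%R -> (0 < e <= 1)%R ->
  RtoC (e * r / 2) <> 0 /\ Cmod (RtoC (e * r / 2)) = (e * r / 2)%R /\ (0 < e * r / 2 < r)%R.
Proof.
  intros Hr He. assert (0 < e * r <= r)%R by nra.
  split; [apply RtoC_neq_0; lra|]. split; [rewrite Cmod_R, Rabs_pos_eq; lra|lra].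
Qed.

(** The limits at [x = 0] and at [y = 0] exist by [removable_estimate].  Their
    invariance under scalings makes them equal to a function of [z] only, which
    the limit at [z = 0] and the real flow show to be constant. *)
Lemma common_limit g r M :
  (0 < r <= 1)%R -> integral_on r g -> bounded_on r M g ->
  exists c : C, forall x y z : C, off_axes r (x, y, z) ->
    (Cmod (g (x, y, z) - c) <= 4 / r * M * Cmod x)%R /\
    (Cmod (g (x, y, z) - c) <= 4 / r * M * Cmod y)%R.
Proof.
  intros Hr Hg HM. pose proof (bounded_on_pos g r M ltac:(lra) HM) as HM0.
  set (K := (4 / r * M)%R).
  assert (HK : (0 <= K)%R).
  { apply Rmult_le_pos; auto. apply Rlt_le, Rdiv_lt_0_compat; lra. }
  assert (Lx : forall y z : C, y <> 0 -> z <> 0 -> (Cmod y < r)%R -> (Cmod z < r)%R ->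
    exists c, forall x : C, x <> 0 -> (Cmod x < r)%R -> (Cmod (g (x, y, z) - c) <= K * Cmod x)%R).
  { intros y z Hy0 Hz0 Hy Hz. apply (removable_estimate (fun x => g (x, y, z))); [lra| |].
    - intros x Hx0 Hx. destruct (Hg (x, y, z)) as (a & b & c & H & _); [repeat split; auto|].
      exists a. apply (cdiff_slice_x g x y z a b c H).
    - intros x Hx0 Hx. apply HM. repeat split; auto. }
  assert (Ly : forall x z : C, x <> 0 -> z <> 0 -> (Cmod x < r)%R -> (Cmod z < r)%R ->
    exists c, forall y : C, y <> 0 -> (Cmod y < r)%R -> (Cmod (g (x, y, z) - c) <= K * Cmod y)%R).
  { intros x z Hx0 Hz0 Hx Hz. apply (removable_estimate (fun y => g (x, y, z))); [lra| |].
    - intros y Hy0 Hy. destruct (Hg (x, y, z)) as (a & b & c & H & _); [repeat split; auto|].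
      exists b. apply (cdiff_slice_y g x y z a b c H).
    - intros y Hy0 Hy. apply HM. repeat split; auto. }
  assert (Lz : forall x y : C, x <> 0 -> y <> 0 -> (Cmod x < r)%R -> (Cmod y < r)%R ->
    exists c, forall z : C, z <> 0 -> (Cmod z < r)%R -> (Cmod (g (x, y, z) - c) <= K * Cmod z)%R).
  { intros x y Hx0 Hy0 Hx Hy. apply (removable_estimate (fun z => g (x, y, z))); [lra| |].
    - intros z Hz0 Hz. destruct (Hg (x, y, z)) as (a & b & c & H & _); [repeat split; auto|].
      exists c. apply (cdiff_slice_z g x y z a b c H).
    - intros z Hz0 Hz. apply HM. repeat split; auto. }
  assert (Lxy : forall z : C, z <> 0 -> (Cmod z < r)%R -> exists c,
    forall x y : C, x <> 0 -> y <> 0 -> (Cmod x < r)%R -> (Cmod y < r)%R ->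
    (Cmod (g (x, y, z) - c) <= K * Cmod x)%R /\ (Cmod (g (x, y, z) - c) <= K * Cmod y)%R).
  { intros z Hz0 Hz.
    assert (Same : forall (x y : C) c1 c2, x <> 0 -> y <> 0 -> (Cmod x < r)%R -> (Cmod y < r)%R ->
      (forall x : C, x <> 0 -> (Cmod x < r)%R -> (Cmod (g (x, y, z) - c1) <= K * Cmod x)%R) ->
      (forall y : C, y <> 0 -> (Cmod y < r)%R -> (Cmod (g (x, y, z) - c2) <= K * Cmod y)%R) ->
      c1 = c2).
    { intros x y c1 c2 Hx0 Hy0 Hx Hy H1 H2.
      (* both limits can be computed at [(s x, s y)] with [s] small *)
      apply (eq_of_close _ _ (K * (Cmod x + Cmod y))). intros s Hs.
      assert (HsC : RtoC s <> 0) by (apply RtoC_neq_0; lra).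
      assert (Ex : Cmod (x * s) = (Cmod x * s)%R) by (rewrite Cmod_mult, Cmod_R, Rabs_pos_eq; lra).
      assert (Ey : Cmod (y * s) = (Cmod y * s)%R) by (rewrite Cmod_mult, Cmod_R, Rabs_pos_eq; lra).
      pose proof (Cmod_ge_0 x). pose proof (Cmod_ge_0 y).
      assert (Hx0' : x * s <> 0) by (apply Cmult_neq_0; auto).
      assert (Hy0' : y * s <> 0) by (apply Cmult_neq_0; auto).
      destruct (Lx (y * s) z) as [c1' H1']; auto; [rewrite Ey; nra|].
      destruct (Ly (x * s) z) as [c2' H2']; auto; [rewrite Ex; nra|].
      assert (c1 = c1') by (apply (x_limit_invariant g r K y z s c1 c1'); auto; lra).
      assert (c2 = c2') by (apply (y_limit_invariant g r K x z s c2 c2'); auto; lra).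
      subst c1' c2'.
      specialize (H1' (x * s) Hx0' ltac:(rewrite Ex; nra)).
      specialize (H2' (y * s) Hy0' ltac:(rewrite Ey; nra)).
      rewrite Ex in H1'. rewrite Ey in H2'.
      replace (c1 - c2) with ((g (x * s, y * s, z) - c2) - (g (x * s, y * s, z) - c1)) by ring.
      eapply Rle_trans; [apply Cmod_triangle_sub|]. lra. }
    destruct (Cmod_real_half r 1 ltac:(lra) ltac:(lra)) as (A0 & A1 & A2).
    destruct (Lx (RtoC (1 * r / 2)) z A0 Hz0 ltac:(lra) Hz) as [c Hc].
    exists c. intros x y Hx0 Hy0 Hx Hy.
    destruct (Ly x z Hx0 Hz0 Hx Hz) as [c2 Hc2].
    destruct (Lx y z Hy0 Hz0 Hy Hz) as [c1 Hc1].
    assert (c = c2) by (apply (Same x (RtoC (1 * r / 2)) c c2); auto; lra).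
    assert (c1 = c2) by (apply (Same x y c1 c2); auto).
    subst c1 c2. split; auto. }
  destruct (Cmod_real_half r 1 ltac:(lra) ltac:(lra)) as (A0 & A1 & A2).
  destruct (Lxy (RtoC (1 * r / 2)) A0 ltac:(lra)) as [c Hc].
  exists c. intros x y z (Hx0 & Hy0 & Hz0 & Hx & Hy & Hz).
  destruct (Lxy z Hz0 Hz) as [c' Hc'].
  assert (c' = c); [|subst c'; apply Hc'; auto].
  apply (eq_of_close _ _ (K * (r * 3))). intros e He.
  destruct (Cmod_real_half r e ltac:(lra) He) as (B0 & B1 & B2).
  set (b := RtoC (e * r / 2)) in *.
  assert (HeC : RtoC e <> 0) by (apply RtoC_neq_0; lra).
  assert (Hsc : forall z : C, z <> 0 -> (Cmod z < r)%R -> (z * e <> 0) /\ (Cmod (z * e) <= r * e)%R /\ (Cmod (z * e) < r)%R).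
  { intros v Hv0 Hv. split; [apply Cmult_neq_0; auto|].
    rewrite Cmod_mult, Cmod_R, Rabs_pos_eq by lra. pose proof (Cmod_ge_0 v). split; nra. }
  destruct (Hsc z Hz0 Hz) as (C0 & C1 & C2).
  destruct (Hsc (RtoC (1 * r / 2)) A0 ltac:(lra)) as (D0 & D1 & D2).
  destruct (Lxy _ C0 C2) as [ce Hce].
  destruct (Lxy _ D0 D2) as [de Hde].
  assert (c' = ce).
  { apply (z_limit_invariant g r K z e c' ce); auto; intros; [apply Hc'|apply Hce]; auto. }
  assert (c = de).
  { apply (z_limit_invariant g r K (RtoC (1 * r / 2)) e c de); auto; try lra; intros; [apply Hc|apply Hde]; auto. }
  subst ce de.
  destruct (Lz b b B0 B0 ltac:(lra) ltac:(lra)) as [c3 Hc3].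
  pose proof (Hc3 _ C0 C2) as E1. pose proof (Hc3 _ D0 D2) as E2.
  destruct (Hce b b B0 B0 ltac:(lra) ltac:(lra)) as [E3 _].
  destruct (Hde b b B0 B0 ltac:(lra) ltac:(lra)) as [E4 _].
  rewrite B1 in E3, E4.
  replace (c' - c) with
   (((g (b, b, z * e) - c3) - (g (b, b, z * e) - c')) -
    ((g (b, b, RtoC (1 * r / 2) * e) - c3) - (g (b, b, RtoC (1 * r / 2) * e) - c))) by ring.
  eapply Rle_trans; [apply Cmod_triangle_sub|].
  eapply Rle_trans; [apply Rplus_le_compat; apply Cmod_triangle_sub|].
  assert (K * Cmod (z * e) <= K * (r * e))%R by (apply Rmult_le_compat_l; auto).
  assert (K * Cmod (RtoC (1 * r / 2) * e) <= K * (r * e))%R by (apply Rmult_le_compat_l; auto).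
  lra.
Qed.

(** Constant along the trajectories of [X], because the nonlinear terms of
    [x' / x] and [y' / y] are opposite. *)
Definition xyz2 (p : C3) : C := let '(x, y, z) := p in x * y * (z * z).

(** [(g - c) / x] is bounded and tends to 0 with [y], so that [g - c] is
    [O(x y)] by a second use of [removable_estimate].  As [x y] is multiplied by
    [s^2] along the backward flow while [g] is constant, [s] of the order of [z]
    gives the factor [z^2]. *)
Lemma xyz2_estimate g r M :
  (0 < r <= 1)%R -> integral_on r g -> bounded_on r M g ->
  exists c, forall p, off_axes r p ->
    (Cmod (g p - c) <= 64 / (r * r * r * r) * M * Cmod (xyz2 p))%R.
Proof.
  intros Hr Hg HM. pose proof (bounded_on_pos g r M ltac:(lra) HM) as HM0.
  destruct (common_limit g r M Hr Hg HM) as [c Hc]. exists c.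
  set (K := (4 / r)%R) in *. assert (HK : (0 < K)%R) by (apply Rdiv_lt_0_compat; lra).
  assert (Hxy : forall x y z : C, off_axes r (x, y, z) ->
    (Cmod (g (x, y, z) - c) <= K * (K * M) * (Cmod x * Cmod y))%R).
  { intros x y z (Hx0 & Hy0 & Hz0 & Hx & Hy & Hz).
    pose proof (proj1 (Cmod_gt_0 x) Hx0) as Hxm. pose proof (Cmod_ge_0 y).
    set (F := fun y : C => (g (x, y, z) - c) * / x).
    assert (HF : forall y, Cmod (F y) = (Cmod (g (x, y, z) - c) / Cmod x)%R).
    { intros v. unfold F. rewrite Cmod_mult, Cmod_inv by auto. reflexivity. }
    destruct (removable_estimate F r (K * M)) as [k Hk]; [lra| | |].
    - intros v Hv0 Hv. destruct (Hg (x, v, z)) as (a & b & d & H1 & _); [repeat split; auto|].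
      eexists. eapply (fun a b d => cdiff_slice_y (fun p => (g p - c) * / x) x v z a b d).
      apply (diff3_mult (fun p => g p - c) (fun _ => / x)).
      + apply (diff3_minus g (fun _ => c)); [exact H1|apply diff3_const].
      + apply diff3_const.
    - intros v Hv0 Hv. rewrite HF. destruct (Hc x v z) as [H1 _]; [repeat split; auto|].
      apply Rle_div_l; auto.
    - assert (k = 0).
      { apply (eq_of_close _ _ ((K * M) * r / Cmod x + K * (K * M) * r)). intros e He.
        destruct (Cmod_real_half r e ltac:(lra) He) as (B0 & B1 & B2).
        set (b := RtoC (e * r / 2)) in *.
        specialize (Hk b B0 ltac:(lra)). destruct (Hc x b z) as [_ H2]; [repeat split; auto; lra|].
        replace (k - 0) with (F b - (F b - k)) by ring.
        eapply Rle_trans; [apply Cmod_triangle_sub|].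
        rewrite HF. rewrite B1 in *. fold K in Hk.
        assert (Cmod (g (x, b, z) - c) / Cmod x <= (K * M) * (e * r) / Cmod x)%R.
        { apply Rmult_le_compat_r; [apply Rlt_le, Rinv_0_lt_compat; auto|].
          eapply Rle_trans; [exact H2|]. apply Rmult_le_compat_l; [nra|lra]. }
        assert (K * (K * M) * (e * r / 2) <= K * (K * M) * (e * r))%R.
        { apply Rmult_le_compat_l; [|lra]. apply Rmult_le_pos; nra. }
        replace ((K * M * r / Cmod x + K * (K * M) * r) * e)%R
          with (K * M * (e * r) / Cmod x + K * (K * M) * (e * r))%R by (field; lra).
        apply Rplus_le_compat; [exact H0|eapply Rle_trans; [exact Hk|exact H1]]. }
      subst k. specialize (Hk y Hy0 Hy). fold K in Hk.
      replace (F y - 0) with (F y) in Hk by ring. rewrite HF in Hk.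
      apply (proj1 (Rle_div_l _ _ _ Hxm)) in Hk. eapply Rle_trans; [exact Hk|]; apply Req_le; ring. }
  set (B := (K * (K * M))%R) in *. assert (HB : (0 <= B)%R) by (unfold B; nra).
  refine (C3_intro _ _). intros x y z Hp. pose proof Hp as (Hx0 & Hy0 & Hz0 & Hx & Hy & Hz).
  pose proof (Cmod_ge_0 x). pose proof (Cmod_ge_0 y). pose proof (proj1 (Cmod_gt_0 z) Hz0) as Hzm.
  assert (Q : (0 <= B * (Cmod x * Cmod y))%R) by (apply Rmult_le_pos; [exact HB|apply Rmult_le_pos; assumption]).
  assert (EK : (64 / (r * r * r * r) * M * Cmod (xyz2 (x, y, z)) =
     B * (Cmod x * Cmod y) * ((2 * Cmod z / r) * (2 * Cmod z / r)))%R).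
  { unfold xyz2. rewrite !Cmod_mult. unfold B, K. field. lra. }
  rewrite EK.
  destruct (Rlt_dec (Cmod z) (r / 2)) as [L|L].
  - set (s := (2 * Cmod z / r)%R).
    assert (Hsr : (r * s = 2 * Cmod z)%R) by (unfold s; field; lra).
    assert (Hs : (0 < s <= 1)%R).
    { split; [apply Rdiv_lt_0_compat; lra|]. apply Rmult_le_reg_l with r; lra. }
    destruct (backward_flow g r x y z s Hg Hr Hs Hp ltac:(lra)) as (x1 & y1 & z1 & O & E1 & E2).
    rewrite E1. eapply Rle_trans; [apply Hxy; exact O|]. rewrite E2. lra.
  - eapply Rle_trans; [apply Hxy; exact Hp|].
    assert (1 <= 2 * Cmod z / r)%R by (apply Rle_div_r; lra).
    rewrite <- (Rmult_1_r (B * (Cmod x * Cmod y))) at 1.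
    apply Rmult_le_compat_l; nra.
Qed.

Lemma diff3_xyz2 (x y z : C) : diff3 xyz2 (x, y, z) (y * (z * z)) (x * (z * z)) (x * y * (z + z)).
Proof.
  assert (Dx := diff3_lin3 1 0 0 (x, y, z)).
  assert (Dy := diff3_lin3 0 1 0 (x, y, z)).
  assert (Dz := diff3_lin3 0 0 1 (x, y, z)).
  apply (filterdiff_ext (V := C_NormedModule)
    (fun p => lin3 1 0 0 p * lin3 0 1 0 p * (lin3 0 0 1 p * lin3 0 0 1 p))).
  { intros [[a b] c]. unfold lin3, xyz2; simpl. C_ring. }
  eapply diff3_eq.
  - apply (diff3_mult (fun p => lin3 1 0 0 p * lin3 0 1 0 p) (fun p => lin3 0 0 1 p * lin3 0 0 1 p));
    apply diff3_mult; eassumption.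
  - unfold lin3; simpl; ring.
  - unfold lin3; simpl; ring.
  - unfold lin3; simpl; ring.
Qed.

Lemma integral_div_xyz2 g r : integral_on r g -> integral_on r (fun p => g p * / xyz2 p).
Proof.
  intros Hg. refine (C3_intro _ _). intros x y z Hp. pose proof Hp as (Hx0 & Hy0 & Hz0 & _).
  destruct (Hg _ Hp) as (a & b & c & H & HX).
  assert (Hu : xyz2 (x, y, z) <> 0) by (unfold xyz2; repeat apply Cmult_neq_0; auto).
  do 3 eexists. split.
  - apply (diff3_mult g (fun p => / xyz2 p)); [exact H|].
    apply (diff3_comp Cinv xyz2); [apply cdiff_inv; exact Hu|apply diff3_xyz2].
  - set (v := / (xyz2 (x, y, z) * xyz2 (x, y, z))). set (gp := g (x, y, z)).
    match goal with |- ?t = _ => replace t with (lin3 a b c (X (x, y, z)) * / xyz2 (x, y, z)) end.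
    + rewrite HX. ring.
    + unfold lin3, X; simpl. ring.
Qed.

(** The vanishing on the line [y = z = d] forces the constant [c] of
    [xyz2_estimate] to be 0.  The quotient by [xyz2] is again a bounded first
    integral on the same polydisc and vanishes on the same line, so the estimate
    can be iterated without loss of domain. *)
Lemma flat_power g r d :
  (0 < r <= 1)%R -> (0 < d < r)%R -> integral_on r g ->
  (forall x : C, x <> 0 -> (Cmod x < r)%R -> g (x, RtoC d, RtoC d) = 0) ->
  forall n M, bounded_on r M g ->
  forall p, off_axes r p ->
    (Cmod (g p) <= M * (64 / (r * r * r * r) * Cmod (xyz2 p)) ^ n)%R.
Proof.
  intros Hr Hd Hg Hz n. revert g Hg Hz. set (K := (64 / (r * r * r * r))%R).
  assert (HK : (0 < K)%R) by (apply Rdiv_lt_0_compat; [lra|repeat apply Rmult_lt_0_compat; lra]).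
  assert (HdC : RtoC d <> 0) by (apply RtoC_neq_0; lra).
  assert (Hdm : Cmod d = d) by (rewrite Cmod_R, Rabs_pos_eq; lra).
  induction n as [|n IH]; intros g Hg Hz M HM; refine (C3_intro _ _); intros x y z Hp.
  { simpl. rewrite Rmult_1_r. apply HM, Hp. }
  pose proof (bounded_on_pos g r M ltac:(lra) HM) as HM0.
  destruct (xyz2_estimate g r M Hr Hg HM) as [c Hc]. fold K in Hc.
  assert (Hc0 : c = 0).
  { apply (eq_of_close _ _ (K * M * r)). intros e He.
    destruct (Cmod_real_half r e ltac:(lra) He) as (B0 & B1 & B2).
    specialize (Hc (RtoC (e * r / 2), RtoC d, RtoC d)). rewrite Hz in Hc by (auto; lra).
    specialize (Hc ltac:(repeat split; auto; lra)).
    replace (c - 0) with (- (0 - c)) by ring. rewrite Cmod_opp.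
    eapply Rle_trans; [exact Hc|]. rewrite !Rmult_assoc. apply Rmult_le_compat_l; [lra|].
    apply Rmult_le_compat_l; auto. unfold xyz2. rewrite !Cmod_mult, B1, Hdm.
    assert (0 <= d * (d * d) <= 1)%R by nra.
    assert (0 < e * r)%R by nra. nra. }
  subst c.
  assert (Hgu : bounded_on r (K * M) (fun p => g p * / xyz2 p)).
  { refine (C3_intro _ _). clear x y z Hp; intros x y z Hq. pose proof Hq as (Hx0 & Hy0 & Hz0 & _).
    assert (Hu : xyz2 (x, y, z) <> 0) by (unfold xyz2; repeat apply Cmult_neq_0; auto).
    pose proof (proj1 (Cmod_gt_0 _) Hu).
    rewrite Cmod_mult, Cmod_inv by auto. specialize (Hc _ Hq).
    replace (g (x, y, z) - 0) with (g (x, y, z)) in Hc by ring.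
    apply Rle_div_l; auto. }
  specialize (IH _ (integral_div_xyz2 g r Hg)).
  specialize (IH ltac:(intros v Hv0 Hv; cbv beta; rewrite Hz by auto; ring) (K * M)%R Hgu (x, y, z) Hp).
  pose proof Hp as (Hx0 & Hy0 & Hz0 & _).
  assert (Hu : xyz2 (x, y, z) <> 0) by (unfold xyz2; repeat apply Cmult_neq_0; auto).
  pose proof (proj1 (Cmod_gt_0 _) Hu).
  cbv beta in IH. rewrite Cmod_mult, Cmod_inv in IH by auto.
  apply (proj1 (Rle_div_l _ _ _ H)) in IH.
  eapply Rle_trans; [exact IH|]. simpl. apply Req_le. ring.
Qed.

(** * First integrals as functions of [x y z^2] *)

Lemma X_xyz2 (x y z : C) : lin3 (y * (z * z)) (x * (z * z)) (x * y * (z + z)) (X (x, y, z)) = 0.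
Proof. unfold lin3, X; simpl. ring. Qed.

Lemma nonzero_near (x : C) (r e : R) : (Cmod x < r)%R -> (0 < e)%R ->
  exists x' : C, x' <> 0 /\ (Cmod x' < r)%R /\ (Cmod (x' - x) < e)%R.
Proof.
  intros Hx He. pose proof (Cmod_ge_0 x).
  destruct (classic (x = 0)) as [E|E].
  - subst x. set (d := Rmin (r / 2) (e / 2)).
    assert (0 < d)%R by (apply Rmin_case; lra).
    pose proof (Rmin_l (r / 2) (e / 2)). pose proof (Rmin_r (r / 2) (e / 2)). fold d in H1, H2.
    exists (RtoC d). replace (RtoC d - 0) with (RtoC d) by ring.
    rewrite Cmod_R, Rabs_pos_eq by lra. split; [apply RtoC_neq_0; lra|lra].
  - exists x. replace (x - x) with (RtoC 0) by ring. rewrite Cmod_0. auto.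
Qed.

(** [phi] is read off the restriction of [f] to the line [y = z = d], on which
    [xyz2] is the coordinate [x] up to a factor.  The difference
    [f - phi(xyz2)] is then flat along the coordinate planes by [flat_power],
    hence zero where [K * |xyz2| < 1]. *)
Lemma first_integral_factor (f : C3 -> C_NormedModule) :
  first_integral X f ->
  exists phi : C -> C, 
    locally origin3 (fun p => f p = phi (xyz2 p) /\ exists l, cdiff phi (xyz2 p) l).
Proof.
  intros [Hhol HX].
  apply locally3_iff in Hhol. destruct Hhol as [d1 [Hd1 Hhol]].
  apply locally3_iff in HX. destruct HX as [d2 [Hd2 HX]].
  assert (Eo : forall q, sub3 q origin3 = q).
  { refine (C3_intro _ _). intros x y z. unfold sub3, origin3; simpl.
    apply injective_projections; [apply injective_projections|]; simpl; ring. }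
  assert (Ho : norm3 (sub3 origin3 origin3) = 0%R).
  { rewrite Eo. unfold norm3, origin3; simpl. rewrite Cmod_0. ring. }
  assert (Hol : forall q, (norm3 q < d1)%R -> exists a b c, diff3 f q a b c).
  { intros q Hq. destruct (Hhol q) as [l Hl]; [rewrite Eo; exact Hq|].
    destruct (is_differential_diff3 f q l Hl) as (a & b & c & _ & H). exists a, b, c. exact H. }
  destruct (Hol origin3) as (a0 & b0 & c0 & H0); [rewrite <- (Eo origin3), Ho; exact Hd1|].
  destruct (diff3_continuous f origin3 a0 b0 c0 H0 1%R ltac:(lra)) as [d3 [Hd3 Hcont]].
  set (M := (Cmod (f origin3) + 1)%R).
  set (r0 := (Rmin 1 (Rmin d1 (Rmin d2 d3)) / 4)%R).
  assert (Hr0 : (0 < r0 <= 1)%R /\ (4 * r0 <= d1)%R /\ (4 * r0 <= d2)%R /\ (4 * r0 <= d3)%R).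
  { unfold r0.
    pose proof (Rmin_l 1 (Rmin d1 (Rmin d2 d3))). pose proof (Rmin_r 1 (Rmin d1 (Rmin d2 d3))).
    pose proof (Rmin_l d1 (Rmin d2 d3)). pose proof (Rmin_r d1 (Rmin d2 d3)).
    pose proof (Rmin_l d2 d3). pose proof (Rmin_r d2 d3).
    assert (0 < Rmin 1 (Rmin d1 (Rmin d2 d3)))%R by (repeat apply Rmin_case; lra). lra. }
  destruct Hr0 as (Hr0 & R1 & R2 & R3). clearbody r0.
  assert (Poly : forall x y z : C, (Cmod x < r0)%R -> (Cmod y < r0)%R -> (Cmod z < r0)%R ->
    (exists a b c, diff3 f (x, y, z) a b c /\ lin3 a b c (X (x, y, z)) = 0) /\ (Cmod (f (x, y, z)) <= M)%R).
  { intros x y z Hx Hy Hz.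
    assert (N : (norm3 (x, y, z) < 3 * r0)%R) by (unfold norm3; simpl; lra).
    split.
    - destruct (Hol (x, y, z)) as (a & b & c & H); [lra|]. exists a, b, c. split; auto.
      apply (HX (x, y, z)); [rewrite Eo; lra|exact H].
    - specialize (Hcont (x, y, z)). rewrite Eo in Hcont. specialize (Hcont ltac:(lra)).
      pose proof (Cmod_triangle_rev (f (x, y, z)) (f origin3)). unfold M. lra. }
  (* on the polydisc of radius [r], [|xyz2| <= r^4 < d^3 r0]: [phi] is defined *)
  set (r := (r0 / 16)%R). set (d := (r / 2)%R).
  assert (Hr : (0 < r <= 1)%R) by (unfold r; lra).
  assert (Hd : (0 < d < r)%R) by (unfold d; lra).
  assert (HdC : RtoC d <> 0) by (apply RtoC_neq_0; lra).
  assert (Hdm : Cmod d = d) by (rewrite Cmod_R, Rabs_pos_eq; lra).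
  assert (Hd3' : (0 < d * d * d)%R) by (repeat apply Rmult_lt_0_compat; lra).
  set (phi := fun v : C => f (v / (d * d * d), RtoC d, RtoC d)).
  set (RR := (d * d * d * r0)%R).
  assert (Harg : forall v : C, (Cmod v < RR)%R -> (Cmod (v / (RtoC d * d * d)) < r0)%R).
  { intros v Hv. rewrite Cmod_div, !Cmod_mult, Hdm by (repeat apply Cmult_neq_0; auto).
    apply Rlt_div_l; [exact Hd3'|]. unfold RR in Hv. lra. }
  assert (Hphi : forall v : C, (Cmod v < RR)%R -> exists l, cdiff phi v l).
  { intros v Hv. destruct (Poly (v / (RtoC d * d * d)) d d) as [(a & b & c & H & _) _];
      [apply Harg; auto|rewrite Hdm; unfold r in Hd; lra|rewrite Hdm; unfold r in Hd; lra|].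
    assert (E : forall s : C, (0 + s * (/ (RtoC d * d * d)), RtoC d + s * 0, RtoC d + s * 0) = (s / (RtoC d * d * d), RtoC d, RtoC d)).
    { intros s. apply injective_projections; [apply injective_projections|]; simpl; unfold Cdiv; ring. }
    exists (lin3 a b c (/ (RtoC d * d * d), RtoC 0, RtoC 0)).
    apply cdiff_ext with (fun s : C => f (0 + s * (/ (RtoC d * d * d)), RtoC d + s * 0, RtoC d + s * 0)).
    { intros s. unfold phi. rewrite E. reflexivity. }
    apply (diff3_slice f (RtoC 0, RtoC d, RtoC d) (/ (RtoC d * d * d), RtoC 0, RtoC 0)).
    simpl. rewrite E. exact H. }
  assert (Hu : forall x y z : C, (Cmod x < r)%R -> (Cmod y < r)%R -> (Cmod z < r)%R -> (Cmod (xyz2 (x, y, z)) < RR)%R).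
  { intros x y z Hx Hy Hz. unfold xyz2. rewrite !Cmod_mult.
    pose proof (Cmod_ge_0 x). pose proof (Cmod_ge_0 y). pose proof (Cmod_ge_0 z).
    assert (E : RR = (2 * (r * r * (r * r)))%R) by (unfold RR, d, r; field).
    rewrite E.
    assert (Cmod x * Cmod y <= r * r)%R by (apply Rmult_le_compat; lra).
    assert (Cmod z * Cmod z <= r * r)%R by (apply Rmult_le_compat; lra).
    assert (0 <= Cmod x * Cmod y)%R by nra. assert (0 <= Cmod z * Cmod z)%R by nra.
    assert (Cmod x * Cmod y * (Cmod z * Cmod z) <= r * r * (r * r))%R by (apply Rmult_le_compat; lra).
    assert (0 < r * r)%R by nra. assert (0 < r * r * (r * r))%R by nra. lra. }
  set (G := fun p => f p - phi (xyz2 p)).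
  assert (HGd : forall x y z : C, (Cmod x < r)%R -> (Cmod y < r)%R -> (Cmod z < r)%R ->
     exists a b c, diff3 G (x, y, z) a b c /\ lin3 a b c (X (x, y, z)) = 0).
  { intros x y z Hx Hy Hz. destruct (Hphi (xyz2 (x, y, z))) as [l Hl]; [apply Hu; auto|].
    destruct (Poly x y z) as [(a & b & c & H & HXf) _]; try (unfold r in *; lra).
    do 3 eexists. split.
    - apply (diff3_minus f (fun p => phi (xyz2 p))); [exact H|].
      apply (diff3_comp phi xyz2); [exact Hl|apply diff3_xyz2].
    - match goal with |- ?t = _ => replace t with
        (lin3 a b c (X (x, y, z)) - l * lin3 (y * (z * z)) (x * (z * z)) (x * y * (z + z)) (X (x, y, z))) end.
      + rewrite HXf, X_xyz2. ring.
      + unfold lin3; simpl. ring. }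
  assert (HGi : integral_on r G).
  { refine (C3_intro _ _). intros x y z (_ & _ & _ & Hx & Hy & Hz). apply HGd; auto. }
  assert (HGb : bounded_on r (2 * M) G).
  { refine (C3_intro _ _). intros x y z (_ & _ & _ & Hx & Hy & Hz). unfold G.
    eapply Rle_trans; [apply Cmod_triangle_sub|].
    destruct (Poly x y z) as [_ B1]; try (unfold r in *; lra).
    destruct (Poly (xyz2 (x, y, z) / (RtoC d * d * d)) d d) as [_ B2];
      [apply Harg, Hu; auto|rewrite Hdm; unfold r in Hd; lra|rewrite Hdm; unfold r in Hd; lra|].
    fold (phi (xyz2 (x, y, z))) in B2. lra. }
  assert (HGz : forall x : C, x <> 0 -> (Cmod x < r)%R -> G (x, RtoC d, RtoC d) = 0).
  { intros x _ _. unfold G, phi, xyz2.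
    replace (x * d * (RtoC d * d) / (RtoC d * d * d)) with x by (field; auto). ring. }
  set (K := (64 / (r * r * r * r))%R).
  assert (HK : (0 < K)%R) by (apply Rdiv_lt_0_compat; [lra|repeat apply Rmult_lt_0_compat; lra]).
  set (r2 := Rmin r (/ (2 * K))).
  assert (Hr2 : (0 < r2)%R) by (apply Rmin_case; [lra|apply Rinv_0_lt_compat; lra]).
  assert (Hr2r : (r2 <= r)%R) by apply Rmin_l.
  assert (Hr2K : (K * r2 <= 1 / 2)%R).
  { apply Rle_trans with (K * / (2 * K))%R; [apply Rmult_le_compat_l; [lra|apply Rmin_r]|].
    apply Req_le. field. lra. }
  assert (HG0 : forall x y z : C, x <> 0 -> y <> 0 -> z <> 0 ->
     (Cmod x < r2)%R -> (Cmod y < r2)%R -> (Cmod z < r2)%R -> G (x, y, z) = 0).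
  { intros x y z Hx0 Hy0 Hz0 Hx Hy Hz. apply Cmod_eq_0. apply Rle_antisym; [|apply Cmod_ge_0].
    apply (le_all_eps _ (2 * M)). intros e He.
    assert (Hq : (0 <= K * Cmod (xyz2 (x, y, z)) <= 1 / 2)%R).
    { pose proof (Cmod_ge_0 (xyz2 (x, y, z))). split; [apply Rmult_le_pos; lra|].
      apply Rle_trans with (K * r2)%R; [|exact Hr2K]. apply Rmult_le_compat_l; [lra|].
      unfold xyz2. rewrite !Cmod_mult.
      pose proof (Cmod_ge_0 x). pose proof (Cmod_ge_0 y). pose proof (Cmod_ge_0 z).
      assert (Cmod y * (Cmod z * Cmod z) <= 1)%R.
      { assert (Cmod z * Cmod z <= 1)%R by nra. assert (0 <= Cmod z * Cmod z)%R by nra. nra. }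
      assert (0 <= Cmod y * (Cmod z * Cmod z))%R by (repeat apply Rmult_le_pos; lra).
      rewrite Rmult_assoc. nra. }
    destruct (pow_lt_1_zero (K * Cmod (xyz2 (x, y, z)))
      (Rabs_def1 (K * Cmod (xyz2 (x, y, z))) 1 ltac:(lra) ltac:(lra)) e He) as [n Hn].
    specialize (Hn n (le_n _)). rewrite Rabs_pos_eq in Hn by (apply pow_le; lra).
    eapply Rle_trans; [apply (flat_power G r d Hr Hd HGi HGz n (2 * M) HGb)|].
    - repeat split; auto; lra.
    - fold K. apply Rmult_le_compat_l; [|lra]. pose proof (Cmod_ge_0 (f origin3)). unfold M; lra. }
  assert (HG : forall x y z : C, (Cmod x < r2)%R -> (Cmod y < r2)%R -> (Cmod z < r2)%R -> G (x, y, z) = 0).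
  { intros x y z Hx Hy Hz. apply Cmod_eq_0. apply Rle_antisym; [|apply Cmod_ge_0].
    apply (le_all_eps _ 1). intros e He.
    destruct (HGd x y z) as (a & b & c & H & _); try lra.
    destruct (diff3_continuous G (x, y, z) a b c H e He) as [dd [Hdd Hc]].
    destruct (nonzero_near x r2 (dd / 3) Hx ltac:(lra)) as (x' & Hx0 & Hx' & Hxx).
    destruct (nonzero_near y r2 (dd / 3) Hy ltac:(lra)) as (y' & Hy0 & Hy' & Hyy).
    destruct (nonzero_near z r2 (dd / 3) Hz ltac:(lra)) as (z' & Hz0 & Hz' & Hzz).
    specialize (Hc (x', y', z')). unfold norm3, sub3 in Hc; simpl in Hc.
    specialize (Hc ltac:(lra)). rewrite HG0 in Hc by auto.
    replace (0 - G (x, y, z)) with (- G (x, y, z)) in Hc by ring.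
    rewrite Cmod_opp in Hc. lra. }
  exists phi. apply locally3_iff. exists r2. split; auto.
  refine (C3_intro _ _). intros x y z Hq. rewrite Eo in Hq. unfold norm3 in Hq; simpl in Hq.
  pose proof (Cmod_ge_0 x). pose proof (Cmod_ge_0 y). pose proof (Cmod_ge_0 z).
  split.
  - apply C_minus_eq_0. apply (HG x y z); lra.
  - apply Hphi, Hu; lra.
Qed.

(** Two functions of [xyz2] have proportional differentials at every point. *)
Lemma no_independent_integrals :
  ~ exists f1 f2 : C3 -> C_NormedModule,
       first_integral X f1 /\ first_integral X f2 /\ independent f1 f2.
Proof.
  intros (f1 & f2 & H1 & H2 & Hind). apply Hind.
  destruct (first_integral_factor f1 H1) as [phi1 F1].
  destruct (first_integral_factor f2 H2) as [phi2 F2].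
  apply locally_locally in F1. apply locally_locally in F2.
  generalize (filter_and _ _ F1 F2). apply filter_imp.
  assert (D : forall (f : C3 -> C_NormedModule) phi x y z l,
    locally (x, y, z) (fun p : C3 => f p = phi (xyz2 p) /\ exists l, cdiff phi (xyz2 p) l) ->
    is_differential f (x, y, z) l ->
    exists k, forall v, l v = k * lin3 (y * (z * z)) (x * (z * z)) (x * y * (z + z)) v).
  { intros f phi x y z l Hloc Hl.
    destruct (locally_singleton _ _ Hloc) as [_ [k Hk]].
    destruct (is_differential_diff3 f _ l Hl) as (a & b & c & El & Hd).
    assert (Hd' : diff3 f (x, y, z) (k * (y * (z * z))) (k * (x * (z * z))) (k * (x * y * (z + z)))).
    { apply diff3_ext_loc with (fun p => phi (xyz2 p)).
      - revert Hloc. apply filter_imp. intros p [E _]. symmetry. exact E.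
      - apply (diff3_comp phi xyz2); [exact Hk|apply diff3_xyz2]. }
    destruct (diff3_unique _ _ _ _ _ _ _ _ Hd Hd') as (-> & -> & ->).
    exists k. intros v. rewrite El. unfold lin3. C_ring. }
  refine (C3_intro _ _). intros x y z [L1 L2] l1 l2 D1 D2 v w.
  destruct (D f1 phi1 x y z l1 L1 D1) as [k1 E1].
  destruct (D f2 phi2 x y z l2 L2 D2) as [k2 E2].
  rewrite !E1, !E2. ring.
Qed.

Lemma xyz2_first_integral : first_integral X xyz2.
Proof.
  split.
  - apply (filter_forall (F := locally origin3)). refine (C3_intro _ _). intros x y z. eexists. apply diff3_xyz2.
  - apply (filter_forall (F := locally origin3)). refine (C3_intro _ _). intros x y z l Hl.
    destruct (is_differential_diff3 xyz2 _ l Hl) as (a & b & c & El & Hd).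
    destruct (diff3_unique _ _ _ _ _ _ _ _ Hd (diff3_xyz2 x y z)) as (-> & -> & ->).
    rewrite El. apply X_xyz2.
Qed.

Lemma xyz2_not_constant : ~ constant_germ xyz2.
Proof.
  intros [c Hc]. apply locally3_iff in Hc. destruct Hc as [d [Hd Hc]].
  assert (E0 : xyz2 origin3 = c).
  { apply Hc. unfold norm3, sub3, origin3; simpl.
    replace (RtoC 0 - RtoC 0) with (RtoC 0) by ring. rewrite Cmod_0. lra. }
  set (t := RtoC (d / 4)). assert (Ht : t <> 0) by (apply RtoC_neq_0; lra).
  assert (E1 : xyz2 (t, t, t) = c).
  { apply Hc. unfold norm3, sub3, origin3; simpl.
    replace (t - RtoC 0) with t by ring. unfold t. rewrite Cmod_R, Rabs_pos_eq; lra. }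
  rewrite <- E0 in E1. unfold xyz2, origin3 in E1.
  assert (E2 : t * t * (t * t) = 0) by (rewrite E1; ring).
  revert E2. repeat apply Cmult_neq_0; auto.
Qed.

(** * The holonomy map *)

(** With [c = 2 pi i], the holonomy.  It preserves [x y], and [w = x^2 y] becomes
    [w / (1 + c w)], which makes the family additive in [c]: see [shear_step]. *)
Definition shear (c : C) (p : C2) : C2 :=
  let '(x, y) := p in (x / (1 + c * (x * x * y)), y * (1 + c * (x * x * y))).

Definition two_pi_i : C := RtoC (2 * PI) * Ci.

Lemma cis_plus a b : cis (a + b) = cis a * cis b.
Proof. unfold cis. rewrite cos_plus, sin_plus. apply injective_projections; simpl; ring. Qed.

Lemma cis_0 : cis 0 = 1.
Proof. unfold cis. rewrite cos_0, sin_0. reflexivity. Qed.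

Lemma cis_2PI : cis (2 * PI) = 1.
Proof. unfold cis. rewrite cos_2PI, sin_2PI. reflexivity. Qed.

Lemma cis_6PI t : cis (6 * PI * t) = cis (2 * PI * t) * cis (2 * PI * t) * cis (2 * PI * t).
Proof. rewrite <- !cis_plus. f_equal. ring. Qed.

Lemma is_deriv_affine (v : C) (t : R) : is_deriv_RC (fun t : R => 1 + v * t) t v.
Proof.
  eapply is_deriv_RC_eq.
  - apply (is_deriv_RC_plus (fun _ => RtoC 1) (fun t : R => v * t)%C).
    apply is_deriv_RC_const.
    apply (is_deriv_RC_mult (fun _ => v) (fun t => RtoC t)).
    apply is_deriv_RC_const. apply is_deriv_RC_R.
  - ring.
Qed.

(** The solution is [x = x0 exp (- 2 pi i t) / D], [y = y0 exp (- 2 pi i t) D] with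
    [D = 1 + 2 pi i w t]. *)
Lemma shear_is_lift (x0 y0 : C) :
  (Cmod (two_pi_i * (x0 * x0 * y0)) < 1)%R -> holonomy_lift (x0, y0) (shear two_pi_i (x0, y0)).
Proof.
  intros Hw. set (w := x0 * x0 * y0) in *. set (v := two_pi_i * w) in *.
  assert (HD : forall t : R, (0 <= t <= 1)%R -> 1 + v * t <> 0).
  { intros t Ht E. assert (E2 : v * t = - (1)) by (replace (v * t) with ((1 + v * t) - 1) by ring; rewrite E; ring).
    apply (f_equal Cmod) in E2. rewrite Cmod_opp, Cmod_1, Cmod_mult, Cmod_R, Rabs_pos_eq in E2 by lra.
    pose proof (Cmod_ge_0 v). nra. }
  set (e := fun t : R => / cis (2 * PI * t)).
  assert (He : forall t, is_deriv_RC e t (- two_pi_i * e t)).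
  { intros t. eapply is_deriv_RC_eq.
    - apply is_deriv_RC_inv; [apply is_deriv_RC_cis|apply cis_neq_0].
    - unfold e, two_pi_i. field. apply cis_neq_0. }
  assert (He3 : forall t, cis (6 * PI * t) * (e t * e t * e t) = 1).
  { intros t. rewrite cis_6PI. unfold e. field. apply cis_neq_0. }
  assert (E0 : e 0%R = 1).
  { unfold e. rewrite Rmult_0_r, cis_0. field. }
  assert (E1 : e 1%R = 1).
  { unfold e. rewrite Rmult_1_r, cis_2PI. field. }
  assert (Epi : RtoC 2 * PI * Ci = two_pi_i) by (unfold two_pi_i; rewrite RtoC_mult; reflexivity).
  exists (fun t : R => x0 * e t * / (1 + v * t)), (fun t : R => y0 * e t * (1 + v * t)).
  split; [|split].
  - rewrite E0. replace (1 + v * 0) with (RtoC 1) by ring. f_equal; field.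
  - rewrite E1. unfold shear. fold w. fold v. replace (1 + v * 1) with (1 + v) by ring.
    f_equal; unfold Cdiv; ring.
  - intros t Ht. specialize (HD t Ht). specialize (He3 t). rewrite Epi.
    set (W := cis (6 * PI * t) * (x0 * e t * / (1 + v * t) * (x0 * e t * / (1 + v * t))) * (y0 * e t * (1 + v * t))).
    assert (HW : two_pi_i * W = v * / (1 + v * t)).
    { transitivity (two_pi_i * w * (cis (6 * PI * t) * (e t * e t * e t)) * / (1 + v * t)).
      - unfold W, w. field. exact HD.
      - rewrite He3. unfold v. ring. }
    split.
    + apply (is_deriv_RC_eq _ _ (- two_pi_i * (x0 * e t * / (1 + v * t)) - (x0 * e t * / (1 + v * t)) * (v * / (1 + v * t)))).
      * eapply is_deriv_RC_eq.
        -- apply is_deriv_RC_mult; [apply is_deriv_RC_mult; [apply (is_deriv_RC_const x0)|apply He]|].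
           apply is_deriv_RC_inv; [apply is_deriv_affine|exact HD].
        -- cbv beta. field. exact HD.
      * rewrite <- HW. ring.
    + apply (is_deriv_RC_eq _ _ (- two_pi_i * (y0 * e t * (1 + v * t)) + (y0 * e t * (1 + v * t)) * (v * / (1 + v * t)))).
      * eapply is_deriv_RC_eq.
        -- apply is_deriv_RC_mult; [apply is_deriv_RC_mult; [apply (is_deriv_RC_const y0)|apply He]|].
           apply is_deriv_affine.
        -- cbv beta. field. exact HD.
      * rewrite <- HW. ring.
Qed.

Lemma bounded_C (f : R -> C) : (forall t, (0 <= t <= 1)%R -> continuous f t) ->
  exists M, forall t, (0 <= t <= 1)%R -> (Cmod (f t) <= M)%R.
Proof.
  intros H. destruct (continuity_ab_maj (fun t => Cmod (f t)) 0 1) as [s [Hs _]]; [lra| |].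
  - intros t Ht. apply continuity_pt_filterlim. apply filterlim_locally. intros eps.
    destruct (proj1 (continuous_RC f t) (H t Ht) eps (cond_pos eps)) as [d [Hd Hd']].
    exists (mkposreal d Hd). intros s Hs. specialize (Hd' s Hs).
    change (Rabs (Cmod (f s) - Cmod (f t)) < eps)%R.
    pose proof (Cmod_triangle_rev (f s) (f t)). pose proof (Cmod_triangle_rev (f t) (f s)) as T.
    rewrite Cmod_sub_sym in T. apply Rabs_def1; lra.
  - exists (Cmod (f s)). exact Hs.
Qed.

(** The squared modulus [N] of a solution satisfies [N' <= 2 M N]. *)
Lemma gronwall_zero (a k : R -> C) (M : R) :
  (forall t, (0 <= t <= 1)%R -> is_deriv_RC a t (k t * a t)) ->
  (forall t, (0 <= t <= 1)%R -> (Cmod (k t) <= M)%R) -> a 0%R = 0 ->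
  forall t, (0 <= t <= 1)%R -> a t = 0.
Proof.
  intros Ha Hk H0 t Ht.
  set (N := fun s => (fst (a s) * fst (a s) + snd (a s) * snd (a s))%R).
  set (dN := fun s => (2 * (fst (a s) * fst (k s * a s)%C + snd (a s) * snd (k s * a s)%C))%R).
  assert (HN : forall s, (0 <= s <= 1)%R -> is_derive N s (dN s)).
  { intros s Hs.
    pose proof (is_deriv_RC_fst _ _ _ (Ha s Hs)) as A1.
    pose proof (is_deriv_RC_snd _ _ _ (Ha s Hs)) as A2.
    replace (dN s) with (plus (fst (k s * a s)%C * fst (a s) + fst (a s) * fst (k s * a s)%C)%R
                              (snd (k s * a s)%C * snd (a s) + snd (a s) * snd (k s * a s)%C)%R).
    - apply (is_derive_plus (V := R_NormedModule)); apply Derive.is_derive_mult; assumption.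
    - unfold dN, plus; simpl. ring. }
  assert (Hd : forall s, (0 <= s <= 1)%R -> (dN s <= 2 * M * N s)%R).
  { intros s Hs. specialize (Hk s Hs).
    assert (E : dN s = (2 * fst (k s) * N s)%R) by (unfold dN, N; simpl; ring).
    rewrite E. assert (0 <= N s)%R by (unfold N; nra).
    apply Rmult_le_compat_r; auto.
    pose proof (re_le_Cmod (k s)) as Hre. unfold Re in Hre. pose proof (Rle_abs (fst (k s))). lra. }
  set (P := fun s => (N s * exp (- (2 * M) * s))%R).
  assert (HP : forall s, (0 <= s <= 1)%R -> is_derive P s ((dN s - 2 * M * N s) * exp (- (2 * M) * s))%R).
  { intros s Hs.
    replace ((dN s - 2 * M * N s) * exp (- (2 * M) * s))%R
      with (dN s * exp (- (2 * M) * s) + N s * (- (2 * M) * exp (- (2 * M) * s)))%R by ring.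
    apply (Derive.is_derive_mult N (fun s => exp (- (2 * M) * s))%R); [apply HN; auto|].
    pose proof (is_deriv_RC_fst _ _ _ (is_deriv_RC_exp (- (2 * M)) s)) as E. simpl in E.
    replace (- (2 * M) * exp (- (2 * M) * s))%R with (- (2 * M) * exp (- (2 * M) * s) - 0 * 0)%R by ring.
    exact E. }
  assert (HP0 : P 0%R = 0%R) by (unfold P, N; rewrite H0; simpl; ring).
  assert (HPt : (P t <= 0)%R).
  { destruct (Req_dec t 0) as [->|Hn]; [lra|].
    destruct (MVT_gen P 0 t (fun s => (dN s - 2 * M * N s) * exp (- (2 * M) * s))%R) as [c [Hc E]].
    - rewrite Rmin_left, Rmax_right by lra. intros s Hs. apply HP; lra.
    - rewrite Rmin_left, Rmax_right by lra. intros s Hs.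
      apply continuity_pt_filterlim. apply (ex_derive_continuous (V := R_NormedModule)).
      eexists. apply HP; lra.
    - rewrite Rmin_left, Rmax_right in Hc by lra. rewrite HP0 in E.
      specialize (Hd c ltac:(lra)). pose proof (exp_pos (- (2 * M) * c)).
      assert ((dN c - 2 * M * N c) * exp (- (2 * M) * c) <= 0)%R by nra. nra. }
  assert (HNt : (N t <= 0)%R).
  { unfold P in HPt. pose proof (exp_pos (- (2 * M) * t)). nra. }
  unfold N in HNt. apply injective_projections; simpl; nra.
Qed.

(** Uniqueness for the equation of the lift: [W D - w0] and [y exp (2 pi i t) - y0 D]
    solve linear equations with zero initial value, and [x D exp (2 pi i t)] is
    constant. *)
Lemma lift_is_shear (p q : C2) :
  holonomy_lift p q -> 1 + two_pi_i * (fst p * fst p * snd p) <> 0 -> q = shear two_pi_i p.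
Proof.
  intros (x & y & Hp & Hq & H) HD. subst p q. simpl in HD.
  set (c := two_pi_i) in *. set (w0 := x 0%R * x 0%R * y 0%R) in *.
  assert (Epi : RtoC 2 * PI * Ci = c) by (unfold c, two_pi_i; rewrite RtoC_mult; reflexivity).
  rewrite Epi in H.
  set (W := fun t : R => cis (6 * PI * t) * (x t * x t) * y t).
  assert (Hx : forall t, (0 <= t <= 1)%R -> is_deriv_RC x t (- c * x t * (1 + W t))) by (intros t Ht; apply (H t Ht)).
  assert (Hy : forall t, (0 <= t <= 1)%R -> is_deriv_RC y t (- c * y t * (1 - W t))) by (intros t Ht; apply (H t Ht)).
  clear H.
  assert (He : forall t, is_deriv_RC (fun t => cis (2 * PI * t)) t (c * cis (2 * PI * t))).
  { intros t. apply is_deriv_RC_cis. }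
  assert (HW : forall t, (0 <= t <= 1)%R -> is_deriv_RC W t (- c * W t * W t)).
  { intros t Ht. eapply is_deriv_RC_eq.
    - apply is_deriv_RC_mult; [|apply Hy; auto].
      apply is_deriv_RC_mult; [apply is_deriv_RC_cis|].
      apply is_deriv_RC_mult; apply Hx; auto.
    - cbv beta.
      replace (RtoC (6 * PI)) with (3 * RtoC (2 * PI)) by (rewrite <- RtoC_mult; f_equal; ring).
      replace (3 * RtoC (2 * PI) * Ci) with (3 * c) by (unfold c, two_pi_i; ring).
      unfold W. ring. }
  destruct (bounded_C W) as [M HM].
  { intros t Ht. eapply is_deriv_RC_continuous. apply HW; auto. }
  assert (HcM : forall t, (0 <= t <= 1)%R -> (Cmod (c * W t) <= Cmod c * M)%R).
  { intros t Ht. rewrite Cmod_mult. apply Rmult_le_compat_l; [apply Cmod_ge_0|apply HM; auto]. }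
  assert (W0 : W 0%R = w0).
  { unfold W, w0. rewrite Rmult_0_r, cis_0. ring. }
  assert (Ha : forall t : R, (0 <= t <= 1)%R -> W t * (1 + c * w0 * t) - w0 = 0).
  { apply (gronwall_zero (fun t : R => W t * (1 + c * w0 * t) - w0) (fun t => - (c * W t)) (Cmod c * M)).
    - intros t Ht. eapply is_deriv_RC_eq.
      + apply (is_deriv_RC_plus (fun t : R => W t * (1 + c * w0 * t))%C (fun _ => - w0)); [|apply is_deriv_RC_const].
        apply is_deriv_RC_mult; [apply HW; auto|apply is_deriv_affine].
      + cbv beta. ring.
    - intros t Ht. rewrite Cmod_opp. apply HcM; auto.
    - rewrite W0. ring. }
  assert (Hy1 : forall t : R, (0 <= t <= 1)%R -> y t * cis (2 * PI * t) - y 0%R * (1 + c * w0 * t) = 0).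
  { apply (gronwall_zero (fun t : R => y t * cis (2 * PI * t) - y 0%R * (1 + c * w0 * t)) (fun t => c * W t) (Cmod c * M)).
    - intros t Ht. eapply is_deriv_RC_eq.
      + apply (is_deriv_RC_plus (fun t : R => y t * cis (2 * PI * t))%C (fun t : R => - (y 0%R * (1 + c * w0 * t)))%C).
        * apply is_deriv_RC_mult; [apply Hy; auto|apply He].
        * apply (is_derive_opp (V := C_R_NormedModule)).
          apply (is_deriv_RC_mult (fun _ => y 0%R) (fun t : R => 1 + c * w0 * t)%C).
          apply is_deriv_RC_const. apply is_deriv_affine.
      + change (- c * y t * (1 - W t) * cis (2 * PI * t) + y t * (c * cis (2 * PI * t)) +
         - (0 * (1 + c * w0 * t) + y 0%R * (c * w0)) =
         c * W t * (y t * cis (2 * PI * t) - y 0%R * (1 + c * w0 * t))).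
        replace w0 with (W t * (1 + c * w0 * t)) at 2 by (apply C_minus_eq_0, Ha; auto). ring.
    - exact HcM.
    - rewrite !Rmult_0_r, cis_0. ring. }
  assert (Hx1 : x 0%R * (1 + c * w0 * 0%R) * cis (2 * PI * 0) = x 1%R * (1 + c * w0 * 1%R) * cis (2 * PI * 1)).
  { apply (is_deriv_RC_zero_const (fun t : R => x t * (1 + c * w0 * t) * cis (2 * PI * t))); [lra|].
    intros t Ht. eapply is_deriv_RC_eq.
    - apply is_deriv_RC_mult; [|apply He].
      apply is_deriv_RC_mult; [apply Hx; auto|apply is_deriv_affine].
    - cbv beta.
      transitivity (- c * x t * cis (2 * PI * t) * (W t * (1 + c * w0 * t) - w0)); [ring|].
      rewrite Ha by auto. ring. }
  specialize (Hy1 1%R ltac:(lra)). apply C_minus_eq_0 in Hy1.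
  rewrite Rmult_1_r, cis_2PI in *. rewrite Rmult_0_r, cis_0 in Hx1.
  unfold shear. fold w0. f_equal.
  - replace (x 0%R) with (x 1%R * (1 + c * w0)); [field; exact HD|].
    replace (x 0%R) with (x 0%R * (1 + c * w0 * 0) * 1) by ring. rewrite Hx1. ring.
  - replace (y 1%R) with (y 1%R * 1) by ring. rewrite Hy1. ring.
Qed.

(** * Holomorphy of the holonomy *)

Lemma holomorphic_mult (U : NormedModule C_AbsRing) (f g : U -> C_NormedModule) p :
  holomorphic_at f p -> holomorphic_at g p ->
  holomorphic_at (V := C_NormedModule) (fun q => Cmult (f q) (g q)) p.
Proof.
  intros [l Hl] [m Hm]. eexists. apply filterdiff_AbsRing.
  apply (filterdiff_mult_fct (K := C_AbsRing) f g p l m Cmult_comm);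
  apply filterdiff_AbsRing; assumption.
Qed.

Lemma holomorphic_plus (U : NormedModule C_AbsRing) (f g : U -> C_NormedModule) p :
  holomorphic_at f p -> holomorphic_at g p ->
  holomorphic_at (V := C_NormedModule) (fun q => Cplus (f q) (g q)) p.
Proof.
  intros [l Hl] [m Hm]. eexists.
  apply (filterdiff_plus_fct (V := C_NormedModule) f g l m); assumption.
Qed.

Lemma holomorphic_const (U : NormedModule C_AbsRing) (k : C) (p : U) :
  holomorphic_at (V := C_NormedModule) (fun _ => k) p.
Proof. eexists. apply (filterdiff_const (V := C_NormedModule) k). Qed.

Lemma holomorphic_inv (U : NormedModule C_AbsRing) (f : U -> C_NormedModule) p :
  holomorphic_at f p -> f p <> RtoC 0 ->
  holomorphic_at (V := C_NormedModule) (fun q => Cinv (f q)) p.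
Proof.
  intros [l Hl] H0. pose proof (cdiff_inv (f p) H0) as Hi. set (m := - / (f p * f p)) in Hi.
  exists (fun u => Cmult (l u) m).
  apply (filterdiff_comp' (V := C_NormedModule) (W := C_NormedModule) f Cinv p l (fun z => Cmult z m) Hl).
  apply is_differential_norm. split.
  - destruct (is_linear_scal_l (K := C_AbsRing) (V := AbsRing_NormedModule C_AbsRing) m) as [A B D].
    split; assumption.
  - intros eps He. destruct (Hi eps He) as [d [Hd Hd']]. exists d. split; auto.
    intros q Hq. specialize (Hd' q Hq). rewrite (Cmult_comm m) in Hd'. exact Hd'.
Qed.

Lemma holomorphic_pair (U : NormedModule C_AbsRing) (f g : U -> C_NormedModule) p :
  holomorphic_at f p -> holomorphic_at g p ->
  holomorphic_at (V := C2) (fun q => (f q, g q)) p.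
Proof.
  intros [l Hl] [m Hm]. exists (fun u => (l u, m u)).
  apply (filterdiff_comp'_2 (K := C_AbsRing) (U := C_NormedModule) (V := C_NormedModule) (W := C2)
    f g (fun a b => (a, b)) p l m (fun a b => (a, b)) Hl Hm).
  apply (filterdiff_ext (fun t : C2 => t)); [intros [a b]; reflexivity|].
  apply (filterdiff_ext_lin _ (fun t : C2 => t)); [apply filterdiff_id|intros [a b]; reflexivity].
Qed.

Lemma shear_holomorphic c (x y : C) :
  1 + c * (x * x * y) <> 0 -> holomorphic_at (U := C2) (V := C2) (shear c) (x, y).
Proof.
  intros H.
  assert (Hx : holomorphic_at (U := C2) (V := C_NormedModule) fst (x, y)).
  { exists fst. apply filterdiff_linear. apply is_linear_fst. }
  assert (Hy : holomorphic_at (U := C2) (V := C_NormedModule) snd (x, y)).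
  { exists snd. apply filterdiff_linear. apply is_linear_snd. }
  set (D := fun q : C2 => 1 + c * (fst q * fst q * snd q)).
  assert (HD : holomorphic_at (U := C2) (V := C_NormedModule) D (x, y)).
  { apply holomorphic_plus; [apply holomorphic_const|].
    apply holomorphic_mult; [apply holomorphic_const|].
    apply holomorphic_mult; [|exact Hy]. apply holomorphic_mult; exact Hx. }
  destruct (holomorphic_pair C2 (fun q => Cmult (fst q) (Cinv (D q))) (fun q => Cmult (snd q) (D q)) (x, y)) as [l Hl].
  - apply holomorphic_mult; [exact Hx|]. apply holomorphic_inv; [exact HD|exact H].
  - apply holomorphic_mult; [exact Hy|exact HD].
  - exists l. revert Hl. apply filterdiff_ext. intros [a b]. reflexivity.
Qed.

Definition box (r : R) (p : C2) : Prop := (Cmod (fst p) < r)%R /\ (Cmod (snd p) < r)%R.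

Lemma locally2_iff (x y : C) (P : C2 -> Prop) :
  locally (T := C2) (x, y) P <->
  exists d : R, (0 < d)%R /\ forall a b : C, (Cmod (a - x) < d)%R -> (Cmod (b - y) < d)%R -> P (a, b).
Proof.
  rewrite locally_norm_iff. split; intros [d [Hd H]].
  - exists (d / 2)%R. split; [lra|]. intros a b Ha Hb. apply H.
    destruct (norm_prod (K := C_AbsRing) (U := C_NormedModule) (V := C_NormedModule) (a - x) (b - y)) as [_ N].
    change (norm (V := C2) (a - x, b - y)%C < d)%R. eapply Rle_lt_trans; [exact N|].
    assert (Hs : (0 < sqrt 2)%R) by apply Rlt_sqrt2_0.
    assert (Hs2 : (sqrt 2 * sqrt 2 = 2)%R) by (apply sqrt_sqrt; lra).
    assert (Hs1 : (sqrt 2 < 2)%R) by nra.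
    change (sqrt 2 * Rmax (Cmod (a - x)) (Cmod (b - y)) < d)%R.
    assert (Rmax (Cmod (a - x)) (Cmod (b - y)) < d / 2)%R by (apply Rmax_lub_lt; auto).
    nra.
  - exists d. split; auto. intros [a b] Hq.
    destruct (norm_prod (K := C_AbsRing) (U := C_NormedModule) (V := C_NormedModule) (a - x) (b - y)) as [N _].
    change (Rmax (Cmod (a - x)) (Cmod (b - y)) <= norm (V := C2) (a - x, b - y)%C)%R in N.
    change (norm (V := C2) (a - x, b - y)%C < d)%R in Hq.
    pose proof (Rmax_l (Cmod (a - x)) (Cmod (b - y))). pose proof (Rmax_r (Cmod (a - x)) (Cmod (b - y))).
    apply H; lra.
Qed.

Lemma C2_intro (P : C2 -> Prop) : (forall x y : C, P (x, y)) -> forall p, P p.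
Proof. intros H [x y]. exact (H x y). Qed.

Lemma locally_origin2 (P : C2 -> Prop) :
  locally origin2 P <-> exists d : R, (0 < d)%R /\ forall p, box d p -> P p.
Proof.
  unfold origin2. rewrite locally2_iff. split; intros [d [Hd H]]; exists d; split; auto.
  - refine (C2_intro _ _). intros x y [Hx Hy]. simpl in *. apply H.
    + replace (x - 0) with x by ring. exact Hx.
    + replace (y - 0) with y by ring. exact Hy.
  - intros a b Ha Hb. apply H. split; simpl.
    + replace a with (a - 0) by ring. exact Ha.
    + replace b with (b - 0) by ring. exact Hb.
Qed.

Lemma open_box r : open (T := C2) (box r).
Proof.
  refine (C2_intro _ _). intros x y [Hx Hy]. simpl in *. apply locally2_iff.
  exists (Rmin (r - Cmod x) (r - Cmod y)). split; [apply Rmin_case; lra|].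
  intros a b Ha Hb.
  pose proof (Rlt_le_trans _ _ _ Ha (Rmin_l _ _)). pose proof (Rlt_le_trans _ _ _ Hb (Rmin_r _ _)).
  pose proof (Cmod_triangle_rev a x). pose proof (Cmod_triangle_rev b y).
  split; simpl; lra.
Qed.

(** The constant 8 is a bound for [2 PI]. *)
Lemma box_w (x y : C) (r : R) : (r <= 1 / 4)%R -> box r (x, y) ->
  (Cmod (two_pi_i * (x * x * y)) <= 8 * (r * r * r))%R /\ (8 * (r * r * r) <= 1 / 8)%R.
Proof.
  intros Hr [Hx Hy]; simpl in *. pose proof (Cmod_ge_0 x). pose proof (Cmod_ge_0 y).
  unfold two_pi_i. rewrite !Cmod_mult, Cmod_Ci, Cmod_R.
  pose proof PI_pos. pose proof PI_4. rewrite Rabs_pos_eq by lra.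
  assert (Cmod x * Cmod x <= r * r)%R by (apply Rmult_le_compat; lra).
  assert (0 <= Cmod x * Cmod x)%R by nra.
  assert (Cmod x * Cmod x * Cmod y <= r * r * r)%R by (apply Rmult_le_compat; lra).
  assert (0 <= Cmod x * Cmod x * Cmod y)%R by (apply Rmult_le_pos; auto).
  assert (r * r <= 1 / 16)%R by nra. split; nra.
Qed.

Lemma near_one (v : C) : (Cmod v <= 1 / 8)%R ->
  1 + v <> 0 /\ (1 / 2 <= Cmod (1 + v) <= 2)%R.
Proof.
  intros H. pose proof (Cmod_triangle 1 v) as T1. pose proof (Cmod_triangle_rev 1 (- v)) as T2.
  rewrite Cmod_opp, Cmod_1 in *. replace (1 - - v) with (1 + v) in T2 by ring.
  split; [apply Cmod_gt_0; lra|lra].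
Qed.

Lemma shear_box c (x y : C) (r : R) :
  (Cmod (c * (x * x * y)) <= 1 / 8)%R -> box r (x, y) -> box (2 * r) (shear c (x, y)).
Proof.
  intros H [Hx Hy]; simpl in *. destruct (near_one _ H) as [H0 H1].
  set (D := 1 + c * (x * x * y)) in *.
  pose proof (Cmod_ge_0 x). pose proof (Cmod_ge_0 y).
  unfold box, shear; simpl. fold D. split.
  - rewrite Cmod_div by auto. apply Rlt_div_l; [lra|]. nra.
  - rewrite Cmod_mult. nra.
Qed.

Lemma shear_inverse c (x y : C) :
  1 + c * (x * x * y) <> 0 -> shear (- c) (shear c (x, y)) = (x, y).
Proof.
  intros H. unfold shear. set (D := 1 + c * (x * x * y)) in *.
  assert (E : 1 + - c * (x / D * (x / D) * (y * D)) = / D).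
  { transitivity ((D - c * (x * x * y)) / D); [field; auto|].
    unfold D. field. exact H. }
  rewrite E. f_equal; field; auto.
Qed.

(** * Orbits and iterates of the holonomy *)

Lemma holonomy_is_shear h : is_holonomy h ->
  exists r : R, (0 < r <= 1 / 4)%R /\ forall p, box r p -> h p = shear two_pi_i p.
Proof.
  intros H. apply locally_origin2 in H. destruct H as [d [Hd H]].
  exists (Rmin d (1 / 4)). split; [split; [apply Rmin_case; lra|apply Rmin_r]|].
  refine (C2_intro _ _). intros x y Hp.
  apply lift_is_shear.
  - apply H. destruct Hp as [A B]. pose proof (Rmin_l d (1 / 4)). split; lra.
  - apply near_one. destruct (box_w x y _ (Rmin_r _ _) Hp) as [A B]. simpl. lra.
Qed.

Lemma shear_is_holonomy : is_holonomy (shear two_pi_i).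
Proof.
  apply locally_origin2. exists (1 / 4)%R. split; [lra|].
  refine (C2_intro _ _). intros x y Hp. apply shear_is_lift.
  destruct (box_w x y _ (Rle_refl _) Hp). lra.
Qed.

Lemma origin_in_box r : (0 < r)%R -> box r origin2.
Proof. intros H. split; simpl; rewrite Cmod_0; auto. Qed.

Lemma holonomy_admissible h r :
  (0 < r <= 1 / 4)%R -> (forall p, box r p -> h p = shear two_pi_i p) ->
  admissible h (shear (- two_pi_i)) (box (r / 2)).
Proof.
  intros Hr Hh.
  assert (Hw : forall x y : C, box (r / 2) (x, y) -> (Cmod (two_pi_i * (x * x * y)) <= 1 / 8)%R).
  { intros x y Hp. destruct (box_w x y (r / 2) ltac:(lra) Hp). lra. }
  assert (Hw' : forall x y : C, box (r / 2) (x, y) -> (Cmod (- two_pi_i * (x * x * y)) <= 1 / 8)%R).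
  { intros x y Hp. replace (- two_pi_i * (x * x * y)) with (- (two_pi_i * (x * x * y))) by ring.
    rewrite Cmod_opp. auto. }
  assert (Hsub : forall p, box (r / 2) p -> box r p).
  { intros p [A B]. split; lra. }
  assert (Hinv : forall p, box (r / 2) p -> shear (- two_pi_i) (h p) = p /\ h (shear (- two_pi_i) p) = p).
  { refine (C2_intro _ _). intros x y Hp. split.
    - rewrite Hh by auto. apply shear_inverse. apply near_one. auto.
    - rewrite Hh.
      + replace two_pi_i with (- - two_pi_i) at 1 by ring. apply shear_inverse. apply near_one. auto.
      + replace r with (2 * (r / 2))%R by field. apply shear_box; auto. }
  split; [apply open_box|]. split; [apply origin_in_box; lra|]. split; [|split; [exact Hinv|split]].
  - refine (C2_intro _ _). intros x y Hp. split.
    + destruct (shear_holomorphic two_pi_i x y) as [l Hl]; [apply near_one; auto|].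
      exists l. revert Hl. apply filterdiff_ext_locally.
      generalize (open_box (r / 2) (x, y) Hp). apply filter_imp. intros q Hq. symmetry; auto.
    + apply shear_holomorphic. apply near_one. auto.
  - intros p q Hp Hq E. rewrite <- (proj1 (Hinv p Hp)), <- (proj1 (Hinv q Hq)), E. reflexivity.
  - intros p q Hp Hq E. rewrite <- (proj2 (Hinv p Hp)), <- (proj2 (Hinv q Hq)), E. reflexivity.
Qed.

Lemma holonomy_is_Diff h : is_holonomy h -> is_Diff h.
Proof.
  intros H. destruct (holonomy_is_shear h H) as (r & Hr & Hh).
  destruct (holonomy_admissible h r Hr Hh) as (A1 & A2 & A3 & A4 & _).
  assert (S0 : forall c, shear c origin2 = origin2).
  { intros c. unfold shear, origin2. replace (1 + c * (RtoC 0 * 0 * 0)) with (RtoC 1) by ring.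
    f_equal; [field|ring]. }
  exists (shear (- two_pi_i)).
  assert (L : locally origin2 (box (r / 2))) by (apply A1; exact A2).
  split; [rewrite Hh, S0; [reflexivity|apply origin_in_box; lra]|].
  split; [apply S0|].
  split; [|split; [|split]]; unfold holomorphic_near, germ_eq; revert L; apply filter_imp; intros p Hp.
  - apply A3; auto.
  - apply A3; auto.
  - apply A4; auto.
  - apply A4; auto.
Qed.

(** By [shear_step], the [k]-th iterate of the holonomy. *)
Definition iterate (p : C2) (k : Z) : C2 := shear (RtoC (IZR k) * two_pi_i) p.

Lemma shear_step (b c x y : C) :
  1 + b * (x * x * y) <> 0 -> 1 + (b + c) * (x * x * y) <> 0 ->
  shear c (shear b (x, y)) = shear (b + c) (x, y).
Proof.
  intros Hb Hc. unfold shear. set (D := 1 + b * (x * x * y)) in *.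
  set (E := 1 + (b + c) * (x * x * y)) in *.
  assert (F : 1 + c * (x / D * (x / D) * (y * D)) = E / D).
  { transitivity ((D + c * (x * x * y)) / D); [field; auto|].
    unfold D, E. field. exact Hb. }
  rewrite F. f_equal; field; auto.
Qed.

(** [1 + (b + c) w] is the product of [1 + b w] by the factor [1 + c w'] met at
    the image point, which is close to 1. *)
Lemma shear_w_step (b c x y : C) :
  1 + b * (x * x * y) <> 0 ->
  (Cmod (c * (fst (shear b (x, y)) * fst (shear b (x, y)) * snd (shear b (x, y)))) <= 1 / 8)%R ->
  1 + (b + c) * (x * x * y) <> 0.
Proof.
  intros Hb Hc E. unfold shear in Hc. simpl in Hc. set (D := 1 + b * (x * x * y)) in *.
  replace (c * (x / D * (x / D) * (y * D))) with (- (1)) in Hc.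
  - rewrite Cmod_opp, Cmod_1 in Hc. lra.
  - replace (- (1)) with ((1 + (b + c) * (x * x * y) - D) / D).
    + unfold D at 1. field. auto.
    + rewrite E. field. auto.
Qed.

(** As long as the points stay in the box no denominator vanishes, so a word acts
    as a single iterate. *)
Lemma word_is_iterate h r (x y : C) :
  (0 < r <= 1 / 4)%R -> (forall p, box r p -> h p = shear two_pi_i p) ->
  forall w k, 1 + (RtoC (IZR k) * two_pi_i) * (x * x * y) <> 0 ->
  in_domain h (shear (- two_pi_i)) (box (r / 2)) w (iterate (x, y) k) ->
  exists k', word_map h (shear (- two_pi_i)) w (iterate (x, y) k) = iterate (x, y) k'.
Proof.
  intros Hr Hh w. induction w as [|b w IH]; intros k Hk [Hdom1 Hdom2].
  { exists k. reflexivity. }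
  assert (HB : (Cmod (two_pi_i * (fst (iterate (x, y) k) * fst (iterate (x, y) k) * snd (iterate (x, y) k))) <= 1 / 8)%R).
  { destruct (box_w (fst (iterate (x, y) k)) (snd (iterate (x, y) k)) (r / 2)) as [A B]; [lra|exact Hdom1|lra]. }
  assert (Hnext : exists j, 1 + (RtoC (IZR j) * two_pi_i) * (x * x * y) <> 0 /\
    (if b then h (iterate (x, y) k) else shear (- two_pi_i) (iterate (x, y) k)) = iterate (x, y) j).
  { destruct b.
    - exists (k + 1)%Z.
      replace (RtoC (IZR (k + 1)) * two_pi_i) with (RtoC (IZR k) * two_pi_i + two_pi_i)
        by (rewrite plus_IZR, RtoC_plus; ring).
      assert (E : 1 + (RtoC (IZR k) * two_pi_i + two_pi_i) * (x * x * y) <> 0) by (apply shear_w_step; auto).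
      split; [exact E|]. rewrite Hh.
      + unfold iterate at 1. rewrite shear_step by auto. unfold iterate. f_equal.
        rewrite plus_IZR, RtoC_plus. ring.
      + destruct Hdom1 as [A B]. split; lra.
    - exists (k - 1)%Z.
      replace (RtoC (IZR (k - 1)) * two_pi_i) with (RtoC (IZR k) * two_pi_i + - two_pi_i)
        by (rewrite minus_IZR, RtoC_minus; ring).
      assert (E : 1 + (RtoC (IZR k) * two_pi_i + - two_pi_i) * (x * x * y) <> 0).
      { apply shear_w_step; auto.
        replace (- two_pi_i * _) with (- (two_pi_i * (fst (iterate (x, y) k) * fst (iterate (x, y) k) * snd (iterate (x, y) k))))
          by (unfold iterate; ring).
        rewrite Cmod_opp. exact HB. }
      split; [exact E|].
      unfold iterate at 1. rewrite shear_step by auto. unfold iterate. f_equal.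
      rewrite minus_IZR, RtoC_minus. ring. }
  destruct Hnext as (j & Hj & Ej). cbn [word_map]. rewrite Ej.
  destruct w as [|b' w].
  { exists j. reflexivity. }
  apply IH; [exact Hj|]. split.
  - specialize (Hdom2 1%nat ltac:(simpl; lia)). cbn [firstn word_map] in Hdom2. rewrite Ej in Hdom2. exact Hdom2.
  - intros l Hl. specialize (Hdom2 (S l) ltac:(simpl in *; lia)). cbn [firstn word_map] in Hdom2. rewrite Ej in Hdom2. exact Hdom2.
Qed.

Lemma iterate_0 p : iterate p 0 = p.
Proof.
  revert p. refine (C2_intro _ _). intros x y. unfold iterate, shear.
  replace (1 + RtoC 0 * two_pi_i * (x * x * y)) with (RtoC 1) by ring. f_equal; [field|ring].
Qed.

(** The second coordinate of the [k]-th iterate is [y (1 + 2 pi i k w)]: for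
    [w <> 0] it leaves the box as soon as [|k|] is large, and for [w = 0] the
    point is fixed. *)
Lemma holonomy_finite_orbits h : is_holonomy h -> has_finite_orbits h.
Proof.
  intros H. destruct (holonomy_is_shear h H) as (r & Hr & Hh).
  exists (shear (- two_pi_i)), (box (r / 2)). split; [apply holonomy_admissible; auto|].
  refine (C2_intro _ _). intros x y Hp.
  assert (Hit : forall q, orbit h (shear (- two_pi_i)) (box (r / 2)) (x, y) q ->
     box (r / 2) q /\ exists k, q = iterate (x, y) k).
  { intros q [Hq [w [Hd Hw]]]. split; [exact Hq|].
    rewrite <- (iterate_0 (x, y)) in Hd, Hw.
    destruct (word_is_iterate h r x y Hr Hh w 0%Z) as [k Hk]; [|exact Hd|].
    - replace (1 + RtoC 0 * two_pi_i * (x * x * y)) with (RtoC 1) by ring. apply RtoC_neq_0; lra.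
    - exists k. rewrite <- Hw. exact Hk. }
  set (v := two_pi_i * (x * x * y)).
  destruct (classic (x * x * y = 0)) as [E|E].
  { exists ((x, y) :: nil). intros q Hq. destruct (Hit q Hq) as [_ [k ->]]. left.
    unfold iterate, shear. rewrite E. replace (1 + _ * 0) with (RtoC 1) by ring.
    f_equal; [field|ring]. }
  assert (Hv : (0 < Cmod v)%R).
  { apply Cmod_gt_0. unfold v, two_pi_i. apply Cmult_neq_0; [apply Cmult_neq_0|exact E].
    - apply RtoC_neq_0. pose proof PI_pos; lra.
    - intros E1; apply (f_equal Cmod) in E1; rewrite Cmod_Ci, Cmod_0 in E1; lra. }
  assert (Hy : (0 < Cmod y)%R).
  { apply Cmod_gt_0. intros ->. apply E. ring. }
  destruct (INR_large ((r / Cmod y + 1) / Cmod v)) as [N [_ HN]].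
  exists (map (fun n => iterate (x, y) (Z.of_nat n - Z.of_nat N)) (seq 0 (2 * N + 1))).
  intros q Hq. destruct (Hit q Hq) as [[_ Hb] [k ->]].
  assert (Hk : (Rabs (IZR k) < INR N)%R).
  { eapply Rle_lt_trans; [|exact HN]. apply Rle_div_r; [exact Hv|].
    unfold iterate, shear in Hb. simpl in Hb. rewrite Cmod_mult in Hb.
    replace (RtoC (IZR k) * two_pi_i * (x * x * y)) with (RtoC (IZR k) * v) in Hb by (unfold v; ring).
    pose proof (Cmod_triangle_rev (RtoC (IZR k) * v) (- (1))) as T.
    replace (RtoC (IZR k) * v - - (1)) with (1 + RtoC (IZR k) * v) in T by ring.
    rewrite Cmod_opp, Cmod_1, Cmod_mult, Cmod_R in T.
    assert (Cmod (1 + RtoC (IZR k) * v) <= r / Cmod y)%R; [|lra].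
    apply Rle_div_r; [exact Hy|]. lra. }
  apply in_map_iff. exists (Z.to_nat (k + Z.of_nat N)).
  assert (Hk' : (- Z.of_nat N <= k <= Z.of_nat N)%Z).
  { rewrite INR_IZR_INZ in Hk. apply Rabs_def2 in Hk. destruct Hk as [K1 K2].
    rewrite <- opp_IZR in K2. apply lt_IZR in K1. apply lt_IZR in K2. lia. }
  split.
  - f_equal. lia.
  - apply in_seq. lia.
Qed.

Lemma word_power_germ h g n : is_holonomy h ->
  locally origin2 (fun p => word_map h g (repeat true n) p = iterate p (Z.of_nat n)).
Proof.
  intros H. destruct (holonomy_is_shear h H) as (r & Hr & Hh).
  induction n as [|n IH].
  { apply filter_forall. intros p. simpl. rewrite iterate_0. reflexivity. }
  apply locally_origin2 in IH. destruct IH as [d [Hd IH]]. apply locally_origin2.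
  set (N := (INR n + 2)%R). pose proof (pos_INR n) as Hn.
  set (e := Rmin (Rmin r (d / 2)) (/ (4 * N))).
  assert (He : (0 < e)%R).
  { repeat apply Rmin_case; try lra. apply Rinv_0_lt_compat. unfold N; lra. }
  pose proof (Rmin_l (Rmin r (d / 2)) (/ (4 * N))) as E1. pose proof (Rmin_r (Rmin r (d / 2)) (/ (4 * N))) as E2.
  fold e in E1, E2. pose proof (Rmin_l r (d / 2)). pose proof (Rmin_r r (d / 2)).
  assert (HeN : (N * e <= 1 / 4)%R).
  { apply Rle_trans with (N * / (4 * N))%R; [apply Rmult_le_compat_l; unfold N in *; lra|].
    apply Req_le. field. unfold N; lra. }
  exists e. split; [exact He|]. refine (C2_intro _ _). intros x y Hp.
  destruct (box_w x y e ltac:(lra) Hp) as [W1 W2].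
  simpl. rewrite Hh by (destruct Hp; split; simpl in *; lra).
  rewrite IH.
  2:{ replace d with (2 * (d / 2))%R by field. apply shear_box; [lra|]. destruct Hp; split; simpl in *; lra. }
  unfold iterate.
  assert (HN : (Cmod ((two_pi_i + RtoC (IZR (Z.of_nat n)) * two_pi_i) * (x * x * y)) <= 1 / 8)%R).
  { replace ((two_pi_i + RtoC (IZR (Z.of_nat n)) * two_pi_i) * (x * x * y))
      with (RtoC (1 + INR n) * (two_pi_i * (x * x * y))).
    2:{ rewrite <- INR_IZR_INZ, RtoC_plus. ring. }
    rewrite Cmod_mult, Cmod_R, Rabs_pos_eq by lra.
    apply Rle_trans with (N * (8 * (e * e * e)))%R.
    - apply Rmult_le_compat; try apply Cmod_ge_0; auto; unfold N; lra.
    - assert (e * e <= 1 / 16)%R by nra. assert (0 < e * e)%R by nra.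
      replace (N * (8 * (e * e * e)))%R with (8 * (N * e) * (e * e))%R by ring.
      assert (0 <= N * e)%R by (unfold N in *; nra). nra. }
  rewrite shear_step.
  - apply (f_equal (fun c => shear c (x, y))). change (Z.pos (Pos.of_succ_nat n)) with (Z.of_nat (S n)). rewrite <- !INR_IZR_INZ, S_INR, RtoC_plus. ring.
  - apply near_one. lra.
  - apply near_one. exact HN.
Qed.

(** Evaluated at one point of the diagonal, where [w <> 0]. *)
Lemma iterate_germ_inj n m :
  locally origin2 (fun p => iterate p (Z.of_nat n) = iterate p (Z.of_nat m)) -> n = m.
Proof.
  intros H. apply locally_origin2 in H. destruct H as [d [Hd H]].
  set (t := RtoC (d / 2)). assert (Ht : t <> 0) by (apply RtoC_neq_0; lra).
  assert (Htm : Cmod t = (d / 2)%R) by (unfold t; rewrite Cmod_R, Rabs_pos_eq; lra).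
  specialize (H (t, t) ltac:(split; simpl; lra)).
  apply (f_equal snd) in H. unfold iterate, shear in H.
  cbn [snd] in H. rename H into E.
  assert (E2 : RtoC (IZR (Z.of_nat n)) = RtoC (IZR (Z.of_nat m))).
  { assert (Hk : two_pi_i * (t * t * t) * t <> 0).
    { unfold two_pi_i. repeat apply Cmult_neq_0; auto.
      - apply RtoC_neq_0. pose proof PI_pos; lra.
      - intros E1; apply (f_equal Cmod) in E1; rewrite Cmod_Ci, Cmod_0 in E1; lra. }
    set (a := RtoC (IZR (Z.of_nat n))) in *. set (b := RtoC (IZR (Z.of_nat m))) in *.
    assert (E3 : (a - b) * (two_pi_i * (t * t * t) * t) = 0).
    { replace ((a - b) * (two_pi_i * (t * t * t) * t)) with
        (t * (1 + a * two_pi_i * (t * t * t)) - t * (1 + b * two_pi_i * (t * t * t))) by ring.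
      rewrite E. ring. }
    apply C_minus_eq_0. apply NNPP. intros Hab. revert E3. apply Cmult_neq_0; auto. }
  apply RtoC_inj, eq_IZR in E2. lia.
Qed.

(** The positive powers of the holonomy have pairwise different germs, which no
    finite list can represent. *)
Lemma holonomy_infinite h : is_holonomy h -> ~ generates_finite_subgroup h.
Proof.
  intros H (g & _ & L & HL).
  assert (Hc : forall n : nat, exists k, In k L /\ germ_eq origin2 (word_map h g (repeat true n)) k)
    by (intros n; apply HL).
  set (k := fun n => proj1_sig (constructive_indefinite_description _ (Hc n))).
  assert (Hk : forall n, In (k n) L /\ germ_eq origin2 (word_map h g (repeat true n)) (k n)).
  { intros n. exact (proj2_sig (constructive_indefinite_description _ (Hc n))). }
  assert (Hinj : Injective k).
  { intros n m E. apply iterate_germ_inj.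
    destruct (Hk n) as [_ G1]. destruct (Hk m) as [_ G2]. rewrite <- E in G2.
    pose proof (word_power_germ h g n H) as W1. pose proof (word_power_germ h g m H) as W2.
    generalize (filter_and _ _ (filter_and _ _ G1 G2) (filter_and _ _ W1 W2)).
    apply filter_imp. intros p [[A1 A2] [B1 B2]]. congruence. }
  pose proof (Injective_map_NoDup Hinj (seq_NoDup (S (length L)) 0)) as Hnd.
  assert (Hincl : incl (map k (seq 0 (S (length L)))) L).
  { intros f Hf. apply in_map_iff in Hf. destruct Hf as [n [<- _]]. apply Hk. }
  pose proof (NoDup_incl_length Hnd Hincl) as Hlen.
  rewrite length_map, length_seq in Hlen. lia.
Qed.

(** * The theorem *)

Theorem mainTheorem3 :
  (~ exists f1 f2 : C3 -> C_NormedModule,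
       first_integral X f1 /\ first_integral X f2 /\ independent f1 f2) /\
  (exists f : C3 -> C_NormedModule, first_integral X f /\ ~ constant_germ f) /\
  (exists h : C2 -> C2, is_holonomy h) /\
  (forall h : C2 -> C2, is_holonomy h ->
     is_Diff h /\ has_finite_orbits h /\ ~ generates_finite_subgroup h).
Proof.
  split; [exact no_independent_integrals|].
  split; [exists xyz2; exact (conj xyz2_first_integral xyz2_not_constant)|].
  split; [exists (shear two_pi_i); exact shear_is_holonomy|].
  intros h Hh.
  exact (conj (holonomy_is_Diff h Hh)
    (conj (holonomy_finite_orbits h Hh) (holonomy_infinite h Hh))).
Qed.
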